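(* Let $k=s+\frac12$ with $s\in\mathbb Z$, and write $s=12a+b$ with $a\in\mathbb Z$ and $b\in\{6,8,9,10,11,12,13,14,15,16,17,19\}$. There are absolute positive constants $A\le 9$ and $B\le 109$ such that the following holds. Let $m$ be an integer with $m\ge A|a|+B$ and $m\equiv 0,(-1)^{s-1}\pmod 4$, and let $\{f_{2-k,i}\}$ be the canonical basis of $M^!_{2-k}$, indexed by the admissible indices $i$ for weight $2-k$ in increasing order. Then for any integer $M>3a+\frac{3m}4+\frac b2-C$, it is impossible that the Fourier coefficients of $q^m$ in each of the first $M$ basis elements $f_{2-k,i}$ with $i\not\equiv m\pmod 4$ simultaneously vanish.
   Context: Let $q=e^{2\pi i\tau}$ and $\vartheta(\tau)=\sum_{n\in\mathbb Z}q^{n^2}$. For a weight $\kappa=t+\frac12$, $t\in\mathbb Z$, $M^!_\kappa$ is the space of holomorphic functions on the upper half plane, possibly with poles at the cusps, transforming like $\vartheta^{2\kappa}$ under $\Gamma_0(4)$ and satisfying Kohnen's plus space condition (Fourier expansion $\sum_{(-1)^tn\equiv0,1\,(4)}a(n)q^n$). Write $t=6\ell+\frac{k'}2$ with $\ell\in\mathbb Z$, $k'\in\{0,4,6,8,10,14\}$; let $N_\kappa=2\ell$ if $\ell$ is even and $N_\kappa=2\ell-(-1)^t$ if $\ell$ is odd. An integer $i$ is an admissible index for weight $\kappa$ if $i\ge -N_\kappa$ and $(-1)^{t-1}i\equiv0,1\pmod4$; for each such $i$ the canonical basis element is $f_{\kappa,i}(\tau)=q^{-i}+\sum_{n>N_\kappa,\,(-1)^tn\equiv0,1\,(4)}a_\kappa(i,n)q^n\in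 M^!_\kappa$, and these form a basis of $M^!_\kappa$. The constant $C$ is: $C=1$ if $m$ and $b$ are even; $C=\frac32$ if $m$ is even and $b$ odd; $C=\frac34$ if $m$ is odd and $b\in\{6,8,9,10,11,13\}$; $C=\frac74$ if $m$ is odd and $b\in\{12,14,15,16,17,19\}$. *)

(* Defs.v *)
From Stdlib Require Import Reals ZArith List.
From Coquelicot Require Export Coquelicot.
Open Scope R_scope.

Definition Cexp (z : C) : C :=
  (exp (Re z) * cos (Im z), exp (Re z) * sin (Im z)).

Definition qpow (tau : C) (n : Z) : C :=
  Cexp (Cmult (Cmult (RtoC (2 * PI * IZR n)) Ci) tau).

(* theta(tau) = sum_{n in Z} q^{n^2} = 1 + 2 sum_{k >= 1} q^{k^2} *)
Definition theta (tau : C) : C :=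
  (1 + 2 * Series (fun k : nat => Re (qpow tau (Z.of_nat (S k) * Z.of_nat (S k)))),
   2 * Series (fun k : nat => Im (qpow tau (Z.of_nat (S k) * Z.of_nat (S k))))).

Definition Czpow (z : C) (n : Z) : C :=
  match n with
  | Z0 => RtoC 1
  | Zpos p => Cpow z (Pos.to_nat p)
  | Zneg p => Cinv (Cpow z (Pos.to_nat p))
  end.

Definition mobius (a b c d : Z) (tau : C) : C :=
  Cdiv (Cplus (Cmult (RtoC (IZR a)) tau) (RtoC (IZR b)))
       (Cplus (Cmult (RtoC (IZR c)) tau) (RtoC (IZR d))).

Definition in_Gamma0_4 (a b c d : Z) : Prop :=
  (a * d - b * c = 1)%Z /\ (4 | c)%Z.

(* Fourier coefficient of q^n of a 1-periodic function, computed on Im tau = 1 *)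
Definition fcoef (f : C -> C) (n : Z) : C :=
  RInt (V := C_R_CompleteNormedModule)
    (fun x : R => Cmult (f (x, 1)) (qpow (x, 1) (- n))) 0 1.

Definition plus_okb (t n : Z) : bool :=
  let r := ((if Z.even t then n else - n) mod 4)%Z in
  (Z.eqb r 0 || Z.eqb r 1)%bool.

(* weight kappa = t + 1/2 *)
Definition holo_on_H (f : C -> C) : Prop :=
  forall tau : C, 0 < Im tau -> ex_derive (K := C_AbsRing) (V := C_NormedModule) f tau.

Definition transforms_like_theta (t : Z) (f : C -> C) : Prop :=
  forall a b c d : Z, in_Gamma0_4 a b c d ->
  forall tau : C, 0 < Im tau ->
    f (mobius a b c d tau) =
    Cmult (Czpow (Cdiv (theta (mobius a b c d tau)) (theta tau)) (2 * t + 1)) (f tau).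

(* meromorphic (at worst poles) at every cusp: for every gamma in SL2(Z),
   |(c tau + d)^{-kappa} f(gamma tau)| = O(exp(N Im tau)) as Im tau -> oo *)
Definition poles_at_cusps (t : Z) (f : C -> C) : Prop :=
  forall a b c d : Z, (a * d - b * c = 1)%Z ->
  exists K N : R, forall tau : C, 1 <= Im tau ->
    Cmod (f (mobius a b c d tau)) <=
    K * exp (N * Im tau) *
    Rpower (Cmod (Cplus (Cmult (RtoC (IZR c)) tau) (RtoC (IZR d)))) (IZR t + / 2).

Definition plus_space (t : Z) (f : C -> C) : Prop :=
  forall n : Z, plus_okb t n = false -> fcoef f n = RtoC 0.

Definition in_Mshriek (t : Z) (f : C -> C) : Prop :=
  holo_on_H f /\ transforms_like_theta t f /\ poles_at_cusps t f /\ plus_space t f.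

(* t = 6 l + k'/2, k'/2 in {0,2,3,4,5,7} *)
Definition kp_half (t : Z) : Z :=
  match (t mod 6)%Z with
  | 1%Z => 7%Z
  | r => r
  end.
Definition ell (t : Z) : Z := ((t - kp_half t) / 6)%Z.
Definition Nk (t : Z) : Z :=
  if Z.even (ell t) then (2 * ell t)%Z
  else (2 * ell t - (if Z.even t then 1 else -1))%Z.

Definition admissibleb (t i : Z) : bool :=
  (Z.leb (- Nk t) i && plus_okb (t - 1) i)%bool.

Definition canonical (t i : Z) (f : C -> C) : Prop :=
  in_Mshriek t f /\ fcoef f (- i) = RtoC 1 /\
  forall n : Z, (n <= Nk t)%Z -> n <> (- i)%Z -> fcoef f n = RtoC 0.

Definition qualb (t m j : Z) : bool :=
  (admissibleb t j && negb (Z.eqb (j mod 4) (m mod 4)))%bool.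

(* number of qualifying indices strictly smaller than i (0-based position) *)
Definition rank (t m i : Z) : nat :=
  length (filter (fun k : nat => qualb t m (- Nk t + Z.of_nat k)%Z)
                 (seq 0 (Z.to_nat (i + Nk t)))).

Definition Cconst (m b : Z) : R :=
  if Z.even m then (if Z.even b then 1 else 3 / 2)
  else (if existsb (Z.eqb b) (6 :: 8 :: 9 :: 10 :: 11 :: 13 :: nil)%Z then 3 / 4 else 7 / 4).

Definition b_range : list Z := (6 :: 8 :: 9 :: 10 :: 11 :: 12 :: 13 :: 14 :: 15 :: 16 :: 17 :: 19 :: nil)%Z.

(* Main.v *)
Require Import Defs.
From Stdlib Require Import Reals ZArith List Lra Lia Classical ClassicalEpsilon FunctionalExtensionality.
From Coquelicot Require Import Coquelicot.
Open Scope R_scope.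

(** Put [t = 1 - s]. A form [f] of weight [t + 1/2] in the plus space is the sum of its even and odd parts,
    supported on the two admissible classes of exponents modulo 4; as functions of [4 tau] they form a
    vector-valued form of level one. Hence their Wronskian [w] has weight [2 t + 3] for SL2(Z) up to a character.
    It is compared with the nonvanishing form [D = x y (x^4 - y^4)] of weight 3, where [x] and [y] are the two
    parts of theta: if the parts of [f] vanish below the exponents [B0] and [B1] with [3 (B0 + B1) > 2 t + 3],
    then [w^12 / D^(4 (2 t + 3))] has weight 0 and vanishes at infinity, so [w = 0]. The two parts are then
    proportional, the shift of [tau] by 1/4 kills one of them, and the inversion law kills the other.

    Suppose that the coefficients of [q^m] vanish. Among [L + 1] consecutive basis elements whose indices lie
    in one class different from that of [m], some nontrivial combination kills the first [L] coefficients above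
    the gap in the class of [m]; when the next exponent is [m] itself, its coefficient vanishes for free. This
    one extra zero violates the estimate, so the combination is zero, which is impossible. The lower bound on
    [m] only serves to make the indices used fall among the first [M].

    The inversion law of theta follows from the quasi-periodicity of Jacobi's theta function [J(s, z)]: the
    product [e(s z^2) J(s, 2 s z)] has period 1 and is multiplied by an exponential when [z] is shifted by
    [-1/(2 s)], which determines its Fourier coefficients up to a common factor [c(s)]; by the heat equation
    [s c(s)^2] is constant. *)

Lemma Cmod_triangle_minus (a b : C) : Cmod (a - b) <= Cmod a + Cmod b.
Proof. unfold Cminus. rewrite <- (Cmod_opp b). apply Cmod_triangle. Qed.

Lemma Cmod_triangle_rev (a b : C) : Cmod a - Cmod b <= Cmod (a - b).
Proof.
  assert (Htriangle := Cmod_triangle (a - b) b).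
  replace (a - b + b)%C with a in Htriangle by ring. lra.
Qed.

Lemma Cmod_minus_sym (a b : C) : Cmod (a - b) = Cmod (b - a).
Proof. rewrite <- Cmod_opp. f_equal. ring. Qed.

Lemma C_eta (z : C) : z = (Re z + Ci * Im z)%C.
Proof. destruct z. apply injective_projections; simpl; ring. Qed.

Lemma Cmod_le_Re_Im (z : C) : Cmod z <= Rabs (Re z) + Rabs (Im z).
Proof.
  rewrite (C_eta z) at 1. eapply Rle_trans; [apply Cmod_triangle|].
  rewrite Cmod_mult, Cmod_Ci, !Cmod_R. lra.
Qed.

Lemma RtoC_neq_0 (r : R) : r <> 0 -> RtoC r <> RtoC 0.
Proof. intros Hr H. apply Hr, RtoC_inj, H. Qed.

Lemma Copp_neq_0 (z : C) : z <> RtoC 0 -> (- z)%C <> RtoC 0.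
Proof. intros Hz H. apply Hz. replace z with (- - z)%C by ring. rewrite H. ring. Qed.

Lemma Cinv_neq_0 (z : C) : z <> RtoC 0 -> (/ z)%C <> RtoC 0.
Proof. intros Hz H. apply C1_nz. rewrite <- (Cinv_r z Hz), H. ring. Qed.

Lemma Cmult_eq_reg_l (c a b : C) : c <> RtoC 0 -> (c * a)%C = (c * b)%C -> a = b.
Proof.
  intros Hc Hab. transitivity (/ c * (c * a))%C; [field; exact Hc|]. rewrite Hab. field. exact Hc.
Qed.

Lemma Ci_sqr : (Ci * Ci)%C = RtoC (-1).
Proof. apply injective_projections; simpl; ring. Qed.

Lemma Im_neq_0 (z : C) : 0 < Im z -> z <> RtoC 0.
Proof. intros Hz ->. simpl in Hz. lra. Qed.

Lemma Im_neg_inv (z : C) : Im (- / z) = Im z / Cmod z ^ 2.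
Proof. rewrite Cmod2_alt. destruct z. simpl. unfold Rdiv. ring. Qed.

Lemma Im_neg_inv_pos (z : C) : 0 < Im z -> 0 < Im (- / z).
Proof.
  intros Hz. rewrite Im_neg_inv. apply Rdiv_lt_0_compat; [exact Hz|].
  apply pow_lt, Cmod_gt_0, Im_neq_0, Hz.
Qed.

Lemma Im_div_4 (z : C) : Im (z / 4) = Im z / 4.
Proof. destruct z. simpl. field. Qed.

(** * Continuity and complex derivatives *)

Lemma continuous_AbsRing_C {T : UniformSpace} (f : T -> C) (x : T) :
  continuous (U := AbsRing_UniformSpace C_AbsRing) f x <->
  continuous (U := C_UniformSpace) f x.
Proof.
  split; intros Hf P HP; apply Hf; apply (locally_C (f x)); exact HP.
Qed.

Lemma continuous_Cplus {U : UniformSpace} (f g : U -> C) (x : U) :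
  continuous f x -> continuous g x -> continuous (fun u => f u + g u)%C x.
Proof. apply (continuous_plus (V := C_R_NormedModule)). Qed.

Lemma continuous_Cminus {U : UniformSpace} (f g : U -> C) (x : U) :
  continuous f x -> continuous g x -> continuous (fun u => f u - g u)%C x.
Proof. apply (continuous_minus (V := C_R_NormedModule)). Qed.

Lemma continuous_Cmult {U : UniformSpace} (f g : U -> C) (x : U) :
  continuous f x -> continuous g x -> continuous (fun u => f u * g u)%C x.
Proof.
  intros Hf Hg. apply continuous_AbsRing_C.
  apply (continuous_mult (K := C_AbsRing)); apply continuous_AbsRing_C; assumption.
Qed.

Notation is_Cderive := (is_derive (K := C_AbsRing) (V := C_NormedModule)).
Notation ex_Cderive := (ex_derive (K := C_AbsRing) (V := C_NormedModule)).

Lemma is_Cderive_AbsRing (f : C -> C) (z l : C) :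
  is_derive (K := C_AbsRing) (V := AbsRing_NormedModule C_AbsRing) f z l <-> is_Cderive f z l.
Proof.
  split; (intros [_ Hf]; split; [apply is_linear_scal_l|exact Hf]).
Qed.

Lemma is_Cderive_eps (f : C -> C) (z l : C) :
  is_Cderive f z l <->
  forall eps, 0 < eps -> exists delta, 0 < delta /\ forall w, Cmod (w - z) < delta ->
    Cmod (f w - f z - l * (w - z)) <= eps * Cmod (w - z).
Proof.
  assert (Hrem : forall w, minus (minus (f w) (f z)) (scal (minus w z) l) = (f w - f z - l * (w - z))%C).
  { intros w. change ((f w - f z - (w - z) * l)%C = (f w - f z - l * (w - z))%C). ring. }
  split.
  - intros [_ Hf] eps Heps.
    destruct (Hf z (fun P HP => HP) (mkposreal eps Heps)) as [delta Hdelta].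
    exists delta. split; [apply cond_pos|]. intros w Hw. rewrite <- Hrem. apply (Hdelta w Hw).
  - intros Hf. split; [apply is_linear_scal_l|]. intros y Hy eps.
    apply (is_filter_lim_locally_unique (V := AbsRing_NormedModule C_AbsRing)) in Hy. subst y.
    destruct (Hf eps (cond_pos eps)) as [delta [Hdelta Hrem_le]].
    exists (mkposreal delta Hdelta). intros w Hw. rewrite Hrem. apply (Hrem_le w Hw).
Qed.

Lemma is_Cderive_quadratic (f : C -> C) (z l : C) (K r : R) : 0 < r ->
  (forall w, Cmod (w - z) < r -> Cmod (f w - f z - l * (w - z)) <= K * Cmod (w - z) ^ 2) ->
  is_Cderive f z l.
Proof.
  intros Hr Hrem. apply is_Cderive_eps. intros eps Heps.
  assert (HK := Rabs_pos K).
  exists (Rmin r (eps / (Rabs K + 1))). split; [apply Rmin_pos; [auto|apply Rdiv_lt_0_compat; lra]|].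
  intros w Hw. assert (Hwr := Rlt_le_trans _ _ _ Hw (Rmin_l _ _)).
  assert (HwK := Rlt_le_trans _ _ _ Hw (Rmin_r _ _)).
  apply Rlt_div_r in HwK; [|lra]. assert (Hpos := Cmod_ge_0 (w - z)).
  apply Rle_trans with (1 := Hrem w Hwr). assert (HKabs := Rle_abs K). nra.
Qed.

Lemma is_Cderive_ext_loc (f g : C -> C) (z l : C) :
  locally (T := C_UniformSpace) z (fun w => f w = g w) -> is_Cderive f z l -> is_Cderive g z l.
Proof. intros Hfg. apply is_derive_ext_loc. apply locally_C. exact Hfg. Qed.

Lemma is_Cderive_ext (f g : C -> C) (z l : C) :
  (forall w, f w = g w) -> is_Cderive f z l -> is_Cderive g z l.
Proof. apply is_derive_ext. Qed.

Lemma is_Cderive_eq (f : C -> C) (z k l : C) : k = l -> is_Cderive f z k -> is_Cderive f z l.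
Proof. intros <-. auto. Qed.

Lemma is_Cderive_const (c z : C) : is_Cderive (fun _ => c) z (RtoC 0).
Proof. apply (is_derive_const (V := C_NormedModule)). Qed.

Lemma is_Cderive_id (z : C) : is_Cderive (fun w => w) z (RtoC 1).
Proof. apply is_Cderive_AbsRing. apply (is_derive_id (K := C_AbsRing)). Qed.

Lemma is_Cderive_plus (f g : C -> C) (z k l : C) :
  is_Cderive f z k -> is_Cderive g z l -> is_Cderive (fun w => f w + g w)%C z (k + l)%C.
Proof. apply (is_derive_plus (V := C_NormedModule)). Qed.

Lemma is_Cderive_minus (f g : C -> C) (z k l : C) :
  is_Cderive f z k -> is_Cderive g z l -> is_Cderive (fun w => f w - g w)%C z (k - l)%C.
Proof. apply (is_derive_minus (V := C_NormedModule)). Qed.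

Lemma is_Cderive_opp (f : C -> C) (z l : C) :
  is_Cderive f z l -> is_Cderive (fun w => - f w)%C z (- l)%C.
Proof. apply (is_derive_opp (V := C_NormedModule)). Qed.

Lemma is_Cderive_mult (f g : C -> C) (z k l : C) :
  is_Cderive f z k -> is_Cderive g z l -> is_Cderive (fun w => f w * g w)%C z (k * g z + f z * l)%C.
Proof.
  intros Hf Hg. apply is_Cderive_AbsRing.
  apply (is_derive_mult (K := C_AbsRing) f g); [apply is_Cderive_AbsRing, Hf|apply is_Cderive_AbsRing, Hg|].
  apply Cmult_comm.
Qed.

Lemma is_Cderive_scal (c : C) (f : C -> C) (z l : C) :
  is_Cderive f z l -> is_Cderive (fun w => c * f w)%C z (c * l)%C.
Proof.
  intros Hf. eapply is_Cderive_eq; [|apply is_Cderive_mult; [apply is_Cderive_const|exact Hf]]. cbv beta. ring.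
Qed.

Lemma is_Cderive_comp (f g : C -> C) (z k l : C) :
  is_Cderive g z k -> is_Cderive f (g z) l -> is_Cderive (fun w => f (g w)) z (k * l)%C.
Proof.
  intros Hg Hf. apply (is_derive_comp (V := C_NormedModule) f g); [exact Hf|].
  apply is_Cderive_AbsRing. exact Hg.
Qed.

Lemma is_Cderive_inv (f : C -> C) (z l : C) : f z <> RtoC 0 -> is_Cderive f z l ->
  is_Cderive (fun w => / f w)%C z (- l / (f z * f z))%C.
Proof.
  intros Hfz Hf.
  assert (Hinv : forall a, a <> RtoC 0 -> is_Cderive Cinv a (- / (a * a))%C).
  { clear. intros a Ha. assert (Hmod := proj1 (Cmod_gt_0 a) Ha).
    apply is_Cderive_quadratic with (2 / Cmod a ^ 3) (Cmod a / 2); [lra|]. intros w Hw.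
    assert (Hw_lower : Cmod a / 2 < Cmod w).
    { assert (Hrev := Cmod_triangle_rev a w). rewrite Cmod_minus_sym in Hrev. lra. }
    assert (Hw0 : w <> RtoC 0) by (apply Cmod_gt_0; lra).
    replace (/ w - / a - - / (a * a) * (w - a))%C with ((w - a) ^ 2 / (w * a ^ 2))%C
      by (simpl; field; auto).
    rewrite Cmod_div, Cmod_mult, !Cmod_pow by (apply Cmult_neq_0; [|apply Cpow_nz]; auto).
    unfold Rdiv. rewrite Rmult_comm. apply Rmult_le_compat_r; [apply pow2_ge_0|].
    apply Rle_trans with (/ (Cmod a / 2 * Cmod a ^ 2)).
    - apply Rinv_le_contravar; [apply Rmult_lt_0_compat; [lra|apply pow_lt; lra]|].
      apply Rmult_le_compat_r; [apply pow2_ge_0|lra].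
    - right. field. lra. }
  eapply is_Cderive_eq; [|exact (is_Cderive_comp Cinv f z _ _ Hf (Hinv _ Hfz))]. field. auto.
Qed.

Lemma ex_Cderive_const (c z : C) : ex_Cderive (fun _ => c) z.
Proof. eexists. apply is_Cderive_const. Qed.

Lemma ex_Cderive_id (z : C) : ex_Cderive (fun w => w) z.
Proof. eexists. apply is_Cderive_id. Qed.

Lemma ex_Cderive_plus (f g : C -> C) (z : C) :
  ex_Cderive f z -> ex_Cderive g z -> ex_Cderive (fun w => f w + g w)%C z.
Proof. intros [k Hk] [l Hl]. eexists. apply is_Cderive_plus; eassumption. Qed.

Lemma ex_Cderive_minus (f g : C -> C) (z : C) :
  ex_Cderive f z -> ex_Cderive g z -> ex_Cderive (fun w => f w - g w)%C z.
Proof. intros [k Hk] [l Hl]. eexists. apply is_Cderive_minus; eassumption. Qed.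

Lemma ex_Cderive_mult (f g : C -> C) (z : C) :
  ex_Cderive f z -> ex_Cderive g z -> ex_Cderive (fun w => f w * g w)%C z.
Proof. intros [k Hk] [l Hl]. eexists. apply is_Cderive_mult; eassumption. Qed.

Lemma ex_Cderive_scal (c : C) (f : C -> C) (z : C) : ex_Cderive f z -> ex_Cderive (fun w => c * f w)%C z.
Proof. intros [l Hl]. eexists. apply is_Cderive_scal, Hl. Qed.

Lemma ex_Cderive_comp (f g : C -> C) (z : C) :
  ex_Cderive g z -> ex_Cderive f (g z) -> ex_Cderive (fun w => f (g w)) z.
Proof. intros [k Hk] [l Hl]. eexists. apply is_Cderive_comp; eassumption. Qed.

Lemma ex_Cderive_inv (f : C -> C) (z : C) : f z <> RtoC 0 -> ex_Cderive f z -> ex_Cderive (fun w => / f w)%C z.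
Proof. intros Hz [l Hl]. eexists. apply is_Cderive_inv; eassumption. Qed.

Lemma is_Cderive_shift (f : C -> C) (z w l : C) :
  is_Cderive f (z + w)%C l -> is_Cderive (fun z => f (z + w)%C) z l.
Proof.
  intros Hf. eapply is_Cderive_eq; [|apply (is_Cderive_comp f (fun z => z + w)%C); [|exact Hf]].
  - apply Cmult_1_l.
  - eapply is_Cderive_eq; [|apply is_Cderive_plus; [apply is_Cderive_id|apply is_Cderive_const]]. ring.
Qed.

Lemma ex_Cderive_shift (f : C -> C) (z w : C) : ex_Cderive f (z + w)%C -> ex_Cderive (fun z => f (z + w)%C) z.
Proof. intros [l Hl]. eexists. apply is_Cderive_shift, Hl. Qed.

Lemma is_Cderive_dilate (f : C -> C) (c z l : C) :
  is_Cderive f (c * z)%C l -> is_Cderive (fun w => f (c * w)%C) z (c * l)%C.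
Proof.
  intros Hf. apply (is_Cderive_comp f (fun w => c * w)%C); [|exact Hf].
  eapply is_Cderive_eq; [|apply is_Cderive_scal, is_Cderive_id]. ring.
Qed.

Lemma is_Cderive_reflect (f : C -> C) (z l : C) : is_Cderive f (- z)%C l -> is_Cderive (fun w => f (- w)%C) z (- l)%C.
Proof.
  intros Hf. eapply is_Cderive_eq; [|apply (is_Cderive_comp f (fun w => - w)%C _ _ _ (is_Cderive_opp _ _ _
    (is_Cderive_id z)) Hf)].
  ring.
Qed.

Lemma is_Cderive_div_4 (z : C) : is_Cderive (fun w => w / 4)%C z (/ 4)%C.
Proof.
  eapply is_Cderive_eq; [|apply is_Cderive_mult; [apply is_Cderive_id|apply is_Cderive_const]]. cbv beta. ring.
Qed.

Lemma is_Cderive_neg_inv (z : C) : z <> RtoC 0 -> is_Cderive (fun w => - / w)%C z (/ (z * z))%C.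
Proof.
  intros Hz. eapply is_Cderive_eq; [|apply is_Cderive_opp, (is_Cderive_inv (fun w => w));
    [exact Hz|apply is_Cderive_id]].
  field. exact Hz.
Qed.

Lemma is_Cderive_unique (f : C -> C) (z k l : C) : is_Cderive f z k -> is_Cderive f z l -> k = l.
Proof.
  intros Hk Hl. rewrite <- (is_C_derive_unique f z k Hk). apply is_C_derive_unique, Hl.
Qed.

Lemma is_Cderive_C_derive (f : C -> C) (z : C) : ex_Cderive f z -> is_Cderive f z (C_derive f z).
Proof. apply C_derive_correct. exact z. Qed.

Lemma ex_Cderive_continuous (f : C -> C) (z : C) : ex_Cderive f z -> continuous f z.
Proof.
  intros Hf P HP. apply locally_C. apply (ex_derive_continuous (V := C_NormedModule) f z Hf P HP).
Qed.

Lemma continuous_Cinv {U : UniformSpace} (f : U -> C) (x : U) :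
  f x <> RtoC 0 -> continuous f x -> continuous (fun u => / f u)%C x.
Proof.
  intros Hfx Hf. apply (continuous_comp f Cinv); [exact Hf|].
  apply ex_Cderive_continuous. eexists. apply (is_Cderive_inv (fun w => w)); [exact Hfx|apply is_Cderive_id].
Qed.

(** * Integrals of complex-valued functions of a real variable *)

Notation CInt := (RInt (V := C_R_CompleteNormedModule)).
Notation ex_CInt := (ex_RInt (V := C_R_CompleteNormedModule)).
Notation is_CInt := (is_RInt (V := C_R_CompleteNormedModule)).

Lemma ex_CInt_continuous (f : R -> C) (a b : R) : (forall x, continuous f x) -> ex_CInt f a b.
Proof. intros Hf. apply (ex_RInt_continuous (V := C_R_CompleteNormedModule)). auto. Qed.

Lemma is_CInt_pair (f : R -> C) (a b : R) (l : C) :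
  is_RInt (fun x => Re (f x)) a b (Re l) -> is_RInt (fun x => Im (f x)) a b (Im l) -> is_CInt f a b l.
Proof.
  intros Hre Him. apply (is_RInt_fct_extend_pair (U := R_NormedModule) (V := R_NormedModule)); assumption.
Qed.

Lemma is_RInt_Re (f : R -> C) (a b : R) (l : C) :
  is_CInt f a b l -> is_RInt (fun x => Re (f x)) a b (Re l).
Proof. apply (is_RInt_fct_extend_fst (U := R_NormedModule) (V := R_NormedModule)). Qed.

Lemma is_RInt_Im (f : R -> C) (a b : R) (l : C) :
  is_CInt f a b l -> is_RInt (fun x => Im (f x)) a b (Im l).
Proof. apply (is_RInt_fct_extend_snd (U := R_NormedModule) (V := R_NormedModule)). Qed.

Lemma is_CInt_Cmult (c : C) (f : R -> C) (a b : R) (l : C) :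
  is_CInt f a b l -> is_CInt (fun x => c * f x)%C a b (c * l)%C.
Proof.
  intros Hf. apply is_RInt_Re in Hf as Hre. apply is_RInt_Im in Hf as Him.
  apply is_CInt_pair.
  - apply (is_RInt_minus (V := R_NormedModule)); apply (is_RInt_scal (V := R_NormedModule)); assumption.
  - apply (is_RInt_plus (V := R_NormedModule)); apply (is_RInt_scal (V := R_NormedModule)); assumption.
Qed.

Lemma CInt_Cmult (c : C) (f : R -> C) (a b : R) :
  ex_CInt f a b -> CInt (fun x => c * f x)%C a b = (c * CInt f a b)%C.
Proof.
  intros Hf. apply (is_RInt_unique (V := C_R_CompleteNormedModule)), is_CInt_Cmult.
  apply (RInt_correct (V := C_R_CompleteNormedModule)). exact Hf.
Qed.

Lemma CInt_plus (f g : R -> C) (a b : R) : ex_CInt f a b -> ex_CInt g a b ->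
  CInt (fun x => f x + g x)%C a b = (CInt f a b + CInt g a b)%C.
Proof. apply (RInt_plus (V := C_R_CompleteNormedModule)). Qed.

Lemma CInt_minus (f g : R -> C) (a b : R) : ex_CInt f a b -> ex_CInt g a b ->
  CInt (fun x => f x - g x)%C a b = (CInt f a b - CInt g a b)%C.
Proof. apply (RInt_minus (V := C_R_CompleteNormedModule)). Qed.

Lemma CInt_ext (f g : R -> C) (a b : R) :
  (forall x, Rmin a b < x < Rmax a b -> f x = g x) -> CInt f a b = CInt g a b.
Proof. apply (RInt_ext (V := C_R_CompleteNormedModule)). Qed.

Lemma CInt_Chasles (f : R -> C) (a b c : R) : ex_CInt f a b -> ex_CInt f b c ->
  (CInt f a b + CInt f b c)%C = CInt f a c.
Proof. apply (RInt_Chasles (V := C_R_CompleteNormedModule)). Qed.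

Lemma CInt_const (c : C) (a b : R) : CInt (fun _ => c) a b = (RtoC (b - a) * c)%C.
Proof. rewrite (RInt_const (V := C_R_CompleteNormedModule)). apply scal_R_Cmult. Qed.

Lemma CInt_shift (f : R -> C) (h a b : R) : ex_CInt f (a + h) (b + h) ->
  CInt (fun x => f (x + h)) a b = CInt f (a + h) (b + h).
Proof.
  intros Hf. assert (Hlin := RInt_comp_lin (V := C_R_CompleteNormedModule) f 1 h a b).
  rewrite !Rmult_1_l in Hlin. rewrite <- Hlin by exact Hf. apply CInt_ext. intros x _.
  rewrite Rmult_1_l. symmetry. apply (scal_one (V := C_R_CompleteNormedModule) (f (x + h))).
Qed.

Lemma Cmod_CInt_le (f : R -> C) (a b M : R) : a <= b -> ex_CInt f a b ->
  (forall x, a <= x <= b -> Cmod (f x) <= M) -> Cmod (CInt f a b) <= (b - a) * M.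
Proof.
  intros Hab Hf HM.
  assert (Hnorm : forall z : C, norm (V := C_R_CompleteNormedModule) z = Cmod z).
  { intros z. symmetry. apply Cmod_norm. }
  rewrite <- Hnorm. apply (norm_RInt_le_const (V := C_R_CompleteNormedModule) f a b); [exact Hab| |].
  - intros x Hx. rewrite Hnorm. auto.
  - apply (RInt_correct (V := C_R_CompleteNormedModule)). exact Hf.
Qed.

Lemma CInt_periodic (f : R -> C) (h : R) :
  (forall x, continuous f x) -> (forall x, f (x + 1) = f x) -> CInt f h (h + 1) = CInt f 0 1.
Proof.
  intros Hf Hper. assert (Hex : forall a b, ex_CInt f a b) by (intros; apply ex_CInt_continuous, Hf).
  rewrite <- (CInt_Chasles f h 0 (h + 1)), <- (CInt_Chasles f 0 1 (h + 1)) by apply Hex.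
  replace (CInt f 1 (h + 1)) with (CInt f 0 h).
  - rewrite (Cplus_comm (CInt f 0 1)), Cplus_assoc, CInt_Chasles by apply Hex.
    rewrite (RInt_point (V := C_R_CompleteNormedModule)). apply Cplus_0_l.
  - replace (CInt f 1 (h + 1)) with (CInt f (0 + 1) (h + 1)) by (f_equal; ring).
    rewrite <- CInt_shift by apply Hex. apply CInt_ext. intros x _. rewrite Hper. reflexivity.
Qed.

(** * The complex exponential *)

Lemma Cexp_plus (a b : C) : Cexp (a + b) = (Cexp a * Cexp b)%C.
Proof.
  unfold Cexp. rewrite re_plus, im_plus, exp_plus, cos_plus, sin_plus.
  apply injective_projections; simpl; ring.
Qed.

Lemma Cexp_0 : Cexp 0 = RtoC 1.
Proof. unfold Cexp. simpl. rewrite exp_0, cos_0, sin_0. apply injective_projections; simpl; ring. Qed.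

Lemma Cmod_Cexp (z : C) : Cmod (Cexp z) = exp (Re z).
Proof.
  apply Rsqr_inj; [apply Cmod_ge_0|left; apply exp_pos|].
  rewrite !Rsqr_pow2, Cmod2_alt. unfold Cexp. simpl Re. simpl Im.
  rewrite !Rpow_mult_distr, <- Rmult_plus_distr_l, <- !Rsqr_pow2, Rplus_comm, sin2_cos2. ring.
Qed.

Lemma Cexp_neq_0 (z : C) : Cexp z <> RtoC 0.
Proof. apply Cmod_gt_0. rewrite Cmod_Cexp. apply exp_pos. Qed.

Lemma Cexp_opp (z : C) : Cexp (- z) = (/ Cexp z)%C.
Proof.
  assert (Hz := Cexp_neq_0 z).
  replace (Cexp (- z)) with (Cexp (- z + z) / Cexp z)%C by (rewrite Cexp_plus; field; exact Hz).
  rewrite Cplus_comm, Cplus_opp_r, Cexp_0. field. exact Hz.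
Qed.

Lemma exp_le (x y : R) : x <= y -> exp x <= exp y.
Proof. intros [Hlt | ->]; [left; apply exp_increasing, Hlt|right; reflexivity]. Qed.

Lemma is_CInt_Cexp_segment (w : C) : is_CInt (fun t => w * Cexp (RtoC t * w))%C 0 1 (Cexp w - 1)%C.
Proof.
  destruct w as [a b].
  assert (Hderive : forall (F f : R -> R) (l : R), F 1 - F 0 = l ->
    (forall t, is_derive F t (f t)) -> (forall t, continuous f t) -> is_RInt f 0 1 l).
  { intros F f l <- HF Hf. apply (is_RInt_derive (V := R_CompleteNormedModule) F f); auto. }
  apply is_CInt_pair.
  - apply Hderive with (fun t => exp (t * a) * cos (t * b)).
    + simpl. rewrite !Rmult_1_l, !Rmult_0_l, exp_0, cos_0. ring.
    + intros t. simpl. auto_derive; auto. rewrite !Rmult_0_l, Rminus_0_r, Rplus_0_r. ring.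
    + intros t. apply (ex_derive_continuous (V := R_NormedModule)). simpl. auto_derive. auto.
  - apply Hderive with (fun t => exp (t * a) * sin (t * b)).
    + simpl. rewrite !Rmult_1_l, !Rmult_0_l, sin_0. ring.
    + intros t. simpl. auto_derive; auto. rewrite !Rmult_0_l, Rminus_0_r, Rplus_0_r. ring.
    + intros t. apply (ex_derive_continuous (V := R_NormedModule)). simpl. auto_derive. auto.
Qed.

Lemma Cmod_Cexp_segment_le (w : C) (t : R) : 0 <= t <= 1 -> Cmod (Cexp (t * w)) <= exp (Cmod w).
Proof.
  intros Ht. rewrite Cmod_Cexp, re_scal_l. apply exp_le.
  assert (Hre := re_le_Cmod w). apply Rabs_le_between in Hre. nra.
Qed.

Lemma Cmod_Cexp_minus_1_le (w : C) : Cmod (Cexp w - 1) <= Cmod w * exp (Cmod w).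
Proof.
  rewrite <- (is_RInt_unique (V := C_R_CompleteNormedModule) _ _ _ _ (is_CInt_Cexp_segment w)).
  replace (Cmod w * exp (Cmod w)) with ((1 - 0) * (Cmod w * exp (Cmod w))) by ring.
  apply Cmod_CInt_le; [lra|eexists; apply is_CInt_Cexp_segment|].
  intros t Ht. rewrite Cmod_mult. apply Rmult_le_compat_l; [apply Cmod_ge_0|].
  apply Cmod_Cexp_segment_le, Ht.
Qed.

Lemma Cmod_Cexp_taylor_le (w : C) : Cmod (Cexp w - 1 - w) <= Cmod w ^ 2 * exp (Cmod w).
Proof.
  assert (Hdistr : forall e : C, (w * (e - 1))%C = (w * e - w)%C) by (intros; ring).
  assert (Hint : is_CInt (fun t => w * (Cexp (RtoC t * w) - 1))%C 0 1 (Cexp w - 1 - w)%C).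
  { apply (is_RInt_ext (V := C_R_CompleteNormedModule) (fun t => minus (w * Cexp (RtoC t * w))%C w)).
    - intros t _. symmetry. apply Hdistr.
    - apply (is_RInt_minus (V := C_R_CompleteNormedModule)); [apply is_CInt_Cexp_segment|].
      assert (Hconst := is_RInt_const (V := C_R_CompleteNormedModule) 0 1 w).
      rewrite Rminus_0_r, scal_R_Cmult, Cmult_1_l in Hconst. exact Hconst. }
  rewrite <- (is_RInt_unique (V := C_R_CompleteNormedModule) _ _ _ _ Hint).
  replace (Cmod w ^ 2 * exp (Cmod w)) with ((1 - 0) * (Cmod w ^ 2 * exp (Cmod w))) by ring.
  apply Cmod_CInt_le; [lra|eexists; exact Hint|].
  intros t Ht. rewrite Cmod_mult. simpl pow. rewrite Rmult_1_r, Rmult_assoc.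
  assert (Hw := Cmod_ge_0 w). apply Rmult_le_compat_l; [exact Hw|].
  apply Rle_trans with (1 := Cmod_Cexp_minus_1_le _).
  assert (Htw : Cmod (t * w) <= Cmod w) by (rewrite Cmod_mult, Cmod_R, Rabs_pos_eq by lra; nra).
  apply Rmult_le_compat; [apply Cmod_ge_0|left; apply exp_pos|exact Htw|apply exp_le, Htw].
Qed.

Lemma is_Cderive_Cexp (z : C) : is_Cderive Cexp z (Cexp z).
Proof.
  apply is_Cderive_quadratic with (exp (Re z) * exp 1) 1; [lra|]. intros w Hw.
  replace (Cexp w - Cexp z - Cexp z * (w - z))%C with (Cexp z * (Cexp (w - z) - 1 - (w - z)))%C.
  - rewrite Cmod_mult, Cmod_Cexp, Rmult_assoc. apply Rmult_le_compat_l; [left; apply exp_pos|].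
    apply Rle_trans with (1 := Cmod_Cexp_taylor_le _). rewrite Rmult_comm.
    apply Rmult_le_compat_r; [apply pow2_ge_0|apply exp_le; lra].
  - replace w with (z + (w - z))%C at 3 by ring. rewrite Cexp_plus. ring.
Qed.

(** * Derivatives and integrals along lines *)

Notation is_RCderive := (is_derive (K := R_AbsRing) (V := C_R_NormedModule)).

Lemma is_RCderive_line (f : C -> C) (z d l : C) (t : R) :
  is_Cderive f (z + t * d)%C l -> is_RCderive (fun u => f (z + RtoC u * d)%C) t (d * l)%C.
Proof.
  intros Hf. rewrite is_Cderive_eps in Hf. split; [apply is_linear_scal_l|]. intros t' Ht' eps.
  apply (is_filter_lim_locally_unique (V := R_NormedModule)) in Ht'. subst t'.
  assert (Hd := Cmod_ge_0 d). assert (Heps := cond_pos eps).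
  destruct (Hf (eps / (Cmod d + 1))) as [delta [Hdelta Hrem]]; [apply Rdiv_lt_0_compat; lra|].
  assert (Hr : 0 < delta / (Cmod d + 1)) by (apply Rdiv_lt_0_compat; lra).
  exists (mkposreal _ Hr). intros u Hu. change (Rabs (u - t) < delta / (Cmod d + 1)) in Hu.
  assert (Hstep : (z + u * d - (z + t * d))%C = (RtoC (u - t) * d)%C) by (rewrite RtoC_minus; ring).
  assert (Hmod : Cmod (RtoC (u - t) * d) = Rabs (u - t) * Cmod d) by (rewrite Cmod_mult, Cmod_R; auto).
  assert (Habs := Rabs_pos (u - t)).
  specialize (Hrem (z + u * d)%C). rewrite Hstep, Hmod in Hrem.
  change (norm (minus u t)) with (Rabs (u - t)).
  rewrite <- Cmod_norm, scal_R_Cmult.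
  apply Rle_trans with (Cmod (f (z + u * d) - f (z + t * d) - l * (RtoC (u - t)%R * d))%C).
  - assert (Hcomm : forall a : C, (a - l * (RtoC (u - t) * d))%C = (a - RtoC (u - t) * (d * l))%C)
      by (intros; ring).
    right. rewrite Hcomm. reflexivity.
  - apply Rlt_div_r in Hu; [|lra].
    apply Rle_trans with (1 := Hrem ltac:(nra)).
    apply Rle_trans with (eps / (Cmod d + 1) * (Rabs (u - t) * (Cmod d + 1))).
    + apply Rmult_le_compat_l; [left; apply Rdiv_lt_0_compat|]; nra.
    + right. field. lra.
Qed.

Lemma horizontal_line (x y : R) : (RtoC y * Ci + RtoC x * 1)%C = (x, y).
Proof. apply injective_projections; simpl; ring. Qed.

Lemma vertical_line (x y : R) : (RtoC x + RtoC y * Ci)%C = (x, y).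
Proof. apply injective_projections; simpl; ring. Qed.

Lemma continuous_horizontal (f : C -> C) (x y : R) :
  continuous f (x, y) -> continuous (fun u => f (u, y)) x.
Proof.
  apply (continuous_comp (fun u : R => ((u, y) : C)) f). intros P [eps HP]. exists eps.
  intros u Hu. apply HP. split; [exact Hu|apply ball_center].
Qed.

Lemma continuous_vertical (f : C -> C) (x y : R) :
  continuous f (x, y) -> continuous (fun v => f (x, v)) y.
Proof.
  apply (continuous_comp (fun v : R => ((x, v) : C)) f). intros P [eps HP]. exists eps.
  intros v Hv. apply HP. split; [apply ball_center|exact Hv].
Qed.

Lemma is_CInt_primitive_horizontal (F f : C -> C) (y a b : R) :
  (forall z, is_Cderive F z (f z)) -> (forall z, continuous f z) ->
  is_CInt (fun u => f (u, y)) a b (F (b, y) - F (a, y))%C.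
Proof.
  intros HF Hf. apply (is_RInt_derive (V := C_R_CompleteNormedModule) (fun u => F (u, y))).
  - intros u _. apply (is_derive_ext (V := C_R_NormedModule) (fun u => F (y * Ci + RtoC u * 1)%C)).
    + intros v. rewrite horizontal_line. reflexivity.
    + rewrite <- (Cmult_1_l (f (u, y))). apply is_RCderive_line. rewrite horizontal_line. apply HF.
  - intros u _. apply continuous_horizontal, Hf.
Qed.

Lemma is_CInt_primitive_vertical (F f : C -> C) (x a b : R) :
  (forall z, is_Cderive F z (f z)) -> (forall z, continuous f z) ->
  is_CInt (fun v => Ci * f (x, v))%C a b (F (x, b) - F (x, a))%C.
Proof.
  intros HF Hf. apply (is_RInt_derive (V := C_R_CompleteNormedModule) (fun v => F (x, v))).
  - intros v _. apply (is_derive_ext (V := C_R_NormedModule) (fun v => F (x + RtoC v * Ci)%C)).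
    + intros w. rewrite vertical_line. reflexivity.
    + apply is_RCderive_line. rewrite vertical_line. apply HF.
  - intros v _. apply continuous_Cmult; [apply continuous_const|apply continuous_vertical, Hf].
Qed.

(** * Goursat's theorem for rectangles *)

Definition rectangle_int (f : C -> C) (x y w s : R) : C :=
  (CInt (fun u => f (u, y)) x (x + w) + Ci * CInt (fun v => f ((x + w)%R, v)) y (y + s)
   - CInt (fun u => f (u, (y + s)%R)) x (x + w) - Ci * CInt (fun v => f (x, v)) y (y + s))%C.

Definition in_rectangle (x y w s : R) (z : C) : Prop :=
  x <= Re z <= x + w /\ y <= Im z <= y + s.

Section ContinuousOnRectangle.

Variables (f : C -> C) (X Y W S : R).
Hypothesis Hf : forall z, in_rectangle X Y W S z -> continuous f z.

Lemma ex_CInt_horizontal (y a b : R) : X <= a <= X + W -> X <= b <= X + W -> Y <= y <= Y + S ->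
  ex_CInt (fun u => f (u, y)) a b.
Proof.
  intros Ha Hb Hy. apply (ex_RInt_continuous (V := C_R_CompleteNormedModule)). intros x Hx.
  apply continuous_horizontal, Hf. revert Hx. unfold Rmin, Rmax, in_rectangle. simpl.
  destruct (Rle_dec a b); lra.
Qed.

Lemma ex_CInt_vertical (x a b : R) : Y <= a <= Y + S -> Y <= b <= Y + S -> X <= x <= X + W ->
  ex_CInt (fun v => f (x, v)) a b.
Proof.
  intros Ha Hb Hx. apply (ex_RInt_continuous (V := C_R_CompleteNormedModule)). intros y Hy.
  apply continuous_vertical, Hf. revert Hy. unfold Rmin, Rmax, in_rectangle. simpl.
  destruct (Rle_dec a b); lra.
Qed.

Lemma rectangle_int_quarters (x y w s : R) :
  0 <= w -> 0 <= s -> X <= x -> x + w <= X + W -> Y <= y -> y + s <= Y + S ->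
  rectangle_int f x y w s =
  (rectangle_int f x y (w / 2) (s / 2) + rectangle_int f (x + w / 2) y (w / 2) (s / 2)
   + rectangle_int f x (y + s / 2) (w / 2) (s / 2)
   + rectangle_int f (x + w / 2) (y + s / 2) (w / 2) (s / 2))%C.
Proof.
  intros Hw Hs HX HXW HY HYS. unfold rectangle_int.
  replace (x + w / 2 + w / 2) with (x + w) by lra.
  replace (y + s / 2 + s / 2) with (y + s) by lra.
  rewrite <- (CInt_Chasles (fun u => f (u, y)) x (x + w / 2) (x + w)) by (apply ex_CInt_horizontal; lra).
  rewrite <- (CInt_Chasles (fun u => f (u, y + s)) x (x + w / 2) (x + w)) by (apply ex_CInt_horizontal; lra).
  rewrite <- (CInt_Chasles (fun v => f (x, v)) y (y + s / 2) (y + s)) by (apply ex_CInt_vertical; lra).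
  rewrite <- (CInt_Chasles (fun v => f (x + w, v)) y (y + s / 2) (y + s)) by (apply ex_CInt_vertical; lra).
  ring.
Qed.

Lemma rectangle_int_le (M : R) : 0 <= W -> 0 <= S ->
  (forall z, in_rectangle X Y W S z -> Cmod (f z) <= M) ->
  Cmod (rectangle_int f X Y W S) <= 2 * (W + S) * M.
Proof.
  intros HW HS HM.
  assert (Hhor : forall v, Y <= v <= Y + S -> Cmod (CInt (fun u => f (u, v)) X (X + W)) <= W * M).
  { intros v Hv. replace (W * M) with ((X + W - X) * M) by ring.
    apply Cmod_CInt_le; [lra|apply ex_CInt_horizontal; lra|].
    intros u Hu. apply HM. split; simpl; lra. }
  assert (Hver : forall u, X <= u <= X + W -> Cmod (CInt (fun v => f (u, v)) Y (Y + S)) <= S * M).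
  { intros u Hu. replace (S * M) with ((Y + S - Y) * M) by ring.
    apply Cmod_CInt_le; [lra|apply ex_CInt_vertical; lra|].
    intros v Hv. apply HM. split; simpl; lra. }
  assert (Hbottom := Hhor Y ltac:(lra)). assert (Htop := Hhor (Y + S) ltac:(lra)).
  assert (Hleft := Hver X ltac:(lra)). assert (Hright := Hver (X + W) ltac:(lra)).
  unfold rectangle_int.
  eapply Rle_trans; [apply Cmod_triangle_minus|].
  eapply Rle_trans; [apply Rplus_le_compat_r, Cmod_triangle_minus|].
  eapply Rle_trans; [apply Rplus_le_compat_r, Rplus_le_compat_r, Cmod_triangle|].
  rewrite !Cmod_mult, Cmod_Ci. lra.
Qed.

End ContinuousOnRectangle.

Lemma rectangle_int_minus (f g : C -> C) (x y w s : R) : 0 <= w -> 0 <= s ->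
  (forall z, in_rectangle x y w s z -> continuous f z) ->
  (forall z, in_rectangle x y w s z -> continuous g z) ->
  rectangle_int (fun z => f z - g z)%C x y w s = (rectangle_int f x y w s - rectangle_int g x y w s)%C.
Proof.
  intros Hw Hs Hf Hg. unfold rectangle_int.
  assert (Hhor : forall h, (forall z, in_rectangle x y w s z -> continuous h z) ->
    forall v, y <= v <= y + s -> ex_CInt (fun u => h (u, v)) x (x + w)).
  { intros h Hh v Hv. apply (ex_CInt_horizontal h x y w s Hh); lra. }
  assert (Hver : forall h, (forall z, in_rectangle x y w s z -> continuous h z) ->
    forall u, x <= u <= x + w -> ex_CInt (fun v => h (u, v)) y (y + s)).
  { intros h Hh u Hu. apply (ex_CInt_vertical h x y w s Hh); lra. }
  rewrite (CInt_minus (fun u => f (u, y)) (fun u => g (u, y))),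
    (CInt_minus (fun u => f (u, y + s)) (fun u => g (u, y + s))),
    (CInt_minus (fun v => f (x + w, v)) (fun v => g (x + w, v))),
    (CInt_minus (fun v => f (x, v)) (fun v => g (x, v)));
    try (apply Hhor; auto; lra); try (apply Hver; auto; lra).
  ring.
Qed.

Lemma rectangle_int_primitive (F f : C -> C) (x y w s : R) :
  (forall z, is_Cderive F z (f z)) -> (forall z, continuous f z) -> rectangle_int f x y w s = RtoC 0.
Proof.
  intros HF Hf. unfold rectangle_int.
  rewrite <- !CInt_Cmult
    by (apply ex_CInt_continuous; intros v; apply continuous_vertical, Hf).
  rewrite !(is_RInt_unique (V := C_R_CompleteNormedModule) _ _ _ _ (is_CInt_primitive_horizontal F f _ _ _ HF Hf)).
  rewrite !(is_RInt_unique (V := C_R_CompleteNormedModule) _ _ _ _ (is_CInt_primitive_vertical F f _ _ _ HF Hf)).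
  ring.
Qed.

Lemma rectangle_int_affine (p q : C) (x y w s : R) :
  rectangle_int (fun z => p + q * z)%C x y w s = RtoC 0.
Proof.
  apply rectangle_int_primitive with (fun z => p * z + q / 2 * (z * z))%C.
  - intros z. eapply is_Cderive_eq; [|apply is_Cderive_plus; apply is_Cderive_scal;
      [apply is_Cderive_id|apply is_Cderive_mult; apply is_Cderive_id]]. cbv beta. field.
  - intros z. apply continuous_Cplus; [apply continuous_const|].
    apply continuous_Cmult; [apply continuous_const|apply continuous_id].
Qed.

Lemma half_pow_nonneg (w : R) (n : nat) : 0 <= w -> 0 <= w / 2 ^ n.
Proof. intros Hw. apply Rdiv_le_0_compat; [exact Hw|apply pow_lt; lra]. Qed.

Lemma half_pow_succ (w : R) (n : nat) : w / 2 ^ S n = w / 2 ^ n / 2.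
Proof. simpl. field. apply pow_nonzero. lra. Qed.

Lemma half_pow_small (w eps : R) : 0 < eps -> exists n, w / 2 ^ n < eps.
Proof.
  intros Heps. assert (Hw := Rabs_pos w).
  destruct (pow_lt_1_zero (/ 2) ltac:(rewrite Rabs_pos_eq; lra) (eps / (Rabs w + 1))) as [n Hn].
  { apply Rdiv_lt_0_compat; lra. }
  exists n. specialize (Hn n (le_n n)). rewrite pow_inv in Hn.
  assert (Hpow : 0 < / 2 ^ n) by (apply Rinv_0_lt_compat, pow_lt; lra).
  rewrite Rabs_pos_eq in Hn by lra. apply Rlt_div_r in Hn; [|lra].
  assert (Hwabs := Rle_abs w). unfold Rdiv. nra.
Qed.

Lemma bisection_point (x : nat -> R) (w : R) : 0 <= w ->
  (forall n, x (S n) = x n \/ x (S n) = x n + w / 2 ^ n / 2) ->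
  exists u, forall n, x n <= u <= x n + w / 2 ^ n.
Proof.
  intros Hw Hstep.
  assert (Hnested : forall n k, x n <= x (n + k)%nat /\ x (n + k)%nat + w / 2 ^ (n + k) <= x n + w / 2 ^ n).
  { intros n k. induction k as [|k IH]; [rewrite Nat.add_0_r; lra|].
    rewrite Nat.add_succ_r, half_pow_succ. assert (Hpos := half_pow_nonneg w (n + k) Hw).
    destruct (Hstep (n + k)%nat) as [-> | ->]; lra. }
  assert (Hle : forall n k, x k <= x n + w / 2 ^ n).
  { intros n k. assert (Hpos := half_pow_nonneg w (n + (k - n)) Hw).
    assert (Hpos' := half_pow_nonneg w n Hw). destruct (Nat.le_gt_cases n k).
    - destruct (Hnested n (k - n)%nat) as [_ Hk]. replace (n + (k - n))%nat with k in * by lia. lra.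
    - destruct (Hnested k (n - k)%nat) as [Hn _]. replace (k + (n - k))%nat with n in * by lia. lra. }
  destruct (completeness (fun r => exists n, r = x n)) as [u [Hub Hleast]].
  - exists (x O + w / 2 ^ 0). intros r [k ->]. apply Hle.
  - exists (x O), O. reflexivity.
  - exists u. intros n. split; [apply Hub; exists n; reflexivity|].
    apply Hleast. intros r [k ->]. apply Hle.
Qed.

Lemma quadrisection_sequence (P : R -> R -> R -> R -> Prop) (X Y W S : R) :
  (forall x y w s, P x y (w / 2) (s / 2) -> P (x + w / 2) y (w / 2) (s / 2) ->
     P x (y + s / 2) (w / 2) (s / 2) -> P (x + w / 2) (y + s / 2) (w / 2) (s / 2) -> P x y w s) ->
  ~ P X Y W S ->
  exists x y : nat -> R, x O = X /\ y O = Y /\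
    (forall n, ~ P (x n) (y n) (W / 2 ^ n) (S / 2 ^ n)) /\
    (forall n, x (Datatypes.S n) = x n \/ x (Datatypes.S n) = x n + W / 2 ^ n / 2) /\
    (forall n, y (Datatypes.S n) = y n \/ y (Datatypes.S n) = y n + S / 2 ^ n / 2).
Proof.
  intros Hquarters Hbad.
  set (bad := fun n (p : R * R) => ~ P (fst p) (snd p) (W / 2 ^ n) (S / 2 ^ n)).
  set (quarter := fun n (p p' : R * R) =>
    (fst p' = fst p \/ fst p' = fst p + W / 2 ^ n / 2) /\
    (snd p' = snd p \/ snd p' = snd p + S / 2 ^ n / 2)).
  assert (Hstep : forall n p, exists p', bad n p -> bad (Datatypes.S n) p' /\ quarter n p p').
  { intros n [x y]. apply NNPP. intros Hnone. apply (not_ex_all_not _ _ Hnone (x, y)). intros Hxy.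
    exfalso. apply Hxy. unfold bad, quarter in Hnone. simpl fst in *. simpl snd in *.
    rewrite !half_pow_succ in Hnone.
    apply Hquarters; apply NNPP; intros Hq.
    - apply Hnone. exists (x, y). auto.
    - apply Hnone. exists (x + W / 2 ^ n / 2, y). auto.
    - apply Hnone. exists (x, y + S / 2 ^ n / 2). auto.
    - apply Hnone. exists (x + W / 2 ^ n / 2, y + S / 2 ^ n / 2). auto. }
  set (next := fun n p => proj1_sig (constructive_indefinite_description _ (Hstep n p))).
  assert (Hnext : forall n p, bad n p -> bad (Datatypes.S n) (next n p) /\ quarter n p (next n p)).
  { intros n p. apply (proj2_sig (constructive_indefinite_description _ (Hstep n p))). }
  set (corner := fix corner n := match n with O => (X, Y) | Datatypes.S n => next n (corner n) end).
  assert (Hcorner : forall n, bad n (corner n)).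
  { induction n as [|n IH]; [|apply Hnext, IH]. unfold bad. simpl. rewrite !Rdiv_1_r. exact Hbad. }
  exists (fun n => fst (corner n)), (fun n => snd (corner n)).
  repeat split; [exact Hcorner| |]; intros n; apply (Hnext n (corner n) (Hcorner n)).
Qed.

Lemma quadrisection_ind (P : R -> R -> R -> R -> Prop) (X Y W S : R) : 0 <= W -> 0 <= S ->
  (forall x y w s, P x y (w / 2) (s / 2) -> P (x + w / 2) y (w / 2) (s / 2) ->
     P x (y + s / 2) (w / 2) (s / 2) -> P (x + w / 2) (y + s / 2) (w / 2) (s / 2) -> P x y w s) ->
  (forall z, in_rectangle X Y W S z -> exists delta, 0 < delta /\
     forall x y w s, 0 <= w -> 0 <= s -> w + s < delta -> in_rectangle x y w s z -> P x y w s) ->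
  P X Y W S.
Proof.
  intros HW HS Hquarters Hlocal. apply NNPP. intros Hbad.
  destruct (quadrisection_sequence P X Y W S Hquarters Hbad) as (x & y & Hx0 & Hy0 & Hnot & Hx & Hy).
  destruct (bisection_point x W HW Hx) as [u Hu]. destruct (bisection_point y S HS Hy) as [v Hv].
  destruct (Hlocal (u, v)) as [delta [Hdelta Hsmall]].
  - specialize (Hu O). specialize (Hv O). rewrite Hx0, Rdiv_1_r in Hu. rewrite Hy0, Rdiv_1_r in Hv.
    split; simpl; lra.
  - destruct (half_pow_small (W + S) delta Hdelta) as [n Hn].
    apply (Hnot n), Hsmall; [apply half_pow_nonneg, HW|apply half_pow_nonneg, HS| |split; simpl; auto].
    unfold Rdiv in *. lra.
Qed.

Lemma rectangle_int_differentiable_le (f : C -> C) (z0 : C) (eps : R) : 0 < eps -> ex_Cderive f z0 ->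
  exists delta, 0 < delta /\ forall x y w s, 0 <= w -> 0 <= s -> w + s < delta -> in_rectangle x y w s z0 ->
    (forall z, in_rectangle x y w s z -> continuous f z) ->
    Cmod (rectangle_int f x y w s) <= eps * (w + s) ^ 2.
Proof.
  intros Heps [l Hl]. rewrite is_Cderive_eps in Hl.
  destruct (Hl (eps / 2)) as [delta [Hdelta Hrem]]; [lra|].
  exists delta. split; [exact Hdelta|]. intros x y w s Hw Hs Hws Hz0 Hf.
  set (tangent := fun z => ((f z0 - l * z0) + l * z)%C).
  assert (Htangent : forall z, continuous tangent z).
  { intros z. apply continuous_Cplus; [apply continuous_const|].
    apply continuous_Cmult; [apply continuous_const|apply continuous_id]. }
  replace (rectangle_int f x y w s) with (rectangle_int (fun z => f z - tangent z)%C x y w s)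
    by (rewrite rectangle_int_minus by auto; unfold tangent at 1; rewrite rectangle_int_affine; ring).
  replace (eps * (w + s) ^ 2) with (2 * (w + s) * (eps / 2 * (w + s))) by field.
  apply rectangle_int_le; [|exact Hw|exact Hs|]; intros z Hz; [apply continuous_Cminus; auto|].
  assert (Hdiam : Cmod (z - z0) <= w + s).
  { eapply Rle_trans; [apply Cmod_le_Re_Im|]. unfold in_rectangle, Cminus in *.
    rewrite re_plus, im_plus, re_opp, im_opp. apply Rplus_le_compat; apply Rabs_le; lra. }
  replace (f z - tangent z)%C with (f z - f z0 - l * (z - z0))%C by (unfold tangent; ring).
  eapply Rle_trans; [apply Hrem; lra|apply Rmult_le_compat_l; lra].
Qed.

Theorem Goursat_rectangle (f : C -> C) (X Y W S : R) : 0 <= W -> 0 <= S ->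
  (forall z, in_rectangle X Y W S z -> ex_Cderive f z) -> rectangle_int f X Y W S = RtoC 0.
Proof.
  intros HW HS Hf.
  assert (Hcont : forall z, in_rectangle X Y W S z -> continuous f z)
    by (intros z Hz; apply ex_Cderive_continuous; auto).
  set (inside := fun x y w s => 0 <= w /\ 0 <= s /\ X <= x /\ x + w <= X + W /\ Y <= y /\ y + s <= Y + S).
  assert (Hsmall : forall eps, 0 < eps -> Cmod (rectangle_int f X Y W S) <= eps * (W + S) ^ 2).
  { intros eps Heps.
    apply (quadrisection_ind (fun x y w s => inside x y w s -> Cmod (rectangle_int f x y w s) <= eps * (w + s) ^ 2));
      [exact HW|exact HS| | |unfold inside; lra].
    - intros x y w s Hll Hlr Hul Hur Hin. unfold inside in *.
      rewrite (rectangle_int_quarters f X Y W S Hcont) by tauto.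
      eapply Rle_trans; [apply Cmod_triangle|].
      eapply Rle_trans; [apply Rplus_le_compat_r, Cmod_triangle|].
      eapply Rle_trans; [apply Rplus_le_compat_r, Rplus_le_compat_r, Cmod_triangle|].
      specialize (Hll ltac:(lra)). specialize (Hlr ltac:(lra)).
      specialize (Hul ltac:(lra)). specialize (Hur ltac:(lra)). lra.
    - intros z0 Hz0. destruct (rectangle_int_differentiable_le f z0 eps Heps (Hf z0 Hz0)) as [delta [Hdelta Hle]].
      exists delta. split; [exact Hdelta|]. intros x y w s Hw Hs Hws Hxy Hin. apply Hle; auto.
      intros z Hz. apply Hcont. unfold in_rectangle, inside in *. lra. }
  apply Cmod_eq_0, Rle_antisym; [|apply Cmod_ge_0]. apply Rle_plus_epsilon. intros eps Heps. rewrite Rplus_0_l.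
  assert (HT := pow2_ge_0 (W + S)).
  apply Rle_trans with (1 := Hsmall (eps / ((W + S) ^ 2 + 1)) ltac:(apply Rdiv_lt_0_compat; lra)).
  apply Rmult_le_reg_r with ((W + S) ^ 2 + 1); [lra|].
  replace (eps / ((W + S) ^ 2 + 1) * (W + S) ^ 2 * ((W + S) ^ 2 + 1)) with (eps * (W + S) ^ 2) by (field; lra).
  nra.
Qed.

(** * The character [exp (2 pi i w)] *)

Lemma RtoC_2PI_neq_0 : RtoC (2 * PI) <> RtoC 0.
Proof. apply RtoC_neq_0. assert (HPI := PI_RGT_0). lra. Qed.

Definition e2pi (w : C) : C := Cexp (RtoC (2 * PI) * Ci * w).

Lemma e2pi_plus (a b : C) : e2pi (a + b) = (e2pi a * e2pi b)%C.
Proof. unfold e2pi. rewrite <- Cexp_plus. f_equal. ring. Qed.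

Lemma e2pi_0 : e2pi 0 = RtoC 1.
Proof. unfold e2pi. rewrite Cmult_0_r. apply Cexp_0. Qed.

Lemma e2pi_neq_0 (w : C) : e2pi w <> RtoC 0.
Proof. apply Cexp_neq_0. Qed.

Lemma e2pi_opp (w : C) : e2pi (- w) = (/ e2pi w)%C.
Proof. unfold e2pi. rewrite <- Cexp_opp. f_equal. ring. Qed.

Lemma Cmod_e2pi (w : C) : Cmod (e2pi w) = exp (- (2 * PI * Im w)).
Proof. unfold e2pi. rewrite Cmod_Cexp. f_equal. destruct w. simpl. ring. Qed.

Lemma Cmod_e2pi_R (r : R) : Cmod (e2pi r) = 1.
Proof. rewrite Cmod_e2pi, im_RtoC, Rmult_0_r, Ropp_0. apply exp_0. Qed.

Lemma e2pi_R (r : R) : e2pi r = (cos (2 * PI * r), sin (2 * PI * r)).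
Proof.
  unfold e2pi, Cexp.
  replace (Re (RtoC (2 * PI) * Ci * r)) with 0 by (simpl; ring).
  replace (Im (RtoC (2 * PI) * Ci * r)) with (2 * PI * r) by (simpl; ring).
  rewrite exp_0, !Rmult_1_l. reflexivity.
Qed.

Lemma e2pi_1 : e2pi 1 = RtoC 1.
Proof. rewrite e2pi_R, Rmult_1_r, cos_2PI, sin_2PI. reflexivity. Qed.

Lemma e2pi_half : e2pi (/ 2)%R = RtoC (-1).
Proof.
  rewrite e2pi_R. replace (2 * PI * / 2) with PI by field. rewrite cos_PI, sin_PI. reflexivity.
Qed.

Lemma e2pi_quarter : e2pi (/ 4)%R = Ci.
Proof.
  rewrite e2pi_R. replace (2 * PI * / 4) with (PI / 2) by field. rewrite cos_PI2, sin_PI2. reflexivity.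
Qed.

Lemma periodic_IZR {A : Type} (f : R -> A) :
  (forall x, f (x + 1) = f x) -> forall (k : Z) (x : R), f (x + IZR k) = f x.
Proof.
  intros Hper k. induction k as [|k IH|k IH] using Z.peano_ind; intros x.
  - rewrite Rplus_0_r. reflexivity.
  - rewrite <- (IH x), <- (Hper (x + IZR k)), succ_IZR. f_equal. ring.
  - rewrite <- (IH x), <- (Hper (x + IZR (Z.pred k))). unfold Z.pred. rewrite plus_IZR. f_equal. ring.
Qed.

Lemma e2pi_plus_1 (w : C) : e2pi (w + 1) = e2pi w.
Proof. rewrite e2pi_plus, e2pi_1. apply Cmult_1_r. Qed.

Lemma e2pi_IZR (n : Z) : e2pi (IZR n) = RtoC 1.
Proof.
  rewrite <- (Rplus_0_l (IZR n)), <- e2pi_0. apply (periodic_IZR (fun x => e2pi x)).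
  intros x. rewrite RtoC_plus. apply e2pi_plus_1.
Qed.

Lemma e2pi_eq_1 (r : R) : e2pi r = RtoC 1 -> exists k : Z, r = IZR k.
Proof.
  rewrite e2pi_R. intros Hr. apply (f_equal fst) in Hr. simpl in Hr.
  rewrite Rmult_assoc, cos_2a_sin in Hr.
  destruct (sin_eq_0_0 (PI * r)) as [k Hk]; [nra|].
  exists k. apply Rmult_eq_reg_l with PI; [lra|apply PI_neq0].
Qed.

Lemma is_Cderive_e2pi (w : C) : is_Cderive e2pi w (RtoC (2 * PI) * Ci * e2pi w)%C.
Proof.
  apply (is_Cderive_comp Cexp (fun w => RtoC (2 * PI) * Ci * w)%C); [|apply is_Cderive_Cexp].
  eapply is_Cderive_eq; [|apply is_Cderive_scal, is_Cderive_id]. ring.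
Qed.

Lemma continuous_e2pi_linear (a x : R) : continuous (fun x => e2pi (a * x)%R) x.
Proof.
  apply (continuous_comp (fun x => RtoC (a * x)) e2pi).
  - intros P [eps HP].
    destruct (continuous_mult (K := R_AbsRing) (fun _ => a) (fun x => x) x
      (continuous_const a x) (continuous_id x) (ball (a * x) eps)) as [delta Hdelta].
    { apply locally_ball. }
    exists delta. intros y Hy. apply HP. split; [apply Hdelta, Hy|apply ball_center].
  - apply ex_Cderive_continuous. eexists. apply is_Cderive_e2pi.
Qed.

Lemma continuous_e2pi_R (x : R) : continuous (fun x : R => e2pi x) x.
Proof.
  apply (continuous_ext (fun x => e2pi (1 * x)%R)); [|apply continuous_e2pi_linear].
  intros y. rewrite Rmult_1_l. reflexivity.
Qed.

(** * Pointwise Fourier inversion *)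

Notation is_Cseries := (is_series (K := C_AbsRing) (V := C_NormedModule)).

Lemma is_Cseries_ext (a b : nat -> C) (l : C) : (forall n, a n = b n) -> is_Cseries a l -> is_Cseries b l.
Proof. apply is_series_ext. Qed.

Definition bilateral_term (a : Z -> C) (k : nat) : C :=
  match k with O => a 0%Z | S _ => (a (Z.of_nat k) + a (- Z.of_nat k)%Z)%C end.

Definition is_bilateral_series (a : Z -> C) (l : C) : Prop := is_Cseries (bilateral_term a) l.

Lemma is_bilateral_series_ext (a b : Z -> C) (l : C) :
  (forall n, a n = b n) -> is_bilateral_series a l -> is_bilateral_series b l.
Proof. intros Hab. apply is_series_ext. intros [|k]; simpl; rewrite !Hab; reflexivity. Qed.

Lemma Csum_Sn (a : nat -> C) (n : nat) : sum_n a (S n) = (sum_n a n + a (S n))%C :> C.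
Proof. exact (sum_Sn a n). Qed.

Lemma is_Cseries_eps (a : nat -> C) (l : C) :
  (forall eps, 0 < eps -> exists N, forall n, (N <= n)%nat -> Cmod (sum_n a n - l) < eps) ->
  is_Cseries a l.
Proof.
  intros Ha. apply filterlim_locally. intros eps. destruct (Ha eps (cond_pos eps)) as [N HN].
  exists N. intros n Hn. apply C_NormedModule_mixin_compat1. apply (HN n Hn).
Qed.

Lemma is_Cseries_unique (a : nat -> C) (l l' : C) : is_Cseries a l -> is_Cseries a l' -> l = l'.
Proof. apply (filterlim_locally_unique (V := C_NormedModule) (sum_n a)). Qed.

Definition fourier_coef (u : R -> C) (n : Z) : C := CInt (fun x => u x * e2pi (- IZR n * x)%R)%C 0 1.

Lemma fourier_coef_ext (u v : R -> C) (n : Z) : (forall x, u x = v x) -> fourier_coef u n = fourier_coef v n.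
Proof. intros Huv. unfold fourier_coef. apply CInt_ext. intros x _. rewrite Huv. reflexivity. Qed.

Lemma continuous_fourier_integrand (u : R -> C) (n : Z) : (forall x, continuous u x) ->
  forall x, continuous (fun x => u x * e2pi (- IZR n * x)%R)%C x.
Proof. intros Hu x. apply continuous_Cmult; [apply Hu|apply continuous_e2pi_linear]. Qed.

Lemma ex_CInt_fourier (u : R -> C) (n : Z) : (forall x, continuous u x) ->
  ex_CInt (fun x => u x * e2pi (- IZR n * x)%R)%C 0 1.
Proof. intros Hu. apply ex_CInt_continuous, continuous_fourier_integrand, Hu. Qed.

Lemma fourier_coef_minus (u v : R -> C) (n : Z) :
  (forall x, continuous u x) -> (forall x, continuous v x) ->
  fourier_coef (fun x => u x - v x)%C n = (fourier_coef u n - fourier_coef v n)%C.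
Proof.
  intros Hu Hv. unfold fourier_coef. rewrite <- CInt_minus by (apply ex_CInt_fourier; assumption).
  apply CInt_ext. intros x _. ring.
Qed.

Lemma fourier_coef_e2pi_mult (u : R -> C) (n : Z) :
  fourier_coef (fun x => e2pi x * u x)%C n = fourier_coef u (n - 1).
Proof.
  unfold fourier_coef. apply CInt_ext. intros x _. rewrite minus_IZR.
  replace (- (IZR n - 1) * x) with (- IZR n * x + x) by ring. rewrite RtoC_plus, e2pi_plus. ring.
Qed.

Lemma continuous_shift (u : R -> C) (h x : R) :
  (forall x, continuous u x) -> continuous (fun x => u (x + h)) x.
Proof.
  intros Hu. apply (continuous_comp (fun x => x + h) u); [|apply Hu].
  apply (continuous_plus (V := R_NormedModule)); [apply continuous_id|apply continuous_const].
Qed.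

Lemma fourier_coef_shift (u : R -> C) (h : R) (n : Z) :
  (forall x, continuous u x) -> (forall x, u (x + 1) = u x) ->
  fourier_coef (fun x => u (x + h)) n = (e2pi (IZR n * h)%R * fourier_coef u n)%C.
Proof.
  intros Hu Hper. set (g := fun x => (u x * e2pi (- IZR n * x)%R)%C).
  assert (Hg : forall x, continuous g x) by (apply continuous_fourier_integrand, Hu).
  assert (Hgper : forall x, g (x + 1) = g x).
  { intros x. unfold g. rewrite Hper. f_equal.
    replace (- IZR n * (x + 1)) with (- IZR n * x + IZR (- n)) by (rewrite opp_IZR; ring).
    rewrite RtoC_plus, e2pi_plus, e2pi_IZR. apply Cmult_1_r. }
  replace (fourier_coef u n) with (CInt (fun x => g (x + h)) 0 1).
  - rewrite <- CInt_Cmult by (apply ex_CInt_continuous; intros x; apply continuous_shift, Hg).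
    unfold fourier_coef. apply CInt_ext. intros x _. unfold g.
    replace (- IZR n * x) with (- IZR n * (x + h) + IZR n * h) by ring.
    rewrite RtoC_plus, e2pi_plus. ring.
  - rewrite CInt_shift by (apply ex_CInt_continuous, Hg). rewrite Rplus_0_l, (Rplus_comm 1).
    apply CInt_periodic; assumption.
Qed.

Lemma fourier_coef_half_period (u : R -> C) (n : Z) : n <> 0%Z ->
  (forall x, continuous u x) -> (forall x, u (x + 1) = u x) ->
  (RtoC 2 * fourier_coef u n)%C = fourier_coef (fun x => u x - u (x + / (2 * IZR n))%R)%C n.
Proof.
  intros Hn Hu Hper. apply not_0_IZR in Hn.
  rewrite fourier_coef_minus by (auto; intros; apply continuous_shift, Hu).
  rewrite (fourier_coef_shift u) by assumption.
  replace (IZR n * / (2 * IZR n)) with (/ 2) by (field; exact Hn). rewrite e2pi_half. ring.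
Qed.

Lemma fourier_coef_const (c : C) (n : Z) :
  fourier_coef (fun _ => c) n = if (n =? 0)%Z then c else RtoC 0.
Proof.
  destruct (Z.eqb_spec n 0) as [-> |Hn].
  - transitivity (CInt (fun _ => c) 0 1); [|rewrite CInt_const, Rminus_0_r; apply Cmult_1_l].
    unfold fourier_coef. apply CInt_ext. intros x _. rewrite Ropp_0, Rmult_0_l, e2pi_0. apply Cmult_1_r.
  - assert (Hhalf := fourier_coef_half_period (fun _ => c) n Hn (continuous_const c) (fun _ => eq_refl)).
    replace (fourier_coef (fun _ => c) n) with (/ 2 * (2 * fourier_coef (fun _ => c) n))%C by field.
    rewrite Hhalf. transitivity (/ 2 * CInt (fun _ => RtoC 0) 0 1)%C.
    + f_equal. apply CInt_ext. intros x _. ring.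
    + rewrite CInt_const. ring.
Qed.

Lemma riemann_lebesgue (u : R -> C) : (forall x, continuous u x) -> (forall x, u (x + 1) = u x) ->
  forall eps, 0 < eps -> exists N, (0 < N)%Z /\ forall n, (N <= Z.abs n)%Z -> Cmod (fourier_coef u n) < eps.
Proof.
  intros Hu Hper eps Heps.
  destruct (unifcont_normed_1d (V := C_R_NormedModule) u (-1) 2 (fun x _ => Hu x) (mkposreal eps Heps))
    as [delta Hunif].
  assert (Hdelta := Rinv_0_lt_compat _ (cond_pos delta)). destruct (archimed (/ delta)) as [Hup _].
  exists (up (/ delta)). split; [apply lt_IZR; lra|].
  intros n Hn. apply IZR_le in Hn as HnR. rewrite abs_IZR in HnR.
  assert (Hn0 : n <> 0%Z) by (intros ->; rewrite Rabs_R0 in HnR; lra).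
  assert (Hn1 : 1 <= Rabs (IZR n)) by (rewrite <- abs_IZR; apply IZR_le; lia).
  set (h := / (2 * IZR n)).
  assert (Hh : Rabs h = / 2 * / Rabs (IZR n)).
  { unfold h. rewrite Rinv_mult, Rabs_mult, Rabs_inv, Rabs_inv, (Rabs_pos_eq 2) by lra. reflexivity. }
  assert (Hinv : / Rabs (IZR n) < delta).
  { rewrite <- (Rinv_inv delta). apply Rinv_lt_contravar; [apply Rmult_lt_0_compat|]; lra. }
  assert (Hinv1 : / Rabs (IZR n) <= 1) by (rewrite <- Rinv_1; apply Rinv_le_contravar; lra).
  assert (Hinv0 : 0 < / Rabs (IZR n)) by (apply Rinv_0_lt_compat; lra).
  assert (Hhrange : - / 2 <= h <= / 2) by (apply Rabs_le_between; lra).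
  assert (Hhalf := fourier_coef_half_period u n Hn0 Hu Hper). fold h in Hhalf.
  assert (Hbound : Cmod (2 * fourier_coef u n) <= (1 - 0) * eps).
  { rewrite Hhalf. apply Cmod_CInt_le; [lra| |].
    - apply ex_CInt_fourier. intros x. apply continuous_Cminus; [apply Hu|apply continuous_shift, Hu].
    - intros x Hx. rewrite Cmod_mult, Cmod_e2pi_R, Rmult_1_r, Cmod_minus_sym.
      left. rewrite Cmod_norm. apply (Hunif x (x + h)); [lra|lra|].
      change (Rabs (x + h - x) < delta). replace (x + h - x) with h by ring. lra. }
  rewrite Cmod_mult, Cmod_R, Rabs_pos_eq in Hbound by lra. lra.
Qed.

(* Chernoff's argument: the Fourier coefficients of [u] telescope into those of [v]. *)
Lemma fourier_inversion_factor (u v : R -> C) :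
  (forall x, continuous v x) -> (forall x, v (x + 1) = v x) ->
  (forall x, u x = (u 0 + (e2pi x - 1) * v x)%C) -> is_bilateral_series (fourier_coef u) (u 0).
Proof.
  intros Hv Hper Hfactor.
  assert (Hev : forall x, continuous (fun x : R => e2pi x * v x)%C x).
  { intros x. apply continuous_Cmult; [apply continuous_e2pi_R|apply Hv]. }
  assert (Hcoef : forall n, fourier_coef u n =
    ((if (n =? 0)%Z then u 0%R else 0) + fourier_coef v (n - 1) - fourier_coef v n)%C).
  { intros n. rewrite <- fourier_coef_const, <- fourier_coef_e2pi_mult.
    transitivity (fourier_coef (fun x : R => u 0%R - (v x - e2pi x * v x))%C n).
    - apply fourier_coef_ext. intros x. rewrite Hfactor. ring.
    - rewrite fourier_coef_minus, fourier_coef_minus; [ring|exact Hv|exact Hev| |].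
      + intros x. apply continuous_const.
      + intros x. apply continuous_Cminus; [apply Hv|apply Hev]. }
  assert (Htelescope : forall N, sum_n (bilateral_term (fourier_coef u)) N =
    (u 0%R + fourier_coef v (- Z.of_nat N - 1) - fourier_coef v (Z.of_nat N))%C :> C).
  { induction N as [|N IH]; [rewrite sum_O; apply Hcoef|].
    rewrite Csum_Sn, IH. unfold bilateral_term. rewrite !Hcoef.
    replace (Z.of_nat (S N) =? 0)%Z with false by (symmetry; apply Z.eqb_neq; lia).
    replace (- Z.of_nat (S N) =? 0)%Z with false by (symmetry; apply Z.eqb_neq; lia).
    replace (Z.of_nat (S N) - 1)%Z with (Z.of_nat N) by lia.
    replace (- Z.of_nat (S N))%Z with (- Z.of_nat N - 1)%Z by lia.
    ring. }
  apply is_Cseries_eps. intros eps Heps.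
  destruct (riemann_lebesgue v Hv Hper (eps / 2)) as [N0 [HN0 Hsmall]]; [lra|].
  exists (Z.to_nat N0). intros N HN. rewrite Htelescope.
  replace (u 0%R + fourier_coef v (- Z.of_nat N - 1) - fourier_coef v (Z.of_nat N) - u 0%R)%C
    with (fourier_coef v (- Z.of_nat N - 1) - fourier_coef v (Z.of_nat N))%C by ring.
  eapply Rle_lt_trans; [apply Cmod_triangle_minus|].
  assert (Hlow := Hsmall (- Z.of_nat N - 1)%Z ltac:(lia)).
  assert (Hhigh := Hsmall (Z.of_nat N) ltac:(lia)). lra.
Qed.

Definition slope (u : R -> C) (l : C) (t : R) : C :=
  if Req_dec_T t 0 then l else ((u t - u 0) / RtoC t)%C.

Lemma slope_mult (u : R -> C) (l : C) (t : R) : (slope u l t * t)%C = (u t - u 0%R)%C.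
Proof.
  unfold slope. destruct (Req_dec_T t 0) as [-> |Ht]; [ring|]. field.
  apply RtoC_neq_0, Ht.
Qed.

Lemma continuous_RtoC (t : R) : continuous (fun t => RtoC t) t.
Proof.
  intros P [eps HP]. exists eps. intros s Hs. apply HP. split; [exact Hs|apply ball_center].
Qed.

Lemma continuous_slope (u : R -> C) (l : C) : (forall t, continuous u t) -> is_RCderive u 0 l ->
  forall t, continuous (slope u l) t.
Proof.
  intros Hu Hderive t. destruct (Req_dec_T t 0) as [-> |Ht].
  - apply filterlim_locally. intros eps.
    destruct Hderive as [_ Hrem]. specialize (Hrem 0 (fun P HP => HP) (pos_div_2 eps)).
    revert Hrem. apply filter_imp. intros s Hs. change (norm (minus s 0)) with (Rabs (s - 0)) in Hs.
    rewrite <- Cmod_norm, scal_R_Cmult, Rminus_0_r in Hs. apply C_NormedModule_mixin_compat1.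
    change (Cmod (slope u l s - slope u l 0) < eps).
    unfold slope. destruct (Req_dec_T 0 0) as [_|n]; [|congruence].
    assert (Heps := cond_pos eps).
    destruct (Req_dec_T s 0) as [_|Hs0].
    { rewrite <- Cmod_0 in Heps. replace (l - l)%C with (RtoC 0) by ring. exact Heps. }
    assert (HsC : RtoC s <> RtoC 0) by apply RtoC_neq_0, Hs0.
    assert (Habs := Rabs_pos_lt s Hs0).
    replace ((u s - u 0%R) / s - l)%C with ((u s - u 0%R - s * l) / s)%C by (field; exact HsC).
    rewrite Cmod_div, Cmod_R by exact HsC. apply Rle_lt_trans with (eps / 2); [|lra].
    apply Rle_div_l; [exact Habs|]. rewrite Rminus_0_r in Hs. exact Hs.
  - apply (continuous_ext_loc _ (fun t => (u t - u 0) / RtoC t)%C).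
    + apply (filter_imp (fun s => s <> 0)); [|apply open_neq; exact Ht].
      intros s Hs. unfold slope. destruct (Req_dec_T s 0); [contradiction|reflexivity].
    + apply continuous_Cmult; [apply continuous_Cminus; [apply Hu|apply continuous_const]|].
      apply continuous_Cinv; [apply RtoC_neq_0, Ht|apply continuous_RtoC].
Qed.

Lemma slope_0 (u : R -> C) (l : C) : slope u l 0 = l.
Proof. unfold slope. destruct (Req_dec_T 0 0) as [_|Hneq]; [reflexivity|contradiction]. Qed.

Lemma is_RCderive_e2pi_0 : is_RCderive (fun x : R => e2pi x) 0 (RtoC (2 * PI) * Ci)%C.
Proof.
  apply (is_derive_ext (V := C_R_NormedModule) (fun x => e2pi (0 + RtoC x * 1)%C)).
  - intros x. f_equal. ring.
  - rewrite <- (Cmult_1_l (RtoC (2 * PI) * Ci)%C). apply is_RCderive_line.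
    eapply is_Cderive_eq; [|apply is_Cderive_e2pi].
    replace (0 + 0 * 1)%C with (RtoC 0) by ring. rewrite e2pi_0. ring.
Qed.

Lemma Z_eq_0_of_Rabs_lt_1 (k : Z) : Rabs (IZR k) < 1 -> k = 0%Z.
Proof. rewrite <- abs_IZR. intros Hk. apply lt_IZR in Hk. lia. Qed.

Lemma slope_e2pi_neq_0 (x : R) : Rabs x < 1 ->
  slope (fun x : R => e2pi x) (RtoC (2 * PI) * Ci) x <> RtoC 0.
Proof.
  intros Hx Hslope. assert (Hmult := slope_mult (fun x : R => e2pi x) (RtoC (2 * PI) * Ci) x).
  rewrite Hslope, Cmult_0_l, e2pi_0 in Hmult. symmetry in Hmult. apply Ceq_minus in Hmult.
  destruct (e2pi_eq_1 x Hmult) as [k ->]. rewrite (Z_eq_0_of_Rabs_lt_1 k Hx), slope_0 in Hslope.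
  revert Hslope. apply Cmult_neq_0; [apply RtoC_2PI_neq_0|apply Ci_nz].
Qed.

(* [v] is [(u - u 0) / (e2pi - 1)], completed at the integers by the quotient of the derivatives. *)
Lemma e2pi_minus_1_factor (u : R -> C) (l : C) :
  (forall x, continuous u x) -> (forall x, u (x + 1) = u x) -> is_RCderive u 0 l ->
  exists v : R -> C, (forall x, continuous v x) /\ (forall x, v (x + 1) = v x) /\
    forall x, u x = (u 0%R + (e2pi x - 1) * v x)%C.
Proof.
  intros Hu Hper Hderive. set (slope_e := slope (fun x : R => e2pi x) (RtoC (2 * PI) * Ci)).
  set (v := fun x : R => if Ceq_dec (e2pi x) 1 then (l / slope_e 0%R)%C
                         else ((u x - u 0%R) / (e2pi x - 1))%C).
  assert (Hvper : forall x, v (x + 1) = v x).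
  { intros x. unfold v. rewrite Hper, RtoC_plus, e2pi_plus_1. reflexivity. }
  assert (Hv_slope : forall x, Rabs x < 1 -> v x = (slope u l x / slope_e x)%C).
  { intros x Hx. assert (Hslope_e := slope_e2pi_neq_0 x Hx). fold slope_e in Hslope_e.
    assert (Hmult : (slope_e x * x)%C = (e2pi x - 1)%C) by (rewrite <- e2pi_0; apply slope_mult).
    unfold v. rewrite <- Hmult, <- (slope_mult u l x). destruct (Ceq_dec (e2pi x) 1) as [Hx1|Hx1].
    - destruct (e2pi_eq_1 x Hx1) as [k ->]. rewrite (Z_eq_0_of_Rabs_lt_1 k Hx), slope_0. reflexivity.
    - field. split; [exact Hslope_e|]. intros Hx0. rewrite Hx0, Cmult_0_r in Hmult.
      apply Hx1, Ceq_minus. rewrite Hx0. symmetry. exact Hmult. }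
  exists v. split; [|split; [exact Hvper|]].
  - intros x. apply (continuous_ext (fun t => v (t + IZR (- Int_part x)))); [apply periodic_IZR, Hvper|].
    destruct (base_fp x) as [Hfp0 Hfp1].
    apply (continuous_comp (fun t => t + IZR (- Int_part x)) v).
    { apply (continuous_plus (V := R_NormedModule)); [apply continuous_id|apply continuous_const]. }
    replace (x + IZR (- Int_part x)) with (frac_part x) by (unfold frac_part; rewrite opp_IZR; ring).
    apply (continuous_ext_loc _ (fun t => slope u l t / slope_e t)%C).
    + apply (locally_interval _ _ (-1) 1); simpl; [lra|lra|]. intros t Ht1 Ht2.
      symmetry. apply Hv_slope, Rabs_lt_between. lra.
    + apply continuous_Cmult; [apply continuous_slope; assumption|].
      apply continuous_Cinv; [apply slope_e2pi_neq_0; rewrite Rabs_pos_eq; lra|].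
      apply continuous_slope; [apply continuous_e2pi_R|apply is_RCderive_e2pi_0].
  - intros x. unfold v. destruct (Ceq_dec (e2pi x) 1) as [Hx|Hx].
    + rewrite Hx. destruct (e2pi_eq_1 x Hx) as [k ->].
      rewrite <- (Rplus_0_l (IZR k)), (periodic_IZR u Hper). ring.
    + field. apply Cminus_eq_contra, Hx.
Qed.

Theorem fourier_inversion (u : R -> C) (l : C) :
  (forall x, continuous u x) -> (forall x, u (x + 1) = u x) -> is_RCderive u 0 l ->
  is_bilateral_series (fourier_coef u) (u 0).
Proof.
  intros Hu Hper Hderive. destruct (e2pi_minus_1_factor u l Hu Hper Hderive) as (v & Hv & Hvper & Hfactor).
  apply (fourier_inversion_factor u v Hv Hvper Hfactor).
Qed.

(** * Absolutely convergent complex series *)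

Lemma is_series_Re (u : nat -> C) (l : C) : is_Cseries u l -> is_series (fun n => Re (u n)) (Re l).
Proof.
  intros Hu. apply (filterlim_ext (fun n => Re (sum_n u n))).
  - induction x as [|n IH]; [rewrite !sum_O; reflexivity|].
    rewrite Csum_Sn, sum_Sn, re_plus, IH. reflexivity.
  - apply (filterlim_comp _ _ _ (sum_n u) Re _ (locally l)); [exact Hu|].
    apply (continuous_fst (U := R_UniformSpace) (V := R_UniformSpace)).
Qed.

Lemma is_series_Im (u : nat -> C) (l : C) : is_Cseries u l -> is_series (fun n => Im (u n)) (Im l).
Proof.
  intros Hu. apply (filterlim_ext (fun n => Im (sum_n u n))).
  - induction x as [|n IH]; [rewrite !sum_O; reflexivity|].
    rewrite Csum_Sn, sum_Sn, im_plus, IH. reflexivity.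
  - apply (filterlim_comp _ _ _ (sum_n u) Im _ (locally l)); [exact Hu|].
    apply (continuous_snd (U := R_UniformSpace) (V := R_UniformSpace)).
Qed.

Definition Cseries (u : nat -> C) : C := (Series (fun n => Re (u n)), Series (fun n => Im (u n))).

Lemma Cseries_unique (u : nat -> C) (l : C) : is_Cseries u l -> Cseries u = l.
Proof.
  intros Hu. unfold Cseries.
  rewrite (is_series_unique _ _ (is_series_Re u l Hu)), (is_series_unique _ _ (is_series_Im u l Hu)).
  destruct l; reflexivity.
Qed.

Lemma ex_Cseries_le (u : nat -> C) (b : nat -> R) :
  (forall n, Cmod (u n) <= b n) -> ex_series b -> is_Cseries u (Cseries u).
Proof.
  intros Hub Hb.
  destruct (ex_series_le (K := C_AbsRing) (V := C_CompleteNormedModule) u b Hub Hb) as [l Hl].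
  rewrite (Cseries_unique u l Hl). exact Hl.
Qed.

Lemma ex_series_le_R (a b : nat -> R) : (forall n, 0 <= a n <= b n) -> ex_series b -> ex_series a.
Proof.
  intros Hab. apply (ex_series_le (V := R_CompleteNormedModule)).
  intros n. change (Rabs (a n) <= b n). rewrite Rabs_pos_eq; apply Hab.
Qed.

Lemma is_Cseries_Cmult (c : C) (u : nat -> C) (l : C) :
  is_Cseries u l -> is_Cseries (fun n => c * u n)%C (c * l)%C.
Proof. apply (is_series_scal (K := C_AbsRing) (V := C_NormedModule)). Qed.

Lemma is_Cseries_plus (u v : nat -> C) (l m : C) :
  is_Cseries u l -> is_Cseries v m -> is_Cseries (fun n => u n + v n)%C (l + m)%C.
Proof. apply (is_series_plus (V := C_NormedModule)). Qed.

Lemma is_Cseries_tail (u : nat -> C) (l : C) :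
  is_Cseries u l -> is_Cseries (fun n => u (S n)) (l - u O)%C.
Proof.
  intros Hu. apply (is_series_incr_1 (V := C_NormedModule)).
  assert (Hl : (l - u O + u O)%C = l) by ring. rewrite <- Hl in Hu. exact Hu.
Qed.

Lemma is_Cseries_cons (u : nat -> C) (l : C) : is_Cseries (fun n => u (S n)) l -> is_Cseries u (u O + l)%C.
Proof.
  intros Hu. apply (is_series_decr_1 (V := C_NormedModule)).
  assert (Hl : (u O + l - u O)%C = l) by ring. rewrite <- Hl in Hu. exact Hu.
Qed.

Lemma is_bilateral_series_Cmult (c : C) (a : Z -> C) (l : C) :
  is_bilateral_series a l -> is_bilateral_series (fun n => c * a n)%C (c * l)%C.
Proof.
  intros Ha. apply (is_Cseries_Cmult c) in Ha. revert Ha. apply is_Cseries_ext.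
  intros [|n]; [reflexivity|apply Cmult_plus_distr_l].
Qed.

Lemma Cmod_Cseries_le (u : nat -> C) (l : C) (b : nat -> R) :
  is_Cseries u l -> (forall n, Cmod (u n) <= b n) -> ex_series b -> Cmod l <= Series b.
Proof.
  intros Hu Hub Hb.
  apply (filterlim_le (F := eventually) (fun n => Cmod (sum_n u n)) (sum_n b) (Cmod l) (Series b)).
  - exists O. intros n _. induction n as [|n IH]; [rewrite !sum_O; apply Hub|].
    rewrite Csum_Sn, sum_Sn. eapply Rle_trans; [apply Cmod_triangle|].
    apply Rplus_le_compat; [exact IH|apply Hub].
  - apply (filterlim_comp _ _ _ (sum_n u) Cmod _ (locally l)); [exact Hu|].
    apply (filterlim_norm (V := C_NormedModule)).
  - apply Series_correct, Hb.
Qed.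

Lemma is_Cseries_even_odd (u : nat -> C) (even odd : C) (b : nat -> R) :
  (forall n, Cmod (u n) <= b n) -> ex_series b ->
  is_Cseries (fun k => u (2 * k)%nat) even -> is_Cseries (fun k => u (2 * k + 1)%nat) odd ->
  is_Cseries u (even + odd)%C.
Proof.
  intros Hub Hb Heven Hodd. assert (Hu := ex_Cseries_le u b Hub Hb).
  replace (even + odd)%C with (Cseries u); [exact Hu|].
  apply (filterlim_locally_unique (V := C_NormedModule) (F := eventually) (fun n => sum_n u (2 * n + 1))).
  - apply (filterlim_comp _ _ _ (fun n => 2 * n + 1)%nat (sum_n u) _ eventually); [|exact Hu].
    intros P [N HN]. exists N. intros n Hn. apply HN. lia.
  - assert (Hsplit : forall n, sum_n (fun k => u (2 * k)%nat + u (2 * k + 1)%nat)%C n = sum_n u (2 * n + 1)).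
    { induction n as [|n IH]; [rewrite sum_O; simpl (2 * 0 + 1)%nat; rewrite Csum_Sn, sum_O; reflexivity|].
      replace (2 * S n + 1)%nat with (S (S (2 * n + 1))) by lia. rewrite !Csum_Sn, IH.
      replace (2 * S n)%nat with (S (2 * n + 1)) by lia.
      replace (S (2 * n + 1) + 1)%nat with (S (S (2 * n + 1))) by lia. apply Cplus_assoc. }
    apply (filterlim_ext _ _ Hsplit). apply (is_Cseries_plus _ _ _ _ Heven Hodd).
Qed.

Lemma exp_INR_mult (a : R) (n : nat) : exp (INR n * a) = exp a ^ n.
Proof.
  induction n as [|n IH]; [simpl; rewrite Rmult_0_l; apply exp_0|].
  rewrite S_INR, Rmult_plus_distr_r, Rmult_1_l, exp_plus, IH. simpl. ring.
Qed.

Lemma is_series_exp_geom (K a : R) : 0 < a ->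
  is_series (fun n => K * exp (- (a * INR n))) (K / (1 - exp (- a))).
Proof.
  intros Ha. apply (is_series_scal (V := R_NormedModule) K).
  apply (is_series_ext (fun n => exp (- a) ^ n)).
  - intros n. rewrite <- exp_INR_mult. f_equal. ring.
  - apply is_series_geom. assert (Hpos := exp_pos (- a)). rewrite Rabs_pos_eq by lra.
    rewrite <- exp_0. apply exp_increasing. lra.
Qed.

Lemma ex_series_exp_geom (K a : R) : 0 < a -> ex_series (fun n => K * exp (- (a * INR n))).
Proof. intros Ha. eexists. apply is_series_exp_geom, Ha. Qed.

Lemma gaussian_exponent_le (a b x : R) : 0 < a -> - (a * x ^ 2) + b * x <= (b + 1) ^ 2 / (4 * a) - x.
Proof.
  intros Ha. assert (Hsqr : 0 <= a * (x - (b + 1) / (2 * a)) ^ 2) by (apply Rmult_le_pos; [lra|apply pow2_ge_0]).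
  replace (a * (x - (b + 1) / (2 * a)) ^ 2) with (a * x ^ 2 - (b + 1) * x + (b + 1) ^ 2 / (4 * a)) in Hsqr
    by (field; lra).
  lra.
Qed.

Lemma ex_series_gaussian (a b : R) : 0 < a -> ex_series (fun n => exp (- (a * (1 + INR n) ^ 2) + b * (1 + INR n))).
Proof.
  intros Ha.
  apply ex_series_le_R with (fun n => exp ((b + 1) ^ 2 / (4 * a)) * exp (- (1 * INR n)));
    [|apply ex_series_exp_geom; lra].
  intros n. split; [left; apply exp_pos|]. rewrite <- exp_plus. apply exp_le.
  eapply Rle_trans; [apply gaussian_exponent_le, Ha|]. lra.
Qed.

(** * Series of exponentials *)

Definition exp_series (c freq : nat -> C) (z : C) : C := Cseries (fun n => c n * Cexp (freq n * z))%C.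

Definition exp_summable (c freq : nat -> C) (z : C) (d : R) : Prop :=
  ex_series (fun n => Cmod (c n) * exp (Re (freq n * z) + Cmod (freq n) * d)).

Lemma is_Cseries_exp_series (c freq : nat -> C) (z w : C) (d : R) :
  exp_summable c freq z d -> Cmod (w - z) <= d ->
  is_Cseries (fun n => c n * Cexp (freq n * w))%C (exp_series c freq w).
Proof.
  intros Hsum Hw. apply ex_Cseries_le with (2 := Hsum). intros n.
  rewrite Cmod_mult, Cmod_Cexp. apply Rmult_le_compat_l; [apply Cmod_ge_0|]. apply exp_le.
  replace (freq n * w)%C with (freq n * z + freq n * (w - z))%C by ring. rewrite re_plus.
  apply Rplus_le_compat_l. eapply Rle_trans; [apply Rle_abs|].
  eapply Rle_trans; [apply re_le_Cmod|]. rewrite Cmod_mult.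
  apply Rmult_le_compat_l; [apply Cmod_ge_0|exact Hw].
Qed.

Lemma exp_summable_le (c freq : nat -> C) (z : C) (d d' : R) :
  d' <= d -> exp_summable c freq z d -> exp_summable c freq z d'.
Proof.
  intros Hd. apply ex_series_le_R. intros n. split.
  - apply Rmult_le_pos; [apply Cmod_ge_0|left; apply exp_pos].
  - apply Rmult_le_compat_l; [apply Cmod_ge_0|]. apply exp_le, Rplus_le_compat_l.
    apply Rmult_le_compat_l; [apply Cmod_ge_0|exact Hd].
Qed.

Lemma exp_summable_derive (c freq : nat -> C) (z : C) (d : R) : 0 < d ->
  exp_summable c freq z d -> exp_summable (fun n => c n * freq n)%C freq z (d / 2).
Proof.
  intros Hd Hsum.
  apply ex_series_le_R with (fun n => 2 / d * (Cmod (c n) * exp (Re (freq n * z) + Cmod (freq n) * d)));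
    [|apply (ex_series_scal (V := R_NormedModule)), Hsum].
  intros n. rewrite Cmod_mult. assert (Hc := Cmod_ge_0 (c n)). assert (Hfreq := Cmod_ge_0 (freq n)).
  set (x := Cmod (freq n) * (d / 2)). set (E := exp (Re (freq n * z) + x)).
  assert (HE : 0 < E) by apply exp_pos.
  split; [repeat apply Rmult_le_pos; lra|].
  replace (Re (freq n * z) + Cmod (freq n) * d) with (x + (Re (freq n * z) + x)) by (unfold x; field).
  rewrite exp_plus. fold E.
  replace (Cmod (c n) * Cmod (freq n) * E) with (2 / d * Cmod (c n) * E * x) by (unfold x; field; lra).
  replace (2 / d * (Cmod (c n) * (exp x * E))) with (2 / d * Cmod (c n) * E * exp x) by ring.
  apply Rmult_le_compat_l; [|assert (Hineq := exp_ineq1_le x); lra].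
  repeat apply Rmult_le_pos; try lra. left. apply Rinv_0_lt_compat, Hd.
Qed.

Lemma pow2_le_exp (x : R) : 0 <= x -> x ^ 2 <= 4 * exp x.
Proof.
  intros Hx. replace x with (x / 2 + x / 2) at 2 by field. rewrite exp_plus.
  assert (Hineq := exp_ineq1_le (x / 2)). nra.
Qed.

Lemma Cmod_Cexp_taylor_dilated_le (a h : C) (d : R) : 0 < d -> Cmod h <= d / 2 ->
  Cmod (Cexp (a * h) - 1 - a * h) <= 16 / d ^ 2 * Cmod h ^ 2 * exp (Cmod a * d).
Proof.
  intros Hd Hh. apply Rle_trans with (1 := Cmod_Cexp_taylor_le _). rewrite Cmod_mult.
  assert (Ha := Cmod_ge_0 a).
  assert (Hpow := pow2_le_exp (Cmod a * (d / 2)) ltac:(nra)).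
  replace ((Cmod a * Cmod h) ^ 2) with (4 / d ^ 2 * Cmod h ^ 2 * (Cmod a * (d / 2)) ^ 2) by (field; lra).
  replace (16 / d ^ 2 * Cmod h ^ 2 * exp (Cmod a * d))
    with (4 / d ^ 2 * Cmod h ^ 2 * (4 * exp (Cmod a * (d / 2))) * exp (Cmod a * (d / 2))).
  - assert (Hcoef : 0 <= 4 / d ^ 2 * Cmod h ^ 2).
    { apply Rmult_le_pos; [left; apply Rdiv_lt_0_compat; [lra|apply pow_lt, Hd]|apply pow2_ge_0]. }
    apply Rmult_le_compat.
    + apply Rmult_le_pos; [exact Hcoef|apply pow2_ge_0].
    + left. apply exp_pos.
    + apply Rmult_le_compat_l; assumption.
    + apply exp_le. nra.
  - replace (Cmod a * d) with (Cmod a * (d / 2) + Cmod a * (d / 2)) by field. rewrite exp_plus. field. lra.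
Qed.

Lemma is_Cderive_exp_series (c freq : nat -> C) (z : C) (d : R) : 0 < d -> exp_summable c freq z d ->
  is_Cderive (exp_series c freq) z (exp_series (fun n => c n * freq n)%C freq z).
Proof.
  intros Hd Hsum. set (b := fun n => Cmod (c n) * exp (Re (freq n * z) + Cmod (freq n) * d)).
  apply is_Cderive_quadratic with (16 / d ^ 2 * Series b) (d / 2); [lra|]. intros w Hw.
  assert (Hz0 : Cmod (z - z) <= d) by (replace (z - z)%C with (RtoC 0) by ring; rewrite Cmod_0; lra).
  assert (Hseries_w := is_Cseries_exp_series c freq z w d Hsum ltac:(lra)).
  assert (Hseries_z := is_Cseries_exp_series c freq z z d Hsum Hz0).
  assert (Hderive := is_Cseries_exp_series _ freq z z _ (exp_summable_derive c freq z d Hd Hsum)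
    ltac:(replace (z - z)%C with (RtoC 0) by ring; rewrite Cmod_0; lra)).
  apply (is_Cseries_Cmult (RtoC (-1))) in Hseries_z. apply (is_Cseries_Cmult (- (w - z))) in Hderive.
  assert (Hrem := is_Cseries_plus _ _ _ _ (is_Cseries_plus _ _ _ _ Hseries_w Hseries_z) Hderive).
  replace (16 / d ^ 2 * Series b * Cmod (w - z) ^ 2) with (Series (fun n => 16 / d ^ 2 * Cmod (w - z) ^ 2 * b n))
    by (rewrite Series_scal_l; ring).
  eapply Cmod_Cseries_le; [|intros n|apply (ex_series_scal (V := R_NormedModule)), Hsum].
  - assert (Hlim : forall a b e : C, (a + RtoC (-1) * b + - (w - z) * e)%C = (a - b - e * (w - z))%C)
      by (intros; ring).
    rewrite Hlim in Hrem. exact Hrem.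
  - cbv beta. replace (Cexp (freq n * w)) with (Cexp (freq n * z) * Cexp (freq n * (w - z)))%C
      by (rewrite <- Cexp_plus; f_equal; ring).
    apply Rle_trans with (Cmod (c n * Cexp (freq n * z) * (Cexp (freq n * (w - z)) - 1 - freq n * (w - z)))).
    { right. f_equal. ring. }
    rewrite !Cmod_mult, Cmod_Cexp. unfold b. rewrite exp_plus.
    replace (16 / d ^ 2 * Cmod (w - z) ^ 2 * (Cmod (c n) * (exp (Re (freq n * z)) * exp (Cmod (freq n) * d))))
      with (Cmod (c n) * exp (Re (freq n * z)) * (16 / d ^ 2 * Cmod (w - z) ^ 2 * exp (Cmod (freq n) * d))) by ring.
    apply Rmult_le_compat_l; [apply Rmult_le_pos; [apply Cmod_ge_0|left; apply exp_pos]|].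
    apply Cmod_Cexp_taylor_dilated_le; lra.
Qed.

(** * Fourier expansions of periodic holomorphic functions *)

Lemma qpow_e2pi (tau : C) (n : Z) : qpow tau n = e2pi (IZR n * tau).
Proof. unfold qpow, e2pi. rewrite RtoC_mult. f_equal. ring. Qed.

Lemma qpow_plus (tau : C) (m n : Z) : qpow tau (m + n) = (qpow tau m * qpow tau n)%C.
Proof. rewrite !qpow_e2pi, <- e2pi_plus, plus_IZR, RtoC_plus. f_equal. ring. Qed.

Lemma qpow_shift (tau w : C) (n : Z) : qpow (tau + w) n = (qpow tau n * qpow w n)%C.
Proof. rewrite !qpow_e2pi, <- e2pi_plus. f_equal. ring. Qed.

Lemma qpow_0 (tau : C) : qpow tau 0 = RtoC 1.
Proof. rewrite qpow_e2pi, Cmult_0_l. apply e2pi_0. Qed.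

Lemma qpow_neq_0 (tau : C) (n : Z) : qpow tau n <> RtoC 0.
Proof. apply Cexp_neq_0. Qed.

Lemma qpow_opp (tau : C) (n : Z) : qpow tau (- n) = (/ qpow tau n)%C.
Proof. rewrite !qpow_e2pi, <- e2pi_opp, opp_IZR, RtoC_opp. f_equal. ring. Qed.

Lemma qpow_plus_1 (tau : C) (n : Z) : qpow (tau + 1) n = qpow tau n.
Proof. rewrite qpow_shift, (qpow_e2pi 1), Cmult_1_r, e2pi_IZR. apply Cmult_1_r. Qed.

Lemma Cmod_qpow (tau : C) (n : Z) : Cmod (qpow tau n) = exp (- (2 * PI * IZR n * Im tau)).
Proof. rewrite qpow_e2pi, Cmod_e2pi, im_scal_l. f_equal. ring. Qed.

Lemma is_Cderive_qpow (tau : C) (n : Z) :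
  is_Cderive (fun z => qpow z n) tau (RtoC (2 * PI * IZR n) * Ci * qpow tau n)%C.
Proof.
  apply (is_Cderive_comp Cexp (fun z => RtoC (2 * PI * IZR n) * Ci * z)%C); [|apply is_Cderive_Cexp].
  eapply is_Cderive_eq; [|apply is_Cderive_scal, is_Cderive_id]. ring.
Qed.

Definition holomorphic_above (h : R) (f : C -> C) : Prop := forall z, h < Im z -> ex_Cderive f z.

Definition periodic_above (h : R) (f : C -> C) : Prop := forall z, h < Im z -> f (z + 1)%C = f z.

Lemma locally_above (h : R) (z : C) : h < Im z -> locally (T := C_UniformSpace) z (fun w => h < Im w).
Proof.
  intros Hz. exists (mkposreal (Im z - h) (proj2 (Rlt_0_minus _ _) Hz)). intros w [_ Hw].
  change (Rabs (Im w - Im z) < Im z - h) in Hw. apply Rabs_lt_between in Hw. lra.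
Qed.

Lemma is_Cderive_ext_above (h : R) (f g : C -> C) (z l : C) :
  (forall w, h < Im w -> f w = g w) -> h < Im z -> is_Cderive f z l -> is_Cderive g z l.
Proof.
  intros Hfg Hz. apply is_Cderive_ext_loc. apply filter_imp with (2 := locally_above h z Hz). exact Hfg.
Qed.

Lemma ex_Cderive_ext_above (h : R) (f g : C -> C) (z : C) :
  (forall w, h < Im w -> f w = g w) -> h < Im z -> ex_Cderive f z -> ex_Cderive g z.
Proof. intros Hfg Hz [l Hl]. exists l. apply is_Cderive_ext_above with h f; assumption. Qed.

Lemma Im_plus_R (z : C) (r : R) : Im (z + r) = Im z.
Proof. rewrite im_plus, im_RtoC. ring. Qed.

Lemma holomorphic_above_continuous (h : R) (f : C -> C) (z : C) :
  holomorphic_above h f -> h < Im z -> continuous f z.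
Proof. intros Hf Hz. apply ex_Cderive_continuous, Hf, Hz. Qed.

Lemma holomorphic_above_line (h : R) (f : C -> C) (y : R) :
  holomorphic_above h f -> h < y -> forall x, continuous (fun x => f (x, y)) x.
Proof.
  intros Hf Hy x. apply continuous_horizontal. apply (holomorphic_above_continuous h f); assumption.
Qed.

Lemma holomorphic_above_mult_qpow (h : R) (f : C -> C) (n : Z) :
  holomorphic_above h f -> holomorphic_above h (fun z => f z * qpow z n)%C.
Proof.
  intros Hf z Hz. apply ex_Cderive_mult; [apply Hf, Hz|]. eexists. apply is_Cderive_qpow.
Qed.

Lemma periodic_above_mult_qpow (h : R) (f : C -> C) (n : Z) :
  periodic_above h f -> periodic_above h (fun z => f z * qpow z n)%C.
Proof. intros Hf z Hz. rewrite Hf, qpow_plus_1 by exact Hz. reflexivity. Qed.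

Definition fcoef_at (f : C -> C) (y : R) (n : Z) : C := CInt (fun x => f (x, y) * qpow (x, y) (- n))%C 0 1.

Lemma fcoef_ext (f g : C -> C) (n : Z) : (forall z, Im z = 1 -> f z = g z) -> fcoef f n = fcoef g n.
Proof. intros Hfg. unfold fcoef. apply CInt_ext. intros x _. rewrite Hfg; reflexivity. Qed.

Lemma fcoef_mult_qpow (f : C -> C) (m n : Z) : fcoef (fun z => f z * qpow z m)%C n = fcoef f (n - m).
Proof.
  unfold fcoef. apply CInt_ext. intros x _. replace (- (n - m))%Z with (m + - n)%Z by ring. rewrite qpow_plus. ring.
Qed.

Lemma fcoef_eq_0 (f : C -> C) (n : Z) : (forall z, Im z = 1 -> f z = RtoC 0) -> fcoef f n = RtoC 0.
Proof.
  intros Hf. transitivity (CInt (fun _ => RtoC 0) 0 1); [|rewrite CInt_const; ring].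
  unfold fcoef. apply CInt_ext. intros x _. rewrite Hf by reflexivity. ring.
Qed.

Section PeriodicHolomorphic.

Variables (h : R) (f : C -> C).
Hypotheses (Hf : holomorphic_above h f) (Hper : periodic_above h f).

Lemma periodic_above_line (y : R) : h < y -> forall x, f (x + 1, y) = f (x, y).
Proof.
  intros Hy x. rewrite <- (Hper (x, y) Hy). f_equal. apply injective_projections; simpl; ring.
Qed.

Lemma fcoef_at_height (n : Z) (y y' : R) : h < y -> y <= y' -> fcoef_at f y n = fcoef_at f y' n.
Proof.
  intros Hy Hyy'. set (g := fun z => (f z * qpow z (- n))%C).
  assert (Hg : rectangle_int g 0 y 1 (y' - y) = RtoC 0).
  { apply Goursat_rectangle; [lra|lra|]. intros z [_ Hz].
    apply (holomorphic_above_mult_qpow h f (- n) Hf). lra. }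
  unfold rectangle_int in Hg. replace (y + (y' - y)) with y' in Hg by ring. rewrite Rplus_0_l in Hg.
  assert (Hsides : CInt (fun v => g (1, v)) y y' = CInt (fun v => g (0, v)) y y').
  { apply CInt_ext. intros v Hv. rewrite Rmin_left in Hv by exact Hyy'.
    replace ((1, v) : C) with ((0, v) + 1)%C by (apply injective_projections; simpl; ring).
    apply (periodic_above_mult_qpow h f (- n) Hper). simpl. lra. }
  rewrite Hsides in Hg. apply Ceq_minus. rewrite <- Hg. unfold fcoef_at, g. ring.
Qed.

Lemma fcoef_at_fcoef (n : Z) (y : R) : h < 1 -> h < y -> fcoef_at f y n = fcoef f n.
Proof.
  intros Hh1 Hy. change (fcoef_at f y n = fcoef_at f 1 n).
  destruct (Rle_lt_dec y 1); [|symmetry]; apply fcoef_at_height; lra.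
Qed.

Lemma continuous_fcoef_integrand (y : R) (n : Z) : h < y ->
  forall x, continuous (fun x => f (x, y) * qpow (x, y) (- n))%C x.
Proof.
  intros Hy x. apply (holomorphic_above_line h (fun z => f z * qpow z (- n))%C); [|exact Hy].
  apply holomorphic_above_mult_qpow, Hf.
Qed.

Lemma fourier_coef_line (z : C) (n : Z) : h < 1 -> h < Im z ->
  fourier_coef (fun x => f (z + RtoC x)%C) n = (fcoef f n * qpow z n)%C.
Proof.
  intros Hh1 Hz. rewrite <- (fcoef_at_fcoef n (Im z)) by assumption.
  transitivity (fourier_coef (fun x => f (x + Re z, Im z)) n).
  { apply fourier_coef_ext. intros x. f_equal. destruct z. apply injective_projections; simpl; ring. }
  rewrite (fourier_coef_shift (fun x => f (x, Im z)))
    by (first [apply periodic_above_line, Hz|apply (holomorphic_above_line h f); assumption]).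
  replace (fourier_coef (fun x => f (x, Im z)) n) with (qpow (0, Im z) n * fcoef_at f (Im z) n)%C.
  - assert (Hsplit : qpow z n = (qpow (0, Im z) n * e2pi (IZR n * Re z)%R)%C).
    { rewrite RtoC_mult, <- qpow_e2pi, <- qpow_shift. f_equal.
      destruct z. apply injective_projections; simpl; ring. }
    rewrite Hsplit. ring.
  - unfold fcoef_at, fourier_coef.
    rewrite <- CInt_Cmult by (apply ex_CInt_continuous, continuous_fcoef_integrand, Hz).
    apply CInt_ext. intros x _.
    replace ((x, Im z) : C) with ((0, Im z) + x)%C at 2 by (apply injective_projections; simpl; ring).
    rewrite qpow_shift, !qpow_opp, (qpow_e2pi x), Ropp_mult_distr_l_reverse, RtoC_opp, e2pi_opp, RtoC_mult.
    field. split; [apply e2pi_neq_0|apply qpow_neq_0].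
Qed.

Lemma fourier_series (z : C) : h < 1 -> h < Im z ->
  is_bilateral_series (fun n => fcoef f n * qpow z n)%C (f z).
Proof.
  intros Hh1 Hz. apply (is_bilateral_series_ext (fourier_coef (fun x => f (z + RtoC x)%C))).
  { intros n. apply fourier_coef_line; assumption. }
  assert (Hline : forall x, h < Im (z + RtoC x)) by (intros x; rewrite Im_plus_R; exact Hz).
  destruct (Hf z Hz) as [l Hl].
  replace (f z) with (f (z + RtoC 0)%C) by (f_equal; ring).
  apply (fourier_inversion (fun x => f (z + RtoC x)%C) l).
  - intros x. apply (continuous_comp (fun x => z + RtoC x)%C f).
    + apply continuous_Cplus; [apply continuous_const|apply continuous_RtoC].
    + apply (holomorphic_above_continuous h f _ Hf), Hline.
  - intros x. rewrite RtoC_plus, Cplus_assoc. apply Hper, Hline.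
  - apply (is_derive_ext (V := C_R_NormedModule) (fun x => f (z + RtoC x * 1)%C)).
    + intros x. f_equal. ring.
    + rewrite <- (Cmult_1_l l). apply is_RCderive_line.
      replace (z + 0 * 1)%C with z by ring. exact Hl.
Qed.

Lemma fcoef_shift (w : C) (n : Z) : h < 1 -> h < 1 + Im w ->
  fcoef (fun z => f (z + w)%C) n = (fcoef f n * qpow w n)%C.
Proof.
  intros Hh1 Hw. set (i := ((0, 1) : C)).
  assert (Hiw : h < Im (i + w)) by (rewrite im_plus; exact Hw).
  transitivity (qpow i (- n) * fourier_coef (fun x => f (i + w + RtoC x)%C) n)%C.
  - unfold fourier_coef. rewrite <- CInt_Cmult.
    + unfold fcoef. apply CInt_ext. intros x _.
      replace ((x, 1) : C) with (i + x)%C by (apply injective_projections; simpl; ring).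
      replace (i + x + w)%C with (i + w + x)%C by ring.
      rewrite qpow_shift, (qpow_e2pi x), opp_IZR, <- RtoC_mult. ring.
    + apply ex_CInt_fourier. intros x. apply (continuous_comp (fun x => i + w + RtoC x)%C f).
      * apply continuous_Cplus; [apply continuous_const|apply continuous_RtoC].
      * apply (holomorphic_above_continuous h f _ Hf). rewrite Im_plus_R. exact Hiw.
  - rewrite fourier_coef_line, qpow_shift, qpow_opp by assumption. field. apply qpow_neq_0.
Qed.

Lemma Cmod_fcoef_le (n : Z) (y M : R) : h < 1 -> h < y ->
  (forall x, 0 <= x <= 1 -> Cmod (f (x, y)) <= M) -> Cmod (fcoef f n) <= M * exp (2 * PI * IZR n * y).
Proof.
  intros Hh1 Hy HM. rewrite <- (fcoef_at_fcoef n y) by assumption.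
  rewrite <- (Rmult_1_l (M * _)), <- (Rminus_0_r 1).
  apply Cmod_CInt_le; [lra|apply ex_CInt_continuous, continuous_fcoef_integrand, Hy|].
  intros x Hx. rewrite Cmod_mult, Cmod_qpow, opp_IZR. simpl Im.
  replace (- (2 * PI * - IZR n * y)) with (2 * PI * IZR n * y) by ring.
  apply Rmult_le_compat_r; [left; apply exp_pos|apply HM, Hx].
Qed.

Lemma bounded_on_line (y : R) : h < y -> exists M, forall x, 0 <= x <= 1 -> Cmod (f (x, y)) <= M.
Proof.
  intros Hy. destruct (ex_RInt_ub (V := C_R_CompleteNormedModule) (fun x => f (x, y)) 0 1) as [M HM].
  - apply ex_CInt_continuous, (holomorphic_above_line h f y Hf Hy).
  - exists M. intros x Hx. rewrite Cmod_norm. apply HM. rewrite Rmin_left, Rmax_right by lra. exact Hx.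
Qed.

End PeriodicHolomorphic.

Lemma fcoef_eq_0_of_growth (h : R) (f : C -> C) (n : Z) (K N : R) : h < 1 ->
  holomorphic_above h f -> periodic_above h f ->
  (forall z, 1 <= Im z -> Cmod (f z) <= K * exp (N * Im z)) -> N + 2 * PI * IZR n < 0 ->
  fcoef f n = RtoC 0.
Proof.
  intros Hh1 Hf Hper Hgrowth HN. apply NNPP. intros Hc. apply Cmod_gt_0 in Hc.
  set (c := Cmod (fcoef f n)) in *. set (a := - (N + 2 * PI * IZR n)). assert (Ha : 0 < a) by (unfold a; lra).
  set (y := 1 + Rabs K / (a * c)).
  assert (HKac : 0 <= Rabs K / (a * c)) by (apply Rdiv_le_0_compat; [apply Rabs_pos|nra]).
  assert (Hcoef := Cmod_fcoef_le h f Hf Hper n y (K * exp (N * y)) Hh1 ltac:(unfold y; lra)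
    (fun x _ => Hgrowth (x, y) ltac:(simpl; unfold y; lra))).
  fold c in Hcoef. rewrite Rmult_assoc, <- exp_plus in Hcoef.
  replace (N * y + 2 * PI * IZR n * y) with (- (a * y)) in Hcoef by (unfold a; ring).
  assert (Hexp := exp_ineq1_le (a * y)).
  assert (HK : c * exp (a * y) <= K).
  { replace K with (K * exp (- (a * y)) * exp (a * y))
      by (rewrite Rmult_assoc, <- exp_plus, Rplus_opp_l, exp_0; ring).
    apply Rmult_le_compat_r; [left; apply exp_pos|exact Hcoef]. }
  assert (Hay : c * (a * y) = a * c + Rabs K) by (unfold y; field; lra).
  assert (HabsK := Rle_abs K). nra.
Qed.

Lemma fcoef_injective (h : R) (f g : C -> C) : h < 1 ->
  holomorphic_above h f -> periodic_above h f -> holomorphic_above h g -> periodic_above h g ->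
  (forall n, fcoef f n = fcoef g n) -> forall z, h < Im z -> f z = g z.
Proof.
  intros Hh1 Hf Hfper Hg Hgper Hfg z Hz.
  apply (is_Cseries_unique (bilateral_term (fun n => fcoef f n * qpow z n)%C)).
  - apply (fourier_series h); assumption.
  - apply (is_bilateral_series_ext (fun n => fcoef g n * qpow z n)%C).
    + intros n. rewrite Hfg. reflexivity.
    + apply (fourier_series h); assumption.
Qed.

Lemma eq_0_of_fcoef_eq_0 (h : R) (f : C -> C) : h < 1 -> holomorphic_above h f -> periodic_above h f ->
  (forall n, fcoef f n = RtoC 0) -> forall z, h < Im z -> f z = RtoC 0.
Proof.
  intros Hh1 Hf Hper Hcoef. apply (fcoef_injective h f (fun _ => RtoC 0)); try assumption.
  - intros z _. apply ex_Cderive_const.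
  - intros z _. reflexivity.
  - intros n. rewrite Hcoef, fcoef_eq_0; reflexivity.
Qed.

Lemma eq_0_of_eq_0_above (h y : R) (f : C -> C) : h < 1 -> h <= y -> holomorphic_above h f -> periodic_above h f ->
  (forall z, y < Im z -> f z = RtoC 0) -> forall z, h < Im z -> f z = RtoC 0.
Proof.
  intros Hh1 Hy Hf Hper Hzero. apply eq_0_of_fcoef_eq_0; try assumption. intros n.
  rewrite <- (fcoef_at_fcoef h f Hf Hper n (y + 1)) by lra.
  transitivity (CInt (fun _ => RtoC 0) 0 1); [|rewrite CInt_const; ring].
  apply CInt_ext. intros x _. rewrite Hzero by (simpl; lra). ring.
Qed.

Lemma fcoef_plus (h : R) (f g : C -> C) (n : Z) : h < 1 ->
  holomorphic_above h f -> holomorphic_above h g ->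
  fcoef (fun z => f z + g z)%C n = (fcoef f n + fcoef g n)%C.
Proof.
  intros Hh1 Hf Hg. unfold fcoef.
  rewrite <- CInt_plus by (apply ex_CInt_continuous, (continuous_fcoef_integrand h); assumption).
  apply CInt_ext. intros x _. ring.
Qed.

Lemma fcoef_Cmult (h : R) (c : C) (f : C -> C) (n : Z) : h < 1 ->
  holomorphic_above h f -> fcoef (fun z => c * f z)%C n = (c * fcoef f n)%C.
Proof.
  intros Hh1 Hf. unfold fcoef.
  rewrite <- CInt_Cmult by (apply ex_CInt_continuous, (continuous_fcoef_integrand h); assumption).
  apply CInt_ext. intros x _. ring.
Qed.

Lemma holomorphic_above_plus (h : R) (f g : C -> C) :
  holomorphic_above h f -> holomorphic_above h g -> holomorphic_above h (fun z => f z + g z)%C.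
Proof. intros Hf Hg z Hz. apply ex_Cderive_plus; [apply Hf, Hz|apply Hg, Hz]. Qed.

Lemma holomorphic_above_Cmult (h : R) (c : C) (f : C -> C) :
  holomorphic_above h f -> holomorphic_above h (fun z => c * f z)%C.
Proof. intros Hf z Hz. apply ex_Cderive_scal, Hf, Hz. Qed.

Lemma holomorphic_above_shift (h r : R) (f : C -> C) :
  holomorphic_above h f -> holomorphic_above h (fun z => f (z + r)%C).
Proof. intros Hf z Hz. apply ex_Cderive_shift, Hf. rewrite Im_plus_R. exact Hz. Qed.

Lemma periodic_above_shift (h r : R) (f : C -> C) :
  periodic_above h f -> periodic_above h (fun z => f (z + r)%C).
Proof.
  intros Hf z Hz. replace (z + 1 + r)%C with (z + r + 1)%C by ring.
  apply Hf. rewrite Im_plus_R. exact Hz.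
Qed.

(** * Expansions in powers of q with finite principal part *)

Definition q_freq (n1 : Z) (k : nat) : C := (RtoC (2 * PI * IZR (n1 + Z.of_nat k)) * Ci)%C.

Lemma Cexp_q_freq (n1 : Z) (k : nat) (z : C) : Cexp (q_freq n1 k * z) = qpow z (n1 + Z.of_nat k).
Proof. reflexivity. Qed.

Lemma Cmod_q_freq (n1 : Z) (k : nat) : Cmod (q_freq n1 k) = 2 * PI * Rabs (IZR n1 + INR k).
Proof.
  unfold q_freq. rewrite Cmod_mult, Cmod_Ci, Cmod_R, Rmult_1_r, Rabs_mult, plus_IZR, <- INR_IZR_INZ.
  assert (HPI := PI_RGT_0). rewrite (Rabs_pos_eq (2 * PI)) by lra. reflexivity.
Qed.

Lemma Re_q_freq_mult (n1 : Z) (k : nat) (z : C) :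
  Re (q_freq n1 k * z) = - (2 * PI * (IZR n1 + INR k) * Im z).
Proof. unfold q_freq. rewrite plus_IZR, <- INR_IZR_INZ. destruct z. simpl. ring. Qed.

(* Multiplication by [q^(-n1)] moves the expansion to nonnegative exponents. *)
Lemma is_Cseries_qexp (h : R) (f : C -> C) (n1 : Z) (z : C) : h < 1 ->
  holomorphic_above h f -> periodic_above h f -> (forall n, (n < n1)%Z -> fcoef f n = RtoC 0) ->
  h < Im z -> is_Cseries (fun k => fcoef f (n1 + Z.of_nat k) * qpow z (n1 + Z.of_nat k))%C (f z).
Proof.
  intros Hh1 Hf Hper Hlow Hz. set (g := fun z => (f z * qpow z (- n1))%C).
  assert (Hg : forall n, fcoef g n = fcoef f (n1 + n)).
  { intros n. unfold g. rewrite fcoef_mult_qpow. f_equal. ring. }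
  assert (Hseries : is_bilateral_series (fun n => fcoef g n * qpow z n)%C (g z)).
  { apply (fourier_series h); [apply holomorphic_above_mult_qpow|apply periodic_above_mult_qpow| |]; assumption. }
  apply (is_Cseries_Cmult (qpow z n1)) in Hseries.
  replace (qpow z n1 * g z)%C with (f z) in Hseries
    by (unfold g; rewrite qpow_opp; field; apply qpow_neq_0).
  assert (Hterm : forall k, (qpow z n1 * bilateral_term (fun n => fcoef g n * qpow z n) k)%C =
    (fcoef f (n1 + Z.of_nat k) * qpow z (n1 + Z.of_nat k))%C).
  { intros k. rewrite qpow_plus. destruct k as [|k]; unfold bilateral_term; rewrite !Hg.
    - simpl Z.of_nat. rewrite !qpow_0. ring.
    - rewrite (Hlow (n1 + - Z.of_nat (S k))%Z) by lia. ring. }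
  exact (is_Cseries_ext _ _ _ Hterm Hseries).
Qed.

Lemma q_freq_growth_le (n1 : Z) (k : nat) (a : R) : 0 <= a ->
  a * (Rabs (IZR n1 + INR k) - 2 * (IZR n1 + INR k)) <= a * (4 * Rabs (IZR n1)) - a * INR k.
Proof.
  intros Ha. assert (Hk := pos_INR k). rewrite <- Rmult_minus_distr_l.
  apply Rmult_le_compat_l; [exact Ha|]. unfold Rabs. destruct (Rcase_abs _), (Rcase_abs _); lra.
Qed.

Lemma qexp_summable (h : R) (f : C -> C) (n1 : Z) (z : C) : h < 1 ->
  holomorphic_above h f -> periodic_above h f -> h < Im z ->
  exists d, 0 < d /\ exp_summable (fun k => fcoef f (n1 + Z.of_nat k)) (q_freq n1) z d.
Proof.
  intros Hh1 Hf Hper Hz. assert (HPI := PI_RGT_0).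
  set (y := (h + Im z) / 2). set (delta := Im z - y).
  assert (Hy : h < y) by (unfold y; lra). assert (Hdelta : 0 < delta) by (unfold delta, y; lra).
  destruct (bounded_on_line h f Hf y Hy) as [M HM]. exists (delta / 2). split; [lra|].
  assert (HM0 : 0 <= M) by (eapply Rle_trans; [apply Cmod_ge_0|apply (HM 0); lra]).
  apply ex_series_le_R with (fun k => M * exp (PI * delta * (4 * Rabs (IZR n1))) * exp (- (PI * delta * INR k)));
    [|apply ex_series_exp_geom; nra].
  intros k. split; [apply Rmult_le_pos; [apply Cmod_ge_0|left; apply exp_pos]|].
  assert (Hcoef := Cmod_fcoef_le h f Hf Hper (n1 + Z.of_nat k) y M Hh1 Hy HM).
  rewrite plus_IZR, <- INR_IZR_INZ in Hcoef.
  rewrite Re_q_freq_mult, Cmod_q_freq, (Rmult_assoc M), <- exp_plus.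
  eapply Rle_trans; [apply Rmult_le_compat_r; [left; apply exp_pos|exact Hcoef]|].
  rewrite Rmult_assoc, <- exp_plus. apply Rmult_le_compat_l; [exact HM0|]. apply exp_le.
  assert (Hgrowth := q_freq_growth_le n1 k (PI * delta) ltac:(nra)).
  replace (Im z) with (y + delta) by (unfold delta; ring). lra.
Qed.

Lemma qexp_decay (c : nat -> C) (n1 : Z) (z0 : C) (d : R) : 0 <= d -> exp_summable c (q_freq n1) z0 d ->
  exists K, 0 <= K /\ forall z l, Im z0 <= Im z ->
    is_Cseries (fun k => c k * Cexp (q_freq n1 k * z))%C l -> Cmod l <= K * exp (- (2 * PI * IZR n1 * Im z)).
Proof.
  intros Hd Hsum. assert (HPI := PI_RGT_0). apply (exp_summable_le _ _ _ _ 0 Hd) in Hsum.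
  set (b := fun k => Cmod (c k) * exp (Re (q_freq n1 k * z0) + Cmod (q_freq n1 k) * 0)).
  assert (Hb : forall k, 0 <= b k) by (intros k; apply Rmult_le_pos; [apply Cmod_ge_0|left; apply exp_pos]).
  exists (Series b * exp (2 * PI * IZR n1 * Im z0)). split.
  - apply Rmult_le_pos; [|left; apply exp_pos]. rewrite <- (Rmult_0_l (Series b)), <- Series_scal_l.
    apply Series_le; [|exact Hsum]. intros k. specialize (Hb k). lra.
  - intros z l Hz Hl. rewrite Rmult_assoc, <- exp_plus, <- Series_scal_r.
    apply (Cmod_Cseries_le _ _ _ Hl); [|apply ex_series_scal_r, Hsum].
    intros k. unfold b. rewrite Cmod_mult, Cmod_Cexp, !Re_q_freq_mult, Rmult_0_r, Rplus_0_r,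
      (Rmult_assoc (Cmod (c k))), <- exp_plus.
    apply Rmult_le_compat_l; [apply Cmod_ge_0|]. apply exp_le.
    assert (Hk := pos_INR k). assert (0 <= PI * (INR k * (Im z - Im z0))) by (apply Rmult_le_pos; nra). lra.
Qed.

Section QExpansion.

Variables (h : R) (f : C -> C) (n1 : Z).
Hypotheses (Hh1 : h < 1) (Hf : holomorphic_above h f) (Hper : periodic_above h f).
Hypothesis Hlow : forall n, (n < n1)%Z -> fcoef f n = RtoC 0.

Let coef (k : nat) : C := fcoef f (n1 + Z.of_nat k).

Lemma is_Cderive_qexp (z : C) : h < Im z ->
  is_Cderive f z (exp_series (fun k => coef k * q_freq n1 k)%C (q_freq n1) z).
Proof.
  intros Hz. apply is_Cderive_ext_above with h (exp_series coef (q_freq n1)); [|exact Hz|].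
  - intros w Hw. apply Cseries_unique. exact (is_Cseries_qexp h f n1 w Hh1 Hf Hper Hlow Hw).
  - destruct (qexp_summable h f n1 z Hh1 Hf Hper Hz) as [d [Hd Hsum]].
    apply is_Cderive_exp_series with d; assumption.
Qed.

Lemma holomorphic_above_C_derive : holomorphic_above h (C_derive f).
Proof.
  intros z Hz. destruct (qexp_summable h f n1 z Hh1 Hf Hper Hz) as [d [Hd Hsum]].
  eexists. apply is_Cderive_ext_above with (2 := Hz)
    (3 := is_Cderive_exp_series _ _ z (d / 2) ltac:(lra) (exp_summable_derive _ _ z d Hd Hsum)).
  intros w Hw. symmetry. apply is_C_derive_unique, is_Cderive_qexp, Hw.
Qed.

Lemma qexp_growth (y0 : R) : h < y0 -> exists K, 0 <= K /\ forall z, y0 <= Im z ->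
  Cmod (f z) <= K * exp (- (2 * PI * IZR n1 * Im z)) /\
  Cmod (C_derive f z) <= K * exp (- (2 * PI * IZR n1 * Im z)).
Proof.
  intros Hy0. set (z0 := ((0, y0) : C)).
  destruct (qexp_summable h f n1 z0 Hh1 Hf Hper Hy0) as [d [Hd Hsum]].
  assert (Hsum' := exp_summable_derive _ _ z0 d Hd Hsum).
  destruct (qexp_decay _ n1 z0 d ltac:(lra) Hsum) as [K [HK Hdecay]].
  destruct (qexp_decay _ n1 z0 (d / 2) ltac:(lra) Hsum') as [K' [HK' Hdecay']].
  exists (K + K'). split; [lra|]. intros z Hz.
  assert (Hexp := exp_pos (- (2 * PI * IZR n1 * Im z))). split.
  - eapply Rle_trans; [|apply Rmult_le_compat_r with (r1 := K); lra].
    apply (Hdecay z); [exact Hz|]. apply (is_Cseries_qexp h f n1 z Hh1 Hf Hper Hlow). simpl in Hz. lra.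
  - rewrite (is_C_derive_unique _ _ _ (is_Cderive_qexp z ltac:(lra))).
    destruct (qexp_summable h f n1 z Hh1 Hf Hper ltac:(lra)) as [e [He Hsum_z]].
    eapply Rle_trans; [apply (Hdecay' z); [exact Hz|]|apply Rmult_le_compat_r; lra].
    apply (is_Cseries_exp_series _ _ z z (e / 2) (exp_summable_derive _ _ z e He Hsum_z)).
    replace (z - z)%C with (RtoC 0) by ring. rewrite Cmod_0. lra.
Qed.

Lemma qexp_leading_term (y0 : R) : h < y0 -> exists K, 0 <= K /\ forall z, y0 <= Im z ->
  Cmod (f z - fcoef f n1 * qpow z n1) <= K * exp (- (2 * PI * IZR (n1 + 1) * Im z)).
Proof.
  intros Hy0. set (z0 := ((0, y0) : C)).
  assert (Hfreq : forall k, q_freq (n1 + 1) k = q_freq n1 (S k)).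
  { intros k. unfold q_freq. replace (n1 + 1 + Z.of_nat k)%Z with (n1 + Z.of_nat (S k))%Z by lia. reflexivity. }
  destruct (qexp_summable h f n1 z0 Hh1 Hf Hper Hy0) as [d [Hd Hsum]].
  assert (Hsum_tail : exp_summable (fun k => coef (S k)) (q_freq (n1 + 1)) z0 d).
  { apply ex_series_incr_1 in Hsum. revert Hsum. apply ex_series_ext. intros k. rewrite Hfreq. reflexivity. }
  destruct (qexp_decay _ (n1 + 1) z0 d ltac:(lra) Hsum_tail) as [K [HK Hdecay]].
  exists K. split; [exact HK|]. intros z Hz. apply (Hdecay z); [exact Hz|].
  assert (Hz' : h < Im z) by lra.
  assert (Hseries := is_Cseries_tail _ _ (is_Cseries_qexp h f n1 z Hh1 Hf Hper Hlow Hz')).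
  cbv beta in Hseries. simpl (Z.of_nat 0) in Hseries. rewrite Z.add_0_r in Hseries.
  revert Hseries. apply is_Cseries_ext. intros k. rewrite Hfreq. reflexivity.
Qed.

Lemma qexp_neq_0 : fcoef f n1 <> RtoC 0 -> exists Y, h <= Y /\ forall z, Y < Im z -> f z <> RtoC 0.
Proof.
  intros Hc. apply Cmod_gt_0 in Hc. set (m := Cmod (fcoef f n1)) in *. assert (HPI := PI2_3_2).
  destruct (qexp_leading_term (Rmax h 0 + 1)) as [K [HK Hlead]]; [assert (Hh := Rmax_l h 0); lra|].
  assert (Hh := Rmax_l h 0). assert (Hmax0 := Rmax_r h 0).
  assert (HKm : 0 <= K / m) by (apply Rdiv_le_0_compat; assumption).
  exists (Rmax h 0 + 1 + K / m). split; [lra|]. intros z Hz Hfz. specialize (Hlead z ltac:(lra)).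
  rewrite Hfz in Hlead. replace (0 - fcoef f n1 * qpow z n1)%C with (- (fcoef f n1 * qpow z n1))%C in Hlead by ring.
  rewrite Cmod_opp, Cmod_mult, Cmod_qpow in Hlead. fold m in Hlead.
  rewrite plus_IZR in Hlead.
  replace (- (2 * PI * (IZR n1 + 1) * Im z)) with (- (2 * PI * Im z) + - (2 * PI * IZR n1 * Im z)) in Hlead by ring.
  rewrite exp_plus, <- Rmult_assoc in Hlead. apply Rmult_le_reg_r in Hlead; [|apply exp_pos].
  rewrite exp_Ropp in Hlead. assert (Hineq := exp_ineq1_le (2 * PI * Im z)).
  assert (HmE : m * exp (2 * PI * Im z) <= K).
  { replace K with (K * / exp (2 * PI * Im z) * exp (2 * PI * Im z)) by (field; apply Rgt_not_eq, exp_pos).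
    apply Rmult_le_compat_r; [left; apply exp_pos|exact Hlead]. }
  assert (HKlt : K < m * Im z).
  { replace K with (m * (K / m)) by (field; lra). apply Rmult_lt_compat_l; lra. }
  assert (Im z <= exp (2 * PI * Im z)) by nra. nra.
Qed.

End QExpansion.

Lemma derivative_zero_constant (h : R) (f : C -> C) :
  (forall z, h < Im z -> is_Cderive f z (RtoC 0)) -> forall z w, h < Im z -> h < Im w -> f z = f w.
Proof.
  intros Hf z w Hz Hw.
  replace (f w) with (f (z + RtoC 1 * (w - z))%C) by (f_equal; ring).
  replace (f z) with (f (z + RtoC 0 * (w - z))%C) by (f_equal; ring).
  apply (eq_is_derive (V := C_R_NormedModule) (fun t => f (z + RtoC t * (w - z))%C)); [|lra].
  intros t Ht. change (is_RCderive (fun t => f (z + RtoC t * (w - z))%C) t (RtoC 0)).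
  rewrite <- (Cmult_0_r (w - z)). apply is_RCderive_line, Hf.
  unfold Cminus. rewrite im_plus, im_scal_l, im_plus, im_opp. destruct (Rle_lt_dec (Im z) (Im w)); nra.
Qed.

(** * Jacobi's theta function and its inversion formula *)

(* [jtheta s z] is the sum of [e2pi (s n^2 + n z)] over all integers [n], and [half_theta s z] its part [1 <= n]. *)
Definition square_qpow (s : C) (n : nat) : C := qpow s ((1 + Z.of_nat n) * (1 + Z.of_nat n)).

Definition half_theta (s z : C) : C := exp_series (square_qpow s) (q_freq 1) z.

Definition jtheta (s z : C) : C := (1 + half_theta s z + half_theta s (- z))%C.

Definition half_theta_dz (s z : C) : C := exp_series (fun n => square_qpow s n * q_freq 1 n)%C (q_freq 1) z.

Definition half_theta_dzz (s z : C) : C :=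
  exp_series (fun n => square_qpow s n * q_freq 1 n * q_freq 1 n)%C (q_freq 1) z.

Lemma Cmod_square_qpow (s : C) (n : nat) : Cmod (square_qpow s n) = exp (- (2 * PI * Im s * (1 + INR n) ^ 2)).
Proof.
  unfold square_qpow. rewrite Cmod_qpow, mult_IZR, plus_IZR, <- INR_IZR_INZ. f_equal. ring.
Qed.

Lemma half_theta_summable (s z : C) (d : R) : 0 < Im s -> exp_summable (square_qpow s) (q_freq 1) z d.
Proof.
  intros Hs. assert (HPI := PI_RGT_0).
  apply ex_series_le_R with (2 := ex_series_gaussian (2 * PI * Im s) (2 * PI * d - 2 * PI * Im z) ltac:(nra)).
  intros n. rewrite Cmod_square_qpow, Re_q_freq_mult, Cmod_q_freq, <- exp_plus.
  rewrite Rabs_pos_eq by (assert (Hn := pos_INR n); lra).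
  split; [left; apply exp_pos|]. right. f_equal. ring.
Qed.

Lemma is_Cseries_half_theta (s z : C) : 0 < Im s ->
  is_Cseries (fun n => square_qpow s n * qpow z (1 + Z.of_nat n))%C (half_theta s z).
Proof.
  intros Hs. apply (is_Cseries_exp_series _ (q_freq 1) z z 1 (half_theta_summable s z 1 Hs)).
  replace (z - z)%C with (RtoC 0) by ring. rewrite Cmod_0. lra.
Qed.

Lemma half_theta_plus_1 (s z : C) : half_theta s (z + 1) = half_theta s z.
Proof.
  assert (Hterm : forall n, Cexp (q_freq 1 n * (z + 1)) = Cexp (q_freq 1 n * z)).
  { intros n. rewrite !Cexp_q_freq. apply qpow_plus_1. }
  unfold half_theta, exp_series, Cseries. f_equal; apply Series_ext; intros n; rewrite Hterm; reflexivity.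
Qed.

Lemma half_theta_quasi_periodic (s z : C) : 0 < Im s ->
  half_theta s z = (e2pi (s + z) * (1 + half_theta s (z + 2 * s)))%C.
Proof.
  intros Hs. assert (Htail := is_Cseries_tail _ _ (is_Cseries_half_theta s z Hs)). cbv beta in Htail.
  assert (Hshift := is_Cseries_Cmult (e2pi (s + z)) _ _ (is_Cseries_half_theta s (z + 2 * s) Hs)).
  assert (Hhead : (square_qpow s 0 * qpow z (1 + Z.of_nat 0))%C = e2pi (s + z)).
  { unfold square_qpow. simpl. rewrite !qpow_e2pi, <- e2pi_plus. f_equal. ring. }
  rewrite Hhead in Htail.
  assert (Heq : (half_theta s z - e2pi (s + z))%C = (e2pi (s + z) * half_theta s (z + 2 * s))%C).
  { refine (is_Cseries_unique _ _ _ Htail _). revert Hshift. apply is_Cseries_ext. intros n.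
    unfold square_qpow. rewrite !qpow_e2pi, <- !e2pi_plus. f_equal.
    rewrite Nat2Z.inj_succ, !mult_IZR, !plus_IZR, succ_IZR, !RtoC_mult, !RtoC_plus. ring. }
  replace (half_theta s z) with (half_theta s z - e2pi (s + z) + e2pi (s + z))%C by ring.
  rewrite Heq. ring.
Qed.

Lemma jtheta_plus_1 (s z : C) : jtheta s (z + 1) = jtheta s z.
Proof.
  unfold jtheta. rewrite half_theta_plus_1, <- (half_theta_plus_1 s (- (z + 1))).
  replace (- (z + 1) + 1)%C with (- z)%C by ring. reflexivity.
Qed.

Lemma jtheta_quasi_periodic (s z : C) : 0 < Im s -> (e2pi (s + z) * jtheta s (z + 2 * s))%C = jtheta s z.
Proof.
  intros Hs. unfold jtheta. rewrite (half_theta_quasi_periodic s z Hs).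
  rewrite (half_theta_quasi_periodic s (- (z + 2 * s)) Hs).
  replace (- (z + 2 * s) + 2 * s)%C with (- z)%C by ring.
  replace (s + - (z + 2 * s))%C with (- (s + z))%C by ring.
  rewrite e2pi_opp. field. apply e2pi_neq_0.
Qed.

Lemma is_Cderive_half_theta (s z : C) : 0 < Im s -> is_Cderive (half_theta s) z (half_theta_dz s z).
Proof. intros Hs. exact (is_Cderive_exp_series _ _ z 1 Rlt_0_1 (half_theta_summable s z 1 Hs)). Qed.

Lemma is_Cderive_half_theta_dz (s z : C) : 0 < Im s -> is_Cderive (half_theta_dz s) z (half_theta_dzz s z).
Proof.
  intros Hs. assert (Hsum := exp_summable_derive _ _ z 1 Rlt_0_1 (half_theta_summable s z 1 Hs)).
  exact (is_Cderive_exp_series _ _ z (1 / 2) ltac:(lra) Hsum).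
Qed.

Definition jtheta_dz (s z : C) : C := (half_theta_dz s z - half_theta_dz s (- z))%C.

Lemma is_Cderive_jtheta (s z : C) : 0 < Im s -> is_Cderive (jtheta s) z (jtheta_dz s z).
Proof.
  intros Hs. unfold jtheta. eapply is_Cderive_eq.
  2: { apply is_Cderive_plus; [apply is_Cderive_plus; [apply is_Cderive_const|apply is_Cderive_half_theta, Hs]|].
       apply is_Cderive_reflect, is_Cderive_half_theta, Hs. }
  unfold jtheta_dz. ring.
Qed.

Lemma is_Cderive_jtheta_dz_0 (s : C) : 0 < Im s -> is_Cderive (jtheta_dz s) (RtoC 0) (2 * half_theta_dzz s 0)%C.
Proof.
  intros Hs. eapply is_Cderive_eq.
  2: { apply is_Cderive_minus; [apply is_Cderive_half_theta_dz, Hs|].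
       apply is_Cderive_reflect, is_Cderive_half_theta_dz, Hs. }
  replace (- 0)%C with (RtoC 0) by ring. ring.
Qed.

Lemma jtheta_dz_0 (s : C) : jtheta_dz s 0 = RtoC 0.
Proof. unfold jtheta_dz. replace (- 0)%C with (RtoC 0) by ring. ring. Qed.

Definition gauss_jtheta (s z : C) : C := (e2pi (s * (z * z)) * jtheta s (2 * s * z))%C.

Definition gauss_jtheta_dz (s z : C) : C :=
  (e2pi (s * (z * z)) * (2 * s * (RtoC (2 * PI) * Ci * z * jtheta s (2 * s * z) + jtheta_dz s (2 * s * z))))%C.

Lemma is_Cderive_gaussian (s z : C) :
  is_Cderive (fun w => e2pi (s * (w * w))%C) z (2 * s * RtoC (2 * PI) * Ci * z * e2pi (s * (z * z)))%C.
Proof.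
  eapply is_Cderive_eq.
  2: { apply (is_Cderive_comp e2pi (fun w => s * (w * w))%C); [|apply is_Cderive_e2pi].
       apply is_Cderive_scal, is_Cderive_mult; apply is_Cderive_id. }
  cbv beta. ring.
Qed.

Lemma is_Cderive_gauss_jtheta (s z : C) : 0 < Im s -> is_Cderive (gauss_jtheta s) z (gauss_jtheta_dz s z).
Proof.
  intros Hs. eapply is_Cderive_eq.
  2: { apply is_Cderive_mult; [apply is_Cderive_gaussian|].
       apply is_Cderive_dilate, is_Cderive_jtheta, Hs. }
  unfold gauss_jtheta_dz. cbv beta. ring.
Qed.

Lemma is_Cderive_gauss_jtheta_dz_0 (s : C) : 0 < Im s ->
  is_Cderive (gauss_jtheta_dz s) (RtoC 0)
    (2 * s * (RtoC (2 * PI) * Ci * jtheta s 0 + 2 * s * (2 * half_theta_dzz s 0)))%C.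
Proof.
  intros Hs. assert (Harg : (2 * s * 0)%C = RtoC 0) by ring.
  assert (Hdz : is_Cderive (fun w => jtheta_dz s (2 * s * w)%C) (RtoC 0) (2 * s * (2 * half_theta_dzz s 0))%C).
  { apply is_Cderive_dilate. rewrite Harg. apply is_Cderive_jtheta_dz_0, Hs. }
  assert (Hj : is_Cderive (fun w => jtheta s (2 * s * w)%C) (RtoC 0) (2 * s * jtheta_dz s (2 * s * 0))%C).
  { apply is_Cderive_dilate, is_Cderive_jtheta, Hs. }
  eapply is_Cderive_eq.
  2: { apply is_Cderive_mult; [apply is_Cderive_gaussian|]. apply is_Cderive_scal, is_Cderive_plus; [|exact Hdz].
       apply is_Cderive_mult; [|exact Hj]. apply is_Cderive_scal, is_Cderive_id. }
  cbv beta. rewrite Harg, jtheta_dz_0. replace (s * (0 * 0))%C with (RtoC 0) by ring. rewrite e2pi_0. ring.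
Qed.

Lemma gauss_jtheta_plus_1 (s z : C) : 0 < Im s -> gauss_jtheta s (z + 1) = gauss_jtheta s z.
Proof.
  intros Hs. unfold gauss_jtheta. rewrite <- (jtheta_quasi_periodic s (2 * s * z) Hs), !Cmult_assoc, <- e2pi_plus.
  f_equal; f_equal; ring.
Qed.

Lemma gauss_jtheta_shift (s z : C) : s <> RtoC 0 ->
  gauss_jtheta s (z - / (2 * s)) = (e2pi (/ (4 * s) - z) * gauss_jtheta s z)%C.
Proof.
  intros Hs. unfold gauss_jtheta. rewrite !Cmult_assoc, <- e2pi_plus, <- (jtheta_plus_1 s (2 * s * (z - / (2 * s)))).
  f_equal; f_equal; field; auto.
Qed.

Lemma holomorphic_above_gauss_jtheta (h : R) (s : C) : 0 < Im s -> holomorphic_above h (gauss_jtheta s).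
Proof. intros Hs z _. eexists. apply is_Cderive_gauss_jtheta, Hs. Qed.

Lemma periodic_above_gauss_jtheta (h : R) (s : C) : 0 < Im s -> periodic_above h (gauss_jtheta s).
Proof. intros Hs z _. apply gauss_jtheta_plus_1, Hs. Qed.

(* Comparing the shifts of [gauss_jtheta s] by the periods [1] and [-1/(2s)] determines its Fourier coefficients. *)
Lemma fcoef_gauss_jtheta_succ (s : C) (n : Z) : 0 < Im s ->
  fcoef (gauss_jtheta s) (n + 1) = (qpow (- / (4 * s)) (2 * n + 1) * fcoef (gauss_jtheta s) n)%C.
Proof.
  intros Hs. assert (Hs0 := Im_neq_0 s Hs).
  assert (H2s : 0 < Im (2 * s)) by (rewrite im_scal_l; lra).
  assert (Hw := Im_neg_inv_pos _ H2s).
  assert (Hshift := fcoef_shift 0 (gauss_jtheta s) (holomorphic_above_gauss_jtheta 0 s Hs)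
    (periodic_above_gauss_jtheta 0 s Hs) (- / (2 * s)) n Rlt_0_1 ltac:(lra)).
  replace (fcoef (fun z => gauss_jtheta s (z + - / (2 * s))) n)
    with (e2pi (/ (4 * s)) * fcoef (gauss_jtheta s) (n + 1))%C in Hshift.
  - apply Cmult_eq_reg_l with (e2pi (/ (4 * s))); [apply e2pi_neq_0|]. rewrite Hshift, Cmult_assoc.
    rewrite !qpow_e2pi, <- e2pi_plus, (Cmult_comm (fcoef _ _)). do 2 f_equal.
    rewrite plus_IZR, mult_IZR, RtoC_plus, RtoC_mult. field. auto.
  - replace (n + 1)%Z with (n - -1)%Z by ring. rewrite <- fcoef_mult_qpow, <- (fcoef_Cmult 0).
    + apply fcoef_ext. intros z _.
      change (gauss_jtheta s (z + - / (2 * s)))%C with (gauss_jtheta s (z - / (2 * s)))%C.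
      rewrite gauss_jtheta_shift, qpow_e2pi by exact Hs0.
      replace (e2pi (/ (4 * s) - z))%C with (e2pi (/ (4 * s)) * e2pi (-1 * z))%C
        by (rewrite <- e2pi_plus; f_equal; ring).
      ring.
    + lra.
    + apply holomorphic_above_mult_qpow, holomorphic_above_gauss_jtheta, Hs.
Qed.

Definition jtheta_factor (s : C) : C := fcoef (gauss_jtheta s) 0.

Lemma fcoef_gauss_jtheta (s : C) (n : Z) : 0 < Im s ->
  fcoef (gauss_jtheta s) n = (jtheta_factor s * qpow (- / (4 * s)) (n * n))%C.
Proof.
  intros Hs. induction n as [|n IH|n IH] using Z.peano_ind.
  - rewrite Z.mul_0_l, qpow_0. unfold jtheta_factor. ring.
  - unfold Z.succ. rewrite fcoef_gauss_jtheta_succ, IH by exact Hs.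
    replace ((n + 1) * (n + 1))%Z with (2 * n + 1 + n * n)%Z by ring. rewrite (qpow_plus _ (2 * n + 1)). ring.
  - apply Cmult_eq_reg_l with (qpow (- / (4 * s)) (2 * Z.pred n + 1)); [apply qpow_neq_0|].
    rewrite <- fcoef_gauss_jtheta_succ by exact Hs. replace (Z.pred n + 1)%Z with n by lia. rewrite IH.
    replace (n * n)%Z with (2 * Z.pred n + 1 + Z.pred n * Z.pred n)%Z by lia. rewrite qpow_plus. ring.
Qed.

Lemma is_bilateral_series_jtheta (s z : C) : 0 < Im s ->
  is_bilateral_series (fun n => qpow s (n * n) * qpow z n)%C (jtheta s z).
Proof.
  intros Hs. unfold is_bilateral_series, jtheta. rewrite <- Cplus_assoc.
  assert (Hhead : bilateral_term (fun n => qpow s (n * n) * qpow z n)%C 0 = RtoC 1)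
    by (unfold bilateral_term; rewrite Z.mul_0_l, !qpow_0; ring).
  rewrite <- Hhead. apply is_Cseries_cons.
  assert (Hseries := is_Cseries_plus _ _ _ _ (is_Cseries_half_theta s z Hs) (is_Cseries_half_theta s (- z) Hs)).
  revert Hseries. apply is_Cseries_ext. intros n. unfold bilateral_term, square_qpow.
  rewrite Nat2Z.inj_succ, Z.mul_opp_opp. replace (Z.succ (Z.of_nat n)) with (1 + Z.of_nat n)%Z by lia.
  rewrite (qpow_e2pi (- z)), (qpow_e2pi z (- _)), opp_IZR, RtoC_opp.
  replace (IZR (1 + Z.of_nat n) * - z)%C with (- IZR (1 + Z.of_nat n) * z)%C by ring. reflexivity.
Qed.

Lemma jtheta_inversion (s z : C) : 0 < Im s ->
  gauss_jtheta s z = (jtheta_factor s * jtheta (- / (4 * s)) z)%C.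
Proof.
  intros Hs. set (h := Rmin 0 (Im z - 1)).
  assert (Hh : h < 1 /\ h < Im z).
  { assert (Hmin0 := Rmin_l 0 (Im z - 1)). assert (Hmin1 := Rmin_r 0 (Im z - 1)). fold h in Hmin0, Hmin1. lra. }
  assert (H4s : 0 < Im (4 * s)) by (rewrite im_scal_l; lra).
  apply (is_Cseries_unique (bilateral_term (fun n => fcoef (gauss_jtheta s) n * qpow z n)%C)).
  - apply (fourier_series h); [apply holomorphic_above_gauss_jtheta|apply periodic_above_gauss_jtheta| |]; tauto.
  - apply (is_bilateral_series_ext (fun n => jtheta_factor s * (qpow (- / (4 * s)) (n * n) * qpow z n))%C).
    + intros n. rewrite fcoef_gauss_jtheta by exact Hs. ring.
    + apply is_bilateral_series_Cmult, is_bilateral_series_jtheta, Im_neg_inv_pos, H4s.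
Qed.

Lemma theta_half_theta (s : C) : 0 < Im s -> theta s = (1 + 2 * half_theta s 0)%C.
Proof.
  intros Hs. rewrite <- (Cseries_unique _ _ (is_Cseries_half_theta s 0 Hs)).
  assert (Hterm : forall n, (square_qpow s n * qpow 0 (1 + Z.of_nat n))%C = qpow s (Z.of_nat (S n) * Z.of_nat (S n))).
  { intros n. unfold square_qpow. rewrite (qpow_e2pi 0), Cmult_0_r, e2pi_0, Nat2Z.inj_succ, Cmult_1_r. f_equal. lia. }
  unfold theta, Cseries. rewrite (Series_ext _ _ (fun n => f_equal Re (Hterm n))).
  rewrite (Series_ext _ _ (fun n => f_equal Im (Hterm n))). apply injective_projections; simpl; ring.
Qed.

Lemma jtheta_0 (s : C) : 0 < Im s -> jtheta s 0 = theta s.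
Proof.
  intros Hs. rewrite theta_half_theta by exact Hs. unfold jtheta. replace (- 0)%C with (RtoC 0) by ring. ring.
Qed.

Lemma theta_inversion (s : C) : 0 < Im s -> theta s = (jtheta_factor s * theta (- / (4 * s)))%C.
Proof.
  intros Hs. assert (H4s : 0 < Im (4 * s)) by (rewrite im_scal_l; lra).
  rewrite <- !jtheta_0 by (try apply Im_neg_inv_pos; assumption).
  rewrite <- jtheta_inversion by exact Hs. unfold gauss_jtheta. rewrite !Cmult_0_r, e2pi_0. ring.
Qed.

Definition square_freq (n : nat) : C :=
  (RtoC (2 * PI * IZR ((1 + Z.of_nat n) * (1 + Z.of_nat n))) * Ci)%C.

Lemma square_freq_summable (s : C) : 0 < Im s -> exp_summable (fun _ => RtoC 1) square_freq s (Im s / 2).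
Proof.
  intros Hs. assert (HPI := PI_RGT_0).
  apply ex_series_le_R with (2 := ex_series_gaussian (PI * Im s) 0 ltac:(nra)). intros n.
  change (square_freq n * s)%C with (RtoC (2 * PI * IZR ((1 + Z.of_nat n) * (1 + Z.of_nat n))) * Ci * s)%C.
  unfold square_freq.
  rewrite Cmod_1, Rmult_1_l, Cmod_mult, Cmod_Ci, Cmod_R, <- Cmult_assoc, re_scal_l, mult_IZR, plus_IZR, <- INR_IZR_INZ.
  rewrite Rabs_pos_eq by (assert (Hsqr := Rle_0_sqr (1 + INR n)); unfold Rsqr in Hsqr; nra).
  split; [left; apply exp_pos|]. right. f_equal. destruct s. simpl. field.
Qed.

(* By the heat equation, the derivative in [s] is a multiple of the second derivative in [z]. *)
Lemma is_Cderive_theta (s : C) : 0 < Im s ->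
  is_Cderive theta s (2 * half_theta_dzz s 0 / (RtoC (2 * PI) * Ci))%C.
Proof.
  intros Hs. set (ds := exp_series (fun n => 1 * square_freq n)%C square_freq).
  assert (Hheat : half_theta_dzz s 0 = (RtoC (2 * PI) * Ci * ds s)%C).
  { apply Cseries_unique.
    assert (Hds := is_Cseries_Cmult (RtoC (2 * PI) * Ci) _ _ (is_Cseries_exp_series _ _ s s (Im s / 2 / 2)
      (exp_summable_derive _ _ s (Im s / 2) ltac:(lra) (square_freq_summable s Hs))
      ltac:(replace (s - s)%C with (RtoC 0) by ring; rewrite Cmod_0; lra))).
    revert Hds. apply is_Cseries_ext. intros n.
    change (Cexp (square_freq n * s)) with (square_qpow s n). unfold square_freq, q_freq.
    rewrite Cmult_0_r, Cexp_0, mult_IZR, !RtoC_mult. ring. }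
  rewrite Hheat. apply is_Cderive_ext_above with 0 (fun s => 1 + 2 * exp_series (fun _ => RtoC 1) square_freq s)%C.
  - intros w Hw. rewrite theta_half_theta by exact Hw. do 2 f_equal.
    apply Cseries_unique. assert (Hseries := is_Cseries_half_theta w 0 Hw). revert Hseries. apply is_Cseries_ext.
    intros n. change (Cexp (square_freq n * w)) with (square_qpow w n).
    rewrite qpow_e2pi, Cmult_0_r, e2pi_0. apply Cmult_comm.
  - exact Hs.
  - eapply is_Cderive_eq.
    2: { apply is_Cderive_plus; [apply is_Cderive_const|]. apply is_Cderive_scal.
         apply is_Cderive_exp_series with (Im s / 2); [lra|]. apply square_freq_summable, Hs. }
    cbv beta. fold (ds s). field. split; [apply Ci_nz|apply RtoC_2PI_neq_0].
Qed.

Lemma heat_theta (s : C) : 0 < Im s -> (2 * half_theta_dzz s 0)%C = (RtoC (2 * PI) * Ci * C_derive theta s)%C.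
Proof.
  intros Hs. rewrite (is_C_derive_unique _ _ _ (is_Cderive_theta s Hs)). field.
  split; [apply Ci_nz|apply RtoC_2PI_neq_0].
Qed.

Lemma C_derive_theta_inversion (s : C) : 0 < Im s ->
  (jtheta_factor s * C_derive theta (- / (4 * s)))%C = (2 * s * theta s + 4 * s * s * C_derive theta s)%C.
Proof.
  intros Hs. assert (H4s : 0 < Im (4 * s)) by (rewrite im_scal_l; lra). assert (HS := Im_neg_inv_pos _ H4s).
  set (S := (- / (4 * s))%C) in *. set (c := jtheta_factor s).
  assert (Hdz : forall z, gauss_jtheta_dz s z = (c * jtheta_dz S z)%C).
  { intros z. apply (is_Cderive_unique (gauss_jtheta s) z); [apply is_Cderive_gauss_jtheta, Hs|].
    apply is_Cderive_ext with (fun z => c * jtheta S z)%C; [intros w; symmetry; apply jtheta_inversion, Hs|].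
    apply is_Cderive_scal, is_Cderive_jtheta, HS. }
  assert (Hdzz : is_Cderive (gauss_jtheta_dz s) (RtoC 0) (c * (2 * half_theta_dzz S 0))%C).
  { apply is_Cderive_ext with (fun z => c * jtheta_dz S z)%C; [intros w; symmetry; apply Hdz|].
    apply is_Cderive_scal, is_Cderive_jtheta_dz_0, HS. }
  apply (is_Cderive_unique _ _ _ _ (is_Cderive_gauss_jtheta_dz_0 s Hs)) in Hdzz.
  rewrite !heat_theta, jtheta_0 in Hdzz by assumption.
  apply Cmult_eq_reg_l with (RtoC (2 * PI) * Ci)%C.
  - apply Cmult_neq_0; [apply RtoC_2PI_neq_0|apply Ci_nz].
  - rewrite Cmult_assoc, (Cmult_comm _ c), <- Cmult_assoc, <- Hdzz. ring.
Qed.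

(** * Even and odd squares in the theta series *)

Lemma is_Cseries_square_qpow (s : C) : 0 < Im s -> is_Cseries (square_qpow s) (half_theta s 0).
Proof.
  intros Hs. apply is_Cseries_ext with (2 := is_Cseries_half_theta s 0 Hs). intros n.
  rewrite (qpow_e2pi 0), Cmult_0_r, e2pi_0. apply Cmult_1_r.
Qed.

Lemma is_Cseries_odd_squares (z : C) : 0 < Im z ->
  is_Cseries (fun n => square_qpow (z / 4) (2 * n)) (e2pi (z / 4) * (1 + half_theta z z))%C.
Proof.
  intros Hz. rewrite Cmult_plus_distr_l, Cmult_1_r.
  replace (e2pi (z / 4)) with (square_qpow (z / 4) (2 * 0)) at 1
    by (unfold square_qpow; rewrite qpow_e2pi; f_equal; simpl; ring).
  apply (is_Cseries_cons (fun n => square_qpow (z / 4) (2 * n))).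
  apply is_Cseries_ext with (2 := is_Cseries_Cmult (e2pi (z / 4)) _ _ (is_Cseries_half_theta z z Hz)).
  intros n. unfold square_qpow. rewrite !qpow_e2pi, <- !e2pi_plus. f_equal.
  replace (1 + Z.of_nat (2 * S n))%Z with (2 * (1 + Z.of_nat n) + 1)%Z by lia. set (k := (1 + Z.of_nat n)%Z).
  rewrite !mult_IZR, plus_IZR, mult_IZR, !RtoC_mult, RtoC_plus, RtoC_mult. field.
Qed.

Lemma square_qpow_div_4 (z : C) (n : nat) : square_qpow (z / 4) (2 * n + 1) = square_qpow z n.
Proof.
  unfold square_qpow. rewrite !qpow_e2pi. f_equal.
  replace (1 + Z.of_nat (2 * n + 1))%Z with (2 * (1 + Z.of_nat n))%Z by lia.
  rewrite !mult_IZR, !RtoC_mult. field.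
Qed.

Definition theta_odd (z : C) : C := (theta (z / 4) - theta z)%C.

(* The even squares of the series [theta (z / 4)] form the series [theta z]. *)
Lemma theta_odd_half_theta (z : C) : 0 < Im z -> theta_odd z = (2 * (e2pi (z / 4) * (1 + half_theta z z)))%C.
Proof.
  intros Hz. assert (Hz4 : 0 < Im (z / 4)) by (rewrite Im_div_4; lra). assert (HPI := PI_RGT_0).
  unfold theta_odd. rewrite !theta_half_theta by assumption.
  replace (half_theta (z / 4) 0) with (e2pi (z / 4) * (1 + half_theta z z) + half_theta z 0)%C; [ring|].
  apply (is_Cseries_unique (square_qpow (z / 4))); [|apply is_Cseries_square_qpow, Hz4].
  apply is_Cseries_even_odd with (fun n => Cmod (square_qpow (z / 4) n)).
  - intros n. apply Rle_refl.
  - apply ex_series_le_R with (2 := ex_series_gaussian (2 * PI * Im (z / 4)) 0 ltac:(nra)).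
    intros n. rewrite Cmod_square_qpow. split; [left; apply exp_pos|]. right. f_equal. ring.
  - apply is_Cseries_odd_squares, Hz.
  - apply is_Cseries_ext with (2 := is_Cseries_square_qpow z Hz). intros n. symmetry. apply square_qpow_div_4.
Qed.

Lemma theta_div_4 (z : C) : theta (z / 4) = (theta z + theta_odd z)%C.
Proof. unfold theta_odd. ring. Qed.

Lemma theta_plus_1 (z : C) : theta (z + 1) = theta z.
Proof.
  assert (Hterm : forall n : nat, qpow (z + 1) (Z.of_nat (S n) * Z.of_nat (S n)) =
    qpow z (Z.of_nat (S n) * Z.of_nat (S n)))
    by (intros n; apply qpow_plus_1).
  unfold theta. rewrite (Series_ext _ _ (fun n => f_equal Re (Hterm n))),
    (Series_ext _ _ (fun n => f_equal Im (Hterm n))).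
  reflexivity.
Qed.

Lemma theta_odd_plus_1 (z : C) : 0 < Im z -> theta_odd (z + 1) = (Ci * theta_odd z)%C.
Proof.
  intros Hz. assert (Hz1 : 0 < Im (z + 1)) by (rewrite Im_plus_R; exact Hz).
  assert (Hhalf : half_theta (z + 1) (z + 1) = half_theta z z).
  { rewrite half_theta_plus_1. unfold half_theta, exp_series, Cseries, square_qpow.
    f_equal; apply Series_ext; intros n; rewrite qpow_plus_1; reflexivity. }
  rewrite !theta_odd_half_theta, Hhalf, <- e2pi_quarter by assumption.
  replace ((z + 1) / 4)%C with (RtoC (/ 4) + z / 4)%C by (rewrite RtoC_inv by lra; field).
  rewrite e2pi_plus. ring.
Qed.

Lemma e2pi_square_half (k : Z) : e2pi (IZR (k * k) / 2) = e2pi (IZR k / 2).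
Proof.
  assert (Hk : exists j, (k * k = k + 2 * j)%Z).
  { destruct (Z.Even_or_Odd k) as [[j ->]|[j ->]]; [exists (j * (2 * j - 1))%Z|exists (j * (2 * j + 1))%Z]; ring. }
  destruct Hk as [j ->]. rewrite plus_IZR, mult_IZR, RtoC_plus, RtoC_mult.
  replace ((IZR k + 2 * IZR j) / 2)%C with (IZR k / 2 + IZR j)%C by field.
  rewrite e2pi_plus, e2pi_IZR. apply Cmult_1_r.
Qed.

Lemma jtheta_half (s : C) : 0 < Im s -> jtheta s (/ 2) = theta (s + / 2).
Proof.
  intros Hs. assert (Hs2 : 0 < Im (s + / 2)) by (rewrite <- RtoC_inv by lra; rewrite Im_plus_R; exact Hs).
  rewrite theta_half_theta by exact Hs2. unfold jtheta. rewrite <- (half_theta_plus_1 s (- / 2)).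
  replace (- / 2 + 1)%C with (/ 2)%C by field.
  replace (half_theta (s + / 2) 0) with (half_theta s (/ 2)); [ring|].
  apply (is_Cseries_unique (square_qpow (s + / 2))); [|apply is_Cseries_square_qpow, Hs2].
  apply is_Cseries_ext with (2 := is_Cseries_half_theta s (/ 2) Hs).
  intros n. unfold square_qpow. rewrite qpow_shift, (qpow_e2pi (/ 2)), (qpow_e2pi (/ 2)).
  f_equal. symmetry. apply e2pi_square_half.
Qed.

Definition theta_multiplier (z : C) : C := jtheta_factor (- / z).

Lemma theta_neg_inv (z : C) : 0 < Im z -> theta (- / z) = (theta_multiplier z * (theta z + theta_odd z))%C.
Proof.
  intros Hz. assert (Hz0 := Im_neq_0 z Hz). rewrite theta_inversion, <- theta_div_4 by apply Im_neg_inv_pos, Hz.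
  do 2 f_equal. field. exact Hz0.
Qed.

Lemma theta_odd_neg_inv (z : C) : 0 < Im z -> theta_odd (- / z) = (theta_multiplier z * (theta z - theta_odd z))%C.
Proof.
  intros Hz. assert (Hz0 := Im_neq_0 z Hz). assert (Hw := Im_neg_inv_pos z Hz). set (w := (- / z)%C) in *.
  assert (Hz4 : 0 < Im (z / 4)) by (rewrite Im_div_4; lra).
  assert (Hz1 : 0 < Im (z + 1)) by (rewrite Im_plus_R; exact Hz).
  assert (Hsub : (theta z - theta_odd z)%C = jtheta (z / 4) (/ 2)).
  { rewrite jtheta_half by exact Hz4. replace (z / 4 + / 2)%C with ((z + 1 + 1) / 4)%C by field.
    rewrite theta_div_4, !theta_plus_1, !theta_odd_plus_1, Cmult_assoc, Ci_sqr by assumption. ring. }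
  assert (Hinv := jtheta_inversion w (/ 2) Hw). fold (theta_multiplier z) in Hinv.
  replace (- / (4 * w))%C with (z / 4)%C in Hinv by (unfold w; field; exact Hz0).
  rewrite Hsub, theta_odd_half_theta by exact Hw. unfold theta_multiplier. fold w. rewrite <- Hinv.
  unfold gauss_jtheta, jtheta. rewrite (half_theta_quasi_periodic w (- (2 * w * / 2)) Hw).
  replace (w * (/ 2 * / 2))%C with (w / 4)%C by field.
  replace (2 * w * / 2)%C with w by field. replace (- w + 2 * w)%C with w by ring.
  replace (w + - w)%C with (RtoC 0) by ring. rewrite e2pi_0. ring.
Qed.

(** * Reduction theory and the discriminant of the theta pair *)

Lemma translation_invariant_IZR (P : C -> Prop) (z : C) (k : Z) :
  (forall z, 0 < Im z -> (P (z + 1)%C <-> P z)) -> 0 < Im z -> (P (z + IZR k)%C <-> P z).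
Proof.
  intros HP Hz. induction k as [|k IH|k IH] using Z.peano_ind.
  - rewrite Cplus_0_r. tauto.
  - rewrite <- IH, <- (HP (z + IZR k)%C) by (rewrite Im_plus_R; exact Hz).
    rewrite succ_IZR, RtoC_plus, Cplus_assoc. tauto.
  - rewrite <- IH, <- (HP (z + IZR (Z.pred k))%C) by (rewrite Im_plus_R; exact Hz).
    replace (IZR k) with (IZR (Z.pred k) + 1) by (rewrite <- succ_IZR; f_equal; lia).
    rewrite RtoC_plus, Cplus_assoc. tauto.
Qed.

Lemma Im_neg_inv_ge (z : C) : 0 < Im z <= 3 / 4 -> - / 2 <= Re z <= / 2 -> 16 / 13 * Im z <= Im (- / z).
Proof.
  intros Him Hre. rewrite Im_neg_inv, Cmod2_alt.
  assert (Hnorm : 0 < Re z ^ 2 + Im z ^ 2 <= 13 / 16) by nra.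
  apply Rmult_le_reg_r with (Re z ^ 2 + Im z ^ 2); [lra|]. unfold Rdiv at 2.
  rewrite Rmult_assoc, (Rmult_assoc (Im z)), Rinv_l by lra. nra.
Qed.

Lemma upper_half_ind (P : C -> Prop) :
  (forall z, 0 < Im z -> (P (z + 1)%C <-> P z)) ->
  (forall z, 0 < Im z -> P (- / z)%C -> P z) ->
  (forall z, 3 / 4 <= Im z -> P z) ->
  forall z, 0 < Im z -> P z.
Proof.
  intros Htranslate Hinvert Hhigh.
  assert (Hlevel : forall n z, 3 / 4 * (13 / 16) ^ n <= Im z -> P z).
  { induction n as [|n IH]; intros z Hz; [apply Hhigh; simpl in Hz; lra|].
    assert (Hpow : 0 < (13 / 16) ^ n) by (apply pow_lt; lra). simpl in Hz.
    destruct (Rle_lt_dec (3 / 4) (Im z)) as [Hbig|Hsmall]; [apply Hhigh, Hbig|].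
    set (k := (- up (Re z - / 2))%Z).
    rewrite <- (translation_invariant_IZR P z k) by (assumption || nra).
    assert (Him : Im (z + IZR k) = Im z) by apply Im_plus_R.
    assert (Hre : - / 2 <= Re (z + IZR k) <= / 2).
    { unfold k. rewrite opp_IZR, re_plus, re_RtoC. assert (Hup := archimed (Re z - / 2)). lra. }
    apply Hinvert; [rewrite Him; nra|]. apply IH.
    eapply Rle_trans; [|apply Im_neg_inv_ge; [rewrite Him; nra|exact Hre]]. rewrite Him. lra. }
  intros z Hz.
  destruct (pow_lt_1_zero (13 / 16) ltac:(rewrite Rabs_pos_eq; lra) (Im z) Hz) as [n Hn].
  specialize (Hn n (le_n n)). assert (Hpow : 0 < (13 / 16) ^ n) by (apply pow_lt; lra).
  rewrite Rabs_pos_eq in Hn by lra. apply (Hlevel n). lra.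
Qed.

Lemma exp_neg_9_8_le : exp (- (9 / 8)) <= 2 / 5.
Proof.
  replace (2 / 5) with (/ (5 / 2)) by field. rewrite exp_Ropp. apply Rinv_le_contravar; [lra|].
  replace (9 / 8) with (INR 4 * (9 / 32)) by (simpl; field). rewrite exp_INR_mult.
  apply Rle_trans with ((41 / 32) ^ 4); [lra|]. apply pow_incr. assert (Hexp := exp_ineq1_le (9 / 32)). lra.
Qed.

Lemma exp_neg_9_2_le : exp (- (9 / 2)) <= / 38.
Proof.
  replace (- (9 / 2)) with (INR 4 * - (9 / 8)) by (simpl; field). rewrite exp_INR_mult.
  apply Rle_trans with ((2 / 5) ^ 4); [|lra]. apply pow_incr. split; [left; apply exp_pos|apply exp_neg_9_8_le].
Qed.

Lemma Cmod_half_theta_le (s z : C) : 3 / 4 <= Im s -> 0 <= Im z -> Cmod (half_theta s z) <= / 37.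
Proof.
  intros Hs Hz. assert (HPI := PI2_3_2). set (a := 2 * PI * Im s). assert (Ha : 9 / 2 <= a) by (unfold a; nra).
  assert (Hexp : exp (- a) <= / 38) by (eapply Rle_trans; [apply exp_le|apply exp_neg_9_2_le]; lra).

  eapply Rle_trans; [apply (Cmod_Cseries_le _ _ (fun n => exp (- a) * exp (- (a * INR n)))
    (is_Cseries_half_theta s z ltac:(lra)))|].
  - intros n. rewrite Cmod_mult, Cmod_square_qpow, Cmod_qpow, plus_IZR, <- INR_IZR_INZ, <- !exp_plus.
    apply exp_le. fold a. assert (Hn := pos_INR n). assert (0 <= PI * (1 + INR n) * Im z) by (apply Rmult_le_pos; nra).
    nra.
  - apply ex_series_exp_geom. lra.
  - rewrite (is_series_unique _ _ (is_series_exp_geom (exp (- a)) a ltac:(lra))).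
    apply Rmult_le_reg_r with (1 - exp (- a)); [lra|]. unfold Rdiv. rewrite Rmult_assoc, Rinv_l by lra. lra.
Qed.

Lemma Cmod_theta_bounds (z : C) : 3 / 4 <= Im z -> 35 / 37 <= Cmod (theta z) <= 39 / 37.
Proof.
  intros Hz. rewrite theta_half_theta by lra. assert (Hhalf := Cmod_half_theta_le z 0 Hz ltac:(simpl; lra)).
  assert (Hdouble : Cmod (2 * half_theta z 0) = 2 * Cmod (half_theta z 0)) by (rewrite Cmod_mult, Cmod_R, Rabs_pos_eq; lra).
  assert (Hupper := Cmod_triangle 1 (2 * half_theta z 0)).
  assert (Hlower := Cmod_triangle_rev 1 (- (2 * half_theta z 0))).
  replace (1 - - (2 * half_theta z 0))%C with (1 + 2 * half_theta z 0)%C in Hlower by ring.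
  rewrite Cmod_opp in Hlower. rewrite Cmod_1 in *. lra.
Qed.

Lemma Cmod_theta_odd_bounds (z : C) : 3 / 4 <= Im z -> exists r, r = exp (- (PI / 2 * Im z)) /\ r <= 2 / 5 /\
  72 / 37 * r <= Cmod (theta_odd z) <= 76 / 37 * r.
Proof.
  intros Hz. exists (exp (- (PI / 2 * Im z))). split; [reflexivity|].
  assert (HPI := PI2_3_2). set (r := exp (- (PI / 2 * Im z))). assert (Hr : 0 < r) by apply exp_pos.
  split; [eapply Rle_trans; [apply exp_le|apply exp_neg_9_8_le]; nra|].
  assert (Hhalf := Cmod_half_theta_le z z Hz ltac:(lra)).
  rewrite theta_odd_half_theta, !Cmod_mult, Cmod_R, Rabs_pos_eq, Cmod_e2pi, Im_div_4 by lra.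
  replace (exp (- (2 * PI * (Im z / 4)))) with r by (unfold r; f_equal; field).
  assert (Hupper := Cmod_triangle 1 (half_theta z z)).
  assert (Hlower := Cmod_triangle_rev 1 (- half_theta z z)).
  replace (1 - - half_theta z z)%C with (1 + half_theta z z)%C in Hlower by ring.
  rewrite Cmod_opp in Hlower. rewrite Cmod_1 in *. nra.
Qed.

Definition theta_disc (z : C) : C := (theta z * theta_odd z * (theta z ^ 4 - theta_odd z ^ 4))%C.

Lemma theta_disc_bounds (z : C) : 3 / 4 <= Im z ->
  / 2 * exp (- (PI / 2 * Im z)) <= Cmod (theta_disc z) <= 5 * exp (- (PI / 2 * Im z)).
Proof.
  intros Hz. destruct (Cmod_theta_bounds z Hz) as [Hx1 Hx2].
  destruct (Cmod_theta_odd_bounds z Hz) as [r [<- [Hr [Hy1 Hy2]]]].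
  unfold theta_disc. rewrite !Cmod_mult.
  assert (Hlower := Cmod_triangle_rev (theta z ^ 4) (theta_odd z ^ 4)).
  assert (Hupper := Cmod_triangle_minus (theta z ^ 4) (theta_odd z ^ 4)).
  rewrite !Cmod_pow in Hlower, Hupper.
  set (x := Cmod (theta z)) in *. set (y := Cmod (theta_odd z)) in *.
  set (w := Cmod (theta z ^ 4 - theta_odd z ^ 4)) in *.
  assert (Hy0 : 0 <= y) by apply Cmod_ge_0.
  assert (Hx4 : (35 / 37) ^ 4 <= x ^ 4 <= (39 / 37) ^ 4) by (split; apply pow_incr; lra).
  assert (Hy4 : 0 <= y ^ 4 <= (83 / 100) ^ 4) by (split; [apply pow_le, Hy0|apply pow_incr; lra]).
  assert (Hxy1 : 35 / 37 * (72 / 37 * r) <= x * y) by (apply Rmult_le_compat; lra).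
  assert (Hxy2 : x * y <= 39 / 37 * (76 / 37 * r)) by (apply Rmult_le_compat; lra).
  split.
  - apply Rle_trans with (35 / 37 * (72 / 37 * r) * (3 / 10)); [lra|]. apply Rmult_le_compat; lra.
  - apply Rle_trans with (39 / 37 * (76 / 37 * r) * 2); [|lra]. apply Rmult_le_compat; lra.
Qed.

Lemma theta_disc_plus_1 (z : C) : 0 < Im z -> theta_disc (z + 1) = (Ci * theta_disc z)%C.
Proof.
  intros Hz. unfold theta_disc. rewrite theta_plus_1, theta_odd_plus_1, Cpow_mult_l by exact Hz.
  replace (Ci ^ 4)%C with (Ci * Ci * (Ci * Ci))%C by ring. rewrite Ci_sqr. ring.
Qed.

(* [theta_disc] is the degree six invariant [x y (x^4 - y^4)] of the octahedral group. *)
Lemma theta_disc_neg_inv (z : C) : 0 < Im z ->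
  theta_disc (- / z) = (8 * theta_multiplier z ^ 6 * theta_disc z)%C.
Proof. intros Hz. unfold theta_disc. rewrite theta_neg_inv, theta_odd_neg_inv by exact Hz. ring. Qed.

Lemma theta_disc_neq_0 (z : C) : 0 < Im z -> theta_disc z <> RtoC 0.
Proof.
  revert z. apply upper_half_ind.
  - intros z Hz. rewrite theta_disc_plus_1 by exact Hz. split; intros Hdisc.
    + intros Hzero. apply Hdisc. rewrite Hzero. ring.
    + apply Cmult_neq_0; [apply Ci_nz|exact Hdisc].
  - intros z Hz Hdisc Hzero. apply Hdisc. rewrite theta_disc_neg_inv, Hzero by exact Hz. ring.
  - intros z Hz Hzero. assert (Hbound := proj1 (theta_disc_bounds z Hz)). rewrite Hzero, Cmod_0 in Hbound.
    assert (Hexp := exp_pos (- (PI / 2 * Im z))). lra.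
Qed.

Lemma theta_neq_0 (z : C) : 0 < Im z -> theta z <> RtoC 0.
Proof. intros Hz Hzero. apply (theta_disc_neq_0 z Hz). unfold theta_disc. rewrite Hzero. ring. Qed.

Lemma holomorphic_above_theta : holomorphic_above 0 theta.
Proof. intros z Hz. eexists. apply is_Cderive_theta, Hz. Qed.

Lemma is_Cderive_theta_neg_inv (s : C) : 0 < Im s ->
  is_Cderive (fun w => theta (- / (4 * w))%C) s
    (theta (- / (4 * s)) * (theta s + 2 * s * C_derive theta s) / (2 * s * theta s))%C.
Proof.
  intros Hs. assert (Hs0 := Im_neq_0 s Hs). assert (H4s : 0 < Im (4 * s)) by (rewrite im_scal_l; lra).
  assert (HS := Im_neg_inv_pos _ H4s). assert (Htheta := theta_neq_0 s Hs). assert (HthetaS := theta_neq_0 _ HS).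
  eapply is_Cderive_eq.
  2: { apply (is_Cderive_comp theta (fun w => - / (4 * w))%C).
       - apply (is_Cderive_dilate (fun w => - / w)%C), is_Cderive_neg_inv, Im_neq_0, H4s.
       - apply is_Cderive_C_derive, holomorphic_above_theta, HS. }
  assert (Hinv := theta_inversion s Hs). assert (Hderive := C_derive_theta_inversion s Hs).
  set (S := (- / (4 * s))%C) in *.
  replace (jtheta_factor s) with (theta s / theta S)%C in Hderive by (rewrite Hinv; field; exact HthetaS).
  apply Cmult_eq_reg_l with (theta s / theta S * (4 * s * s))%C.
  - unfold Cdiv. repeat apply Cmult_neq_0; try assumption; [apply Cinv_neq_0, HthetaS|apply RtoC_neq_0; lra].
  - transitivity (theta s / theta S * C_derive theta S)%C; [field; auto|]. rewrite Hderive. field. auto.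
Qed.

Lemma jtheta_factor_sqr (s : C) : 0 < Im s -> (jtheta_factor s * jtheta_factor s * s)%C = (Ci / 2)%C.
Proof.
  set (ratio := fun w => (theta w * theta w * w * / (theta (- / (4 * w)) * theta (- / (4 * w))))%C).
  assert (Hratio : forall w, 0 < Im w -> (jtheta_factor w * jtheta_factor w * w)%C = ratio w).
  { intros w Hw. assert (H4w : 0 < Im (4 * w)) by (rewrite im_scal_l; lra).
    unfold ratio. rewrite (theta_inversion w Hw). field. apply theta_neq_0, Im_neg_inv_pos, H4w. }
  assert (Hconst : forall w, 0 < Im w -> is_Cderive ratio w (RtoC 0)).
  { intros w Hw. assert (Hw0 := Im_neq_0 w Hw). assert (H4w : 0 < Im (4 * w)) by (rewrite im_scal_l; lra).
    assert (HthetaW := theta_neq_0 _ (Im_neg_inv_pos _ H4w)).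
    assert (Htheta := is_Cderive_C_derive theta w (holomorphic_above_theta w Hw)).
    assert (Hinv := is_Cderive_theta_neg_inv w Hw). eapply is_Cderive_eq.
    2: { apply is_Cderive_mult; [apply is_Cderive_mult; [apply is_Cderive_mult; exact Htheta|apply is_Cderive_id]|].
         apply is_Cderive_inv; [apply Cmult_neq_0; exact HthetaW|apply is_Cderive_mult; exact Hinv]. }
    cbv beta. field. repeat split; try assumption. apply theta_neq_0, Hw. }
  intros Hs. set (i2 := (Ci / 2)%C). assert (Hi2 : 0 < Im i2) by (unfold i2; simpl; lra).
  assert (Hfix : (- / (4 * i2))%C = i2).
  { unfold i2. apply Cmult_eq_reg_l with (2 * Ci)%C.
    - apply Cmult_neq_0; [apply RtoC_neq_0; lra|apply Ci_nz].
    - transitivity (RtoC (-1)); [field; apply Ci_nz|]. rewrite <- Ci_sqr. field. }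
  rewrite Hratio, (derivative_zero_constant 0 ratio Hconst s i2) by assumption.
  unfold ratio. rewrite Hfix. field. apply theta_neq_0, Hi2.
Qed.

Lemma Cmod_theta_multiplier_sqr (z : C) : 0 < Im z -> 2 * Cmod (theta_multiplier z) ^ 2 = Cmod z.
Proof.
  intros Hz. assert (Hz0 := Im_neq_0 z Hz). assert (Hmod := f_equal Cmod (jtheta_factor_sqr _ (Im_neg_inv_pos z Hz))).
  fold (theta_multiplier z) in Hmod.
  rewrite Cmod_div, !Cmod_mult, Cmod_opp, Cmod_inv, Cmod_Ci, Cmod_R, Rabs_pos_eq in Hmod
    by (exact Hz0 || lra || (apply RtoC_neq_0; lra)).
  assert (Hpos := proj1 (Cmod_gt_0 z) Hz0).
  transitivity (2 * (Cmod (theta_multiplier z) * Cmod (theta_multiplier z) * / Cmod z) * Cmod z); [field; lra|].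
  rewrite Hmod. field.
Qed.

Lemma Cmod_theta_disc_neg_inv (z : C) : 0 < Im z -> Cmod (theta_disc (- / z)) = Cmod z ^ 3 * Cmod (theta_disc z).
Proof.
  intros Hz. rewrite theta_disc_neg_inv, !Cmod_mult, Cmod_R, Rabs_pos_eq, Cmod_pow, <- (Cmod_theta_multiplier_sqr z)
    by (assumption || lra).
  ring.
Qed.

(** * Vanishing of level one functions of weight zero *)

Lemma Cmod_fcoef_bounded_le (f : C -> C) (B : R) (n : Z) :
  holomorphic_above 0 f -> periodic_above 0 f -> (forall z, 0 < Im z -> Cmod (f z) <= B) ->
  (0 < n)%Z -> Cmod (fcoef f n) <= 3 * B.
Proof.
  intros Hf Hper HB Hn. apply IZR_lt in Hn. assert (HPI := PI_RGT_0).
  set (y := / (2 * PI * IZR n)). assert (Hy : 0 < y) by (apply Rinv_0_lt_compat; nra).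
  assert (HB0 : 0 <= B) by (apply Rle_trans with (Cmod (f (0, y))); [apply Cmod_ge_0|apply HB, Hy]).
  eapply Rle_trans; [apply (Cmod_fcoef_le 0 f Hf Hper n y B Rlt_0_1 Hy); intros x _; apply HB, Hy|].
  replace (2 * PI * IZR n * y) with 1 by (unfold y; field; lra).
  assert (He := exp_le_3). nra.
Qed.

Lemma Cmod_cuspidal_le_half (f : C -> C) (B : R) (z : C) :
  holomorphic_above 0 f -> periodic_above 0 f -> (forall z, 0 < Im z -> Cmod (f z) <= B) ->
  (forall n, (n < 1)%Z -> fcoef f n = RtoC 0) -> 3 / 4 <= Im z -> Cmod (f z) <= B / 2.
Proof.
  intros Hf Hper HB Hcusp Hz. assert (HPI := PI2_3_2).
  assert (HB0 : 0 <= B) by (apply Rle_trans with (Cmod (f z)); [apply Cmod_ge_0|apply HB; lra]).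
  set (a := 2 * PI * Im z). assert (Ha : 9 / 2 <= a) by (unfold a; nra).
  assert (Hexp : exp (- a) <= / 38) by (eapply Rle_trans; [apply exp_le|apply exp_neg_9_2_le]; lra).

  eapply Rle_trans; [apply (Cmod_Cseries_le _ _ (fun k => 3 * B * exp (- a) * exp (- (a * INR k)))
    (is_Cseries_qexp 0 f 1 z Rlt_0_1 Hf Hper Hcusp ltac:(lra)))|].
  - intros k. rewrite Cmod_mult, Cmod_qpow, plus_IZR, <- INR_IZR_INZ, (Rmult_assoc (3 * B)), <- exp_plus.
    replace (- (2 * PI * (1 + INR k) * Im z)) with (- a + - (a * INR k)) by (unfold a; ring).
    apply Rmult_le_compat_r; [left; apply exp_pos|]. apply Cmod_fcoef_bounded_le; [assumption..|lia].
  - apply ex_series_exp_geom. lra.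
  - rewrite (is_series_unique _ _ (is_series_exp_geom (3 * B * exp (- a)) a ltac:(lra))).
    apply Rmult_le_reg_r with (1 - exp (- a)); [lra|]. unfold Rdiv. rewrite Rmult_assoc, Rinv_l by lra. nra.
Qed.

(* The supremum of [|phi|] is attained up to invariance on [3/4 <= Im z], where [|phi|] is at most half of it. *)
Lemma weight_zero_vanishing (phi : C -> C) (K : R) : holomorphic_above 0 phi -> periodic_above 0 phi ->
  (forall z, 0 < Im z -> Cmod (phi (- / z)%C) = Cmod (phi z)) ->
  (forall z, 3 / 4 <= Im z -> Cmod (phi z) <= K * exp (- (2 * PI * Im z))) ->
  forall z, 0 < Im z -> phi z = RtoC 0.
Proof.
  intros Hphi Hper Hinv HK. assert (HPI := PI_RGT_0).
  assert (Hextend : forall B, (forall z, 3 / 4 <= Im z -> Cmod (phi z) <= B) ->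
    forall z, 0 < Im z -> Cmod (phi z) <= B).
  { intros B HB. apply upper_half_ind; [intros z Hz; rewrite Hper by exact Hz; tauto| |exact HB].
    intros z Hz. rewrite Hinv by exact Hz. auto. }
  assert (Hcusp : forall n, (n < 1)%Z -> fcoef phi n = RtoC 0).
  { intros n Hn. assert (Hn0 : IZR n <= 0) by (apply IZR_le; lia).
    apply (fcoef_eq_0_of_growth 0 phi n K (- (2 * PI)) Rlt_0_1 Hphi Hper); [|nra].
    intros z Hz. replace (- (2 * PI) * Im z) with (- (2 * PI * Im z)) by ring. apply HK. lra. }
  assert (Hbound : bound (fun r => exists z, 0 < Im z /\ r = Cmod (phi z))).
  { exists (Rabs K). intros r [z [Hz ->]]. revert z Hz. apply Hextend. intros z Hz.
    apply Rle_trans with (Rabs K * exp (- (2 * PI * Im z))).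
    - eapply Rle_trans; [apply HK, Hz|]. apply Rmult_le_compat_r; [left; apply exp_pos|apply Rle_abs].
    - rewrite <- (Rmult_1_r (Rabs K)) at 2. apply Rmult_le_compat_l; [apply Rabs_pos|].
      rewrite <- exp_0. apply exp_le. nra. }
  destruct (completeness _ Hbound) as [B [HB Hleast]]; [exists (Cmod (phi Ci)), Ci; simpl; split; [lra|reflexivity]|].
  assert (Hsup : forall z, 0 < Im z -> Cmod (phi z) <= B) by (intros z Hz; apply HB; exists z; auto).
  assert (Hhalf : B <= B / 2).
  { apply Hleast. intros r [z [Hz ->]]. revert z Hz. apply Hextend. intros z Hz. apply Cmod_cuspidal_le_half; auto. }
  intros z Hz. apply Cmod_eq_0. assert (Hge0 := Cmod_ge_0 (phi z)). specialize (Hsup z Hz). lra.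
Qed.

(** * Integer powers *)

Lemma Czpow_1 (n : Z) : Czpow 1 n = RtoC 1.
Proof. destruct n; simpl; rewrite ?Cpow_1_l; [reflexivity|reflexivity|field]. Qed.

Lemma Czpow_mult (a b : C) (n : Z) : a <> RtoC 0 -> b <> RtoC 0 ->
  Czpow (a * b) n = (Czpow a n * Czpow b n)%C.
Proof.
  intros Ha Hb. destruct n; simpl; rewrite ?Cpow_mult_l; [ring|reflexivity|].
  field. split; apply Cpow_nz; assumption.
Qed.

Lemma Czpow_neq_0 (a : C) (n : Z) : a <> RtoC 0 -> Czpow a n <> RtoC 0.
Proof.
  intros Ha. destruct n; simpl; [apply C1_nz|apply Cpow_nz, Ha|apply Cinv_neq_0, Cpow_nz, Ha].
Qed.

Lemma Cmod_Czpow (a : C) (n : Z) : a <> RtoC 0 -> Cmod (Czpow a n) = powerRZ (Cmod a) n.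
Proof.
  intros Ha. destruct n; simpl; [apply Cmod_1|apply Cmod_pow|].
  rewrite Cmod_inv, Cmod_pow by apply Cpow_nz, Ha. reflexivity.
Qed.

Lemma Czpow_e2pi (w : C) (n : Z) : Czpow (e2pi w) n = e2pi (IZR n * w).
Proof.
  assert (Hpow : forall k : nat, (e2pi w ^ k)%C = e2pi (INR k * w)).
  { induction k as [|k IH]; [rewrite Cmult_0_l, e2pi_0; reflexivity|].
    rewrite Cpow_S, IH, <- e2pi_plus, S_INR, RtoC_plus. f_equal. ring. }
  destruct n as [|p|p]; simpl; rewrite ?Hpow, ?INR_IPR.
  - rewrite Cmult_0_l, e2pi_0. reflexivity.
  - reflexivity.
  - rewrite <- e2pi_opp. f_equal. unfold IZR. rewrite RtoC_opp. ring.
Qed.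

Lemma ex_Cderive_Cpow (f : C -> C) (z : C) (n : nat) : ex_Cderive f z -> ex_Cderive (fun w => f w ^ n)%C z.
Proof.
  intros [l Hl]. induction n as [|n [k Hk]]; [exists (RtoC 0); apply (is_Cderive_const 1)|].
  eexists. apply (is_Cderive_mult f (fun w => f w ^ n)%C); eassumption.
Qed.

Lemma ex_Cderive_Czpow (f : C -> C) (z : C) (n : Z) : ex_Cderive f z -> f z <> RtoC 0 ->
  ex_Cderive (fun w => Czpow (f w) n) z.
Proof.
  intros Hf Hz. destruct n; simpl; [eexists; apply is_Cderive_const|apply ex_Cderive_Cpow, Hf|].
  destruct (ex_Cderive_Cpow f z (Pos.to_nat p) Hf) as [l Hl]. eexists.
  apply (is_Cderive_inv (fun w => f w ^ Pos.to_nat p)%C); [apply Cpow_nz, Hz|exact Hl].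
Qed.

Lemma powerRZ_exp (x : R) (n : Z) : powerRZ (exp x) n = exp (IZR n * x).
Proof. rewrite powerRZ_Rpower by apply exp_pos. unfold Rpower. rewrite ln_exp. reflexivity. Qed.

Lemma powerRZ_pow (x : R) (n : Z) (k : nat) : powerRZ (x ^ k) n = powerRZ x n ^ k.
Proof. induction k as [|k IH]; [apply powerRZ_R1|]. simpl. rewrite powerRZ_mult, IH. reflexivity. Qed.

Lemma powerRZ_le_scaled (a b r x : R) (n : Z) : 0 < a -> 0 < b -> 0 < r -> a * r <= x <= b * r ->
  powerRZ x n <= (powerRZ a n + powerRZ b n) * powerRZ r n.
Proof.
  intros Ha Hb Hr Hx. assert (Har : 0 < a * r) by nra.
  assert (Hpa := powerRZ_lt (a * r) n Har). assert (Hpb := powerRZ_lt (b * r) n ltac:(nra)).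
  rewrite Rmult_plus_distr_r, <- !powerRZ_mult.
  cut (powerRZ x n <= powerRZ (a * r) n \/ powerRZ x n <= powerRZ (b * r) n); [intros [H|H]; lra|].
  destruct n as [|p|p]; simpl; [left; lra|right; apply pow_incr; lra|left].
  apply Rinv_le_contravar; [apply pow_lt, Har|apply pow_incr; lra].
Qed.

(** * Even and odd parts of plus forms *)

Definition even_part (f : C -> C) (z : C) : C := ((f z + f (z + (/ 2)%R)) / 2)%C.

Definition odd_part (f : C -> C) (z : C) : C := ((f z - f (z + (/ 2)%R)) / 2)%C.

Lemma even_odd_parts (f : C -> C) (z : C) : f z = (even_part f z + odd_part f z)%C.
Proof. unfold even_part, odd_part. field. Qed.

Lemma qpow_half (n : Z) : qpow (/ 2)%R n = if Z.even n then RtoC 1 else RtoC (-1).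
Proof.
  rewrite qpow_e2pi. destruct (Z.even n) eqn:Hn.
  - apply Z.even_spec in Hn. destruct Hn as [k ->]. rewrite <- RtoC_mult, mult_IZR.
    replace (2 * IZR k * / 2) with (IZR k) by field. apply e2pi_IZR.
  - rewrite <- Z.negb_odd, Bool.negb_false_iff in Hn. apply Z.odd_spec in Hn. destruct Hn as [k ->].
    rewrite <- RtoC_mult, plus_IZR, mult_IZR. replace ((2 * IZR k + 1) * / 2) with (IZR k + / 2) by field.
    rewrite RtoC_plus, e2pi_plus, e2pi_IZR, e2pi_half. ring.
Qed.

Section Parts.

Variable f : C -> C.
Hypotheses (Hf : holomorphic_above 0 f) (Hper : periodic_above 0 f).

Let Hf_half : holomorphic_above 0 (fun z => f (z + (/ 2)%R)%C) := holomorphic_above_shift 0 (/ 2) f Hf.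

Lemma holomorphic_above_even_part : holomorphic_above 0 (even_part f).
Proof.
  intros z Hz. apply ex_Cderive_mult; [|apply ex_Cderive_const].
  apply ex_Cderive_plus; [apply Hf, Hz|apply Hf_half, Hz].
Qed.

Lemma holomorphic_above_odd_part : holomorphic_above 0 (odd_part f).
Proof.
  intros z Hz. apply ex_Cderive_mult; [|apply ex_Cderive_const].
  apply ex_Cderive_minus; [apply Hf, Hz|apply Hf_half, Hz].
Qed.

Lemma periodic_above_even_part : periodic_above 0 (even_part f).
Proof.
  intros z Hz. unfold even_part. rewrite Hper, (periodic_above_shift 0 (/ 2) f Hper) by exact Hz. reflexivity.
Qed.

Lemma periodic_above_odd_part : periodic_above 0 (odd_part f).
Proof.
  intros z Hz. unfold odd_part. rewrite Hper, (periodic_above_shift 0 (/ 2) f Hper) by exact Hz. reflexivity.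
Qed.

Lemma fcoef_half_shift (n : Z) :
  fcoef (fun z => f (z + (/ 2)%R)%C) n = (fcoef f n * if Z.even n then RtoC 1 else RtoC (-1))%C.
Proof.
  rewrite <- qpow_half. apply (fcoef_shift 0); try assumption; [lra|]. rewrite im_RtoC. lra.
Qed.

Lemma fcoef_even_part (n : Z) : fcoef (even_part f) n = if Z.even n then fcoef f n else RtoC 0.
Proof.
  transitivity (/ 2 * (fcoef f n + fcoef (fun z => f (z + (/ 2)%R)%C) n))%C.
  - rewrite <- (fcoef_plus 0), <- (fcoef_Cmult 0) by (assumption || lra || apply holomorphic_above_plus; assumption).
    apply fcoef_ext. intros z _. unfold even_part. field.
  - rewrite fcoef_half_shift. destruct (Z.even n); field.
Qed.

Lemma fcoef_odd_part (n : Z) : fcoef (odd_part f) n = if Z.even n then RtoC 0 else fcoef f n.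
Proof.
  transitivity (fcoef f n + -1 * fcoef (even_part f) n)%C.
  - assert (Heven := holomorphic_above_even_part).
    rewrite <- (fcoef_Cmult 0), <- (fcoef_plus 0) by (lra || assumption || apply holomorphic_above_Cmult, Heven).
    apply fcoef_ext. intros z _. unfold odd_part, even_part. field.
  - rewrite fcoef_even_part. destruct (Z.even n); ring.
Qed.

End Parts.

Definition plus_unit (t : Z) : C := if Z.even t then Ci else (- Ci)%C.

Lemma plus_unit_sqr (t : Z) : (plus_unit t * plus_unit t)%C = RtoC (-1).
Proof. unfold plus_unit. destruct (Z.even t); rewrite <- Ci_sqr; ring. Qed.

Lemma plus_unit_neq_0 (t : Z) : plus_unit t <> RtoC 0.
Proof. intros Hzero. assert (Hsqr := plus_unit_sqr t). rewrite Hzero, Cmult_0_l in Hsqr. apply RtoC_inj in Hsqr. lra. Qed.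

Lemma qpow_quarter (t n : Z) : plus_okb t n = true ->
  qpow (/ 4)%R n = if Z.even n then RtoC 1 else plus_unit t.
Proof.
  intros Hn.
  assert (Hquarter : forall k r : Z, qpow (/ 4)%R (4 * k + r) = qpow (/ 4)%R r).
  { intros k r. rewrite qpow_plus, (qpow_e2pi _ (4 * k)), <- RtoC_mult, mult_IZR.
    replace (4 * IZR k * / 4) with (IZR k) by field. rewrite e2pi_IZR. ring. }
  assert (Hmod : exists k r, n = (4 * k + r)%Z /\ (r = 0 \/ r = if Z.even t then 1 else -1)%Z).
  { unfold plus_okb in Hn. apply Bool.orb_true_iff in Hn. rewrite !Z.eqb_eq in Hn. destruct (Z.even t).
    - exists (n / 4)%Z, (n mod 4)%Z. Z.div_mod_to_equations. lia.
    - exists (- (- n / 4))%Z, (- (- n mod 4))%Z. Z.div_mod_to_equations. lia. }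
  destruct Hmod as [k [r [-> Hr]]]. rewrite Hquarter, Z.even_add, Z.even_mul. simpl (Z.even 4).
  unfold plus_unit. destruct Hr as [-> | ->]; [apply qpow_0|].
  assert (Hone : qpow (/ 4)%R 1 = Ci) by (rewrite qpow_e2pi, Cmult_1_l; apply e2pi_quarter).
  destruct (Z.even t); [exact Hone|]. simpl. change (-1)%Z with (- (1))%Z. rewrite qpow_opp, Hone.
  apply Cmult_eq_reg_l with Ci; [apply Ci_nz|]. rewrite Cinv_r by apply Ci_nz.
  replace (Ci * - Ci)%C with (- (Ci * Ci))%C by ring. rewrite Ci_sqr. ring.
Qed.

Definition plus_form (t : Z) (f : C -> C) : Prop :=
  holomorphic_above 0 f /\ transforms_like_theta t f /\ plus_space t f.

Lemma in_Mshriek_plus_form (t : Z) (f : C -> C) : in_Mshriek t f -> plus_form t f.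
Proof. intros [Hholo [Htrans [_ Hplus]]]. split; [exact Hholo|split; assumption]. Qed.

Lemma transforms_periodic (t : Z) (f : C -> C) : transforms_like_theta t f -> periodic_above 0 f.
Proof.
  intros Hf z Hz. assert (Hmobius : mobius 1 1 0 1 z = (z + 1)%C)
    by (unfold mobius; rewrite Cmult_0_l, Cplus_0_l; field).
  assert (Hlaw := Hf 1%Z 1%Z 0%Z 1%Z ltac:(split; [reflexivity|exists 0%Z; reflexivity]) z Hz).
  rewrite Hmobius, theta_plus_1 in Hlaw.
  replace (theta z / theta z)%C with (RtoC 1) in Hlaw by (field; apply theta_neq_0, Hz).
  rewrite Hlaw, Czpow_1. ring.
Qed.

Section QuarterShift.

Variables (t : Z) (f : C -> C).
Hypothesis Hf : plus_form t f.

Let Hholo : holomorphic_above 0 f := proj1 Hf.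
Let Hper : periodic_above 0 f := transforms_periodic t f (proj1 (proj2 Hf)).

Lemma fcoef_plus_form (n : Z) (u : C) :
  (plus_okb t n = true -> qpow (/ 4)%R n = u) -> (fcoef f n * qpow (/ 4)%R n)%C = (fcoef f n * u)%C.
Proof.
  intros Hu. destruct (plus_okb t n) eqn:Hn; [rewrite Hu by reflexivity; reflexivity|].
  rewrite (proj2 (proj2 Hf) n Hn). ring.
Qed.

Lemma even_part_quarter (z : C) : 0 < Im z -> even_part f (z + (/ 4)%R) = even_part f z.
Proof.
  revert z. assert (Heven := holomorphic_above_even_part f Hholo).
  assert (Hevenper := periodic_above_even_part f Hper).
  apply (fcoef_injective 0 (fun z => even_part f (z + (/ 4)%R)%C)); try assumption; try lra.
  - apply holomorphic_above_shift, Heven.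
  - apply periodic_above_shift, Hevenper.
  - intros n. rewrite (fcoef_shift 0) by (try assumption; rewrite ?im_RtoC; lra).
    rewrite fcoef_even_part by assumption. destruct (Z.even n) eqn:Hn; [|ring].
    rewrite (fcoef_plus_form n 1); [ring|]. intros Hok. rewrite (qpow_quarter t n Hok), Hn. reflexivity.
Qed.

Lemma odd_part_quarter (z : C) : 0 < Im z -> odd_part f (z + (/ 4)%R) = (plus_unit t * odd_part f z)%C.
Proof.
  revert z. assert (Hodd := holomorphic_above_odd_part f Hholo). assert (Hoddper := periodic_above_odd_part f Hper).
  apply (fcoef_injective 0 (fun z => odd_part f (z + (/ 4)%R)%C) (fun z => plus_unit t * odd_part f z)%C);
    try assumption; try lra.
  - apply holomorphic_above_shift, Hodd.
  - apply periodic_above_shift, Hoddper.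
  - apply holomorphic_above_Cmult, Hodd.
  - intros z Hz. rewrite Hoddper by exact Hz. reflexivity.
  - intros n. rewrite (fcoef_shift 0), (fcoef_Cmult 0) by (try assumption; rewrite ?im_RtoC; lra).
    rewrite fcoef_odd_part by assumption. destruct (Z.even n) eqn:Hn; [ring|].
    rewrite (fcoef_plus_form n (plus_unit t)); [ring|]. intros Hok. rewrite (qpow_quarter t n Hok), Hn. reflexivity.
Qed.

End QuarterShift.

(** * Transformation under inversion *)

Lemma theta_quarter_succ (z : C) : 0 < Im z -> theta ((z + 1) / 4) = (theta z + Ci * theta_odd z)%C.
Proof. intros Hz. rewrite theta_div_4, theta_plus_1, theta_odd_plus_1 by exact Hz. reflexivity. Qed.

Lemma theta_quarter_pred (z : C) : 0 < Im z -> theta ((z - 1) / 4) = (theta z - Ci * theta_odd z)%C.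
Proof.
  intros Hz. set (w := (z - 1)%C). assert (Hw : 0 < Im w) by (unfold w; destruct z; simpl in *; lra).
  replace z with (w + 1)%C by (unfold w; ring). rewrite theta_div_4, theta_plus_1, theta_odd_plus_1 by exact Hw.
  transitivity (theta w - (Ci * Ci) * theta_odd w)%C; [rewrite Ci_sqr; ring|ring].
Qed.

Definition theta_cocycle (z : C) : C := (theta_multiplier z * (1 + Ci))%C.

Lemma theta_quarter_neg_inv_succ (z : C) : 0 < Im z ->
  theta ((- / z + 1) / 4) = (theta_cocycle z * theta ((z - 1) / 4))%C.
Proof.
  intros Hz. rewrite theta_quarter_succ, theta_quarter_pred, theta_neg_inv, theta_odd_neg_inv
    by (assumption || apply Im_neg_inv_pos, Hz).
  unfold theta_cocycle.
  transitivity (theta_multiplier z * ((1 + Ci) * theta z - (Ci + Ci * Ci) * theta_odd z))%C;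
    [rewrite Ci_sqr; ring|ring].
Qed.

Lemma theta_quarter_neg_inv_pred (z : C) : 0 < Im z ->
  theta ((- / z - 1) / 4) = (- Ci * theta_cocycle z * theta ((z + 1) / 4))%C.
Proof.
  intros Hz. rewrite theta_quarter_succ, theta_quarter_pred, theta_neg_inv, theta_odd_neg_inv
    by (assumption || apply Im_neg_inv_pos, Hz).
  unfold theta_cocycle.
  transitivity (theta_multiplier z * (- (Ci + Ci * Ci) * theta z - (Ci * Ci + Ci * Ci * Ci) * theta_odd z))%C;
    [rewrite Ci_sqr; ring|ring].
Qed.

Lemma Cmod_theta_cocycle_sqr (z : C) : 0 < Im z -> Cmod (theta_cocycle z) ^ 2 = Cmod z.
Proof.
  intros Hz. unfold theta_cocycle.
  rewrite Cmod_mult, Rpow_mult_distr, (Cmod2_alt (1 + Ci)), <- (Cmod_theta_multiplier_sqr z Hz).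
  simpl. ring.
Qed.

Lemma theta_cocycle_neq_0 (z : C) : 0 < Im z -> theta_cocycle z <> RtoC 0.
Proof.
  intros Hz Hzero. assert (Hsqr := Cmod_theta_cocycle_sqr z Hz). rewrite Hzero, Cmod_0 in Hsqr.
  assert (Hpos := proj1 (Cmod_gt_0 z) (Im_neq_0 z Hz)). lra.
Qed.

Definition weight_cocycle (t : Z) (z : C) : C := Czpow (theta_cocycle z) (2 * t + 1).

Lemma weight_cocycle_neq_0 (t : Z) (z : C) : 0 < Im z -> weight_cocycle t z <> RtoC 0.
Proof. intros Hz. apply Czpow_neq_0, theta_cocycle_neq_0, Hz. Qed.

Lemma Cmod_weight_cocycle_sqr (t : Z) (z : C) : 0 < Im z ->
  Cmod (weight_cocycle t z) ^ 2 = powerRZ (Cmod z) (2 * t + 1).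
Proof.
  intros Hz. unfold weight_cocycle.
  rewrite Cmod_Czpow, <- (Cmod_theta_cocycle_sqr z Hz) by apply theta_cocycle_neq_0, Hz.
  simpl. rewrite !Rmult_1_r, powerRZ_mult. reflexivity.
Qed.

Lemma ex_Cderive_div_4 (f : C -> C) (z : C) : holomorphic_above 0 f -> 0 < Im z -> ex_Cderive (fun w => f (w / 4)%C) z.
Proof.
  intros Hf Hz. apply (ex_Cderive_comp f (fun w => w / 4)%C).
  - apply ex_Cderive_mult; [apply ex_Cderive_id|apply ex_Cderive_const].
  - apply Hf. rewrite Im_div_4. lra.
Qed.

Lemma ex_Cderive_neg_inv (f : C -> C) (z : C) : holomorphic_above 0 f -> 0 < Im z ->
  ex_Cderive (fun w => f (- / w)%C) z.
Proof.
  intros Hf Hz. apply (ex_Cderive_comp f (fun w => - / w)%C); [|apply Hf, Im_neg_inv_pos, Hz].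
  eexists. apply is_Cderive_neg_inv, Im_neq_0, Hz.
Qed.

Lemma holomorphic_above_weight_cocycle (t : Z) : holomorphic_above 0 (weight_cocycle t).
Proof.
  intros z Hz. apply (ex_Cderive_Czpow theta_cocycle); [|apply theta_cocycle_neq_0, Hz].
  assert (Hz4 : forall w, 0 < Im w -> theta (w / 4) <> RtoC 0)
    by (intros w Hw; apply theta_neq_0; rewrite Im_div_4; lra).
  apply ex_Cderive_ext_above with 0 (fun w => theta (- / w) * / theta (w / 4) * (1 + Ci))%C; [|exact Hz|].
  - intros w Hw. unfold theta_cocycle. rewrite theta_neg_inv, theta_div_4 by exact Hw.
    field. rewrite <- theta_div_4. apply Hz4, Hw.
  - apply ex_Cderive_mult; [apply ex_Cderive_mult|apply ex_Cderive_const].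
    + apply ex_Cderive_neg_inv; [exact holomorphic_above_theta|exact Hz].
    + apply (ex_Cderive_inv (fun w => theta (w / 4)%C)); [apply Hz4, Hz|].
      apply ex_Cderive_div_4; [exact holomorphic_above_theta|exact Hz].
Qed.

Definition inversion_sign (t : Z) : C := Czpow (- Ci) (2 * t + 1).

Lemma inversion_sign_e2pi (t : Z) : inversion_sign t = e2pi (IZR (2 * t + 1) * - / 4)%R.
Proof.
  unfold inversion_sign. replace (- Ci)%C with (e2pi (- / 4)%R); [rewrite Czpow_e2pi, RtoC_mult; reflexivity|].
  rewrite RtoC_opp, e2pi_opp, e2pi_quarter. apply Cmult_eq_reg_l with Ci; [apply Ci_nz|].
  rewrite Cinv_r by apply Ci_nz. transitivity (- (Ci * Ci))%C; [rewrite Ci_sqr; ring|ring].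
Qed.

Lemma Cmod_inversion_sign (t : Z) : Cmod (inversion_sign t) = 1.
Proof. rewrite inversion_sign_e2pi. apply Cmod_e2pi_R. Qed.

Lemma inversion_sign_neq_1 (t : Z) : inversion_sign t <> RtoC 1.
Proof.
  rewrite inversion_sign_e2pi. intros H. apply e2pi_eq_1 in H. destruct H as [k Hk].
  assert (Hint : IZR (2 * t + 1) = IZR (- 4 * k)) by (rewrite mult_IZR, <- Hk; simpl; field).
  apply eq_IZR in Hint. lia.
Qed.

Lemma transforms_neg_inv_succ (t : Z) (f : C -> C) (z : C) : transforms_like_theta t f -> 0 < Im z ->
  f ((- / z + 1) / 4)%C = (weight_cocycle t z * f ((z - 1) / 4))%C.
Proof.
  intros Hf Hz. assert (Hz0 := Im_neq_0 z Hz). set (w := ((z - 1) / 4)%C).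
  assert (Hw : 0 < Im w) by (unfold w; rewrite Im_div_4; destruct z; simpl in *; lra).
  assert (Hlaw := Hf 1%Z 0%Z 4%Z 1%Z ltac:(split; [reflexivity|exists 1%Z; reflexivity]) w Hw).
  assert (Hden : (4 * w + 1)%C = z) by (unfold w; field).
  assert (Hmobius : mobius 1 0 4 1 w = ((- / z + 1) / 4)%C).
  { unfold mobius. rewrite Hden. unfold w. field. exact Hz0. }
  rewrite Hmobius, theta_quarter_neg_inv_succ in Hlaw by exact Hz. rewrite Hlaw. fold w. unfold weight_cocycle.
  do 2 f_equal. field. apply theta_neq_0, Hw.
Qed.

Lemma transforms_neg_inv_pred (t : Z) (f : C -> C) (z : C) : transforms_like_theta t f -> 0 < Im z ->
  f ((- / z - 1) / 4)%C = (inversion_sign t * weight_cocycle t z * f ((z + 1) / 4))%C.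
Proof.
  intros Hf Hz. assert (Hz0 := Im_neq_0 z Hz). set (w := ((z + 1) / 4)%C).
  assert (Hw : 0 < Im w) by (unfold w; rewrite Im_div_4, Im_plus_R; lra).
  assert (Hlaw := Hf 1%Z 0%Z (-4)%Z 1%Z ltac:(split; [reflexivity|exists (-1)%Z; reflexivity]) w Hw).
  assert (Hden : (-4 * w + 1)%C = (- z)%C) by (unfold w; field).
  assert (Hmobius : mobius 1 0 (-4) 1 w = ((- / z - 1) / 4)%C).
  { unfold mobius. rewrite Hden. unfold w. field. exact Hz0. }
  rewrite Hmobius, theta_quarter_neg_inv_pred in Hlaw by exact Hz. rewrite Hlaw. fold w.
  unfold inversion_sign, weight_cocycle. rewrite <- Czpow_mult.
  - do 2 f_equal. field. apply theta_neq_0, Hw.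
  - apply Copp_neq_0, Ci_nz.
  - apply theta_cocycle_neq_0, Hz.
Qed.

Lemma half_period_vanishing (t : Z) (f : C -> C) (eps : C) : transforms_like_theta t f -> (eps * eps)%C = RtoC 1 ->
  (forall z, 0 < Im z -> f (z + (/ 2)%R)%C = (eps * f z)%C) -> forall z, 0 < Im z -> f z = RtoC 0.
Proof.
  intros Hf Heps Hhalf z Hz. set (w := (4 * z + 1)%C).
  assert (Hw : 0 < Im w) by (unfold w; rewrite Im_plus_R, im_scal_l; lra).
  assert (Hshift : forall u, 0 < Im u -> f ((u + 1) / 4)%C = (eps * f ((u - 1) / 4))%C).
  { intros u Hu. rewrite <- Hhalf by (rewrite Im_div_4; destruct u; simpl in *; lra).
    f_equal. rewrite RtoC_inv by lra. field. }
  assert (Hz_eq : z = ((w - 1) / 4)%C) by (unfold w; field).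
  assert (Hsucc := transforms_neg_inv_succ t f w Hf Hw).
  rewrite Hshift, (transforms_neg_inv_pred t f w Hf Hw), (Hshift w Hw) in Hsucc by apply Im_neg_inv_pos, Hw.
  rewrite <- Hz_eq in Hsucc. apply NNPP. intros Hfz.
  apply (inversion_sign_neq_1 t). apply Cmult_eq_reg_l with (weight_cocycle t w * f z)%C.
  - apply Cmult_neq_0; [apply weight_cocycle_neq_0, Hw|exact Hfz].
  - rewrite Cmult_1_r. etransitivity; [|exact Hsucc].
    transitivity ((eps * eps) * (inversion_sign t * weight_cocycle t w * f z))%C; [rewrite Heps|]; ring.
Qed.

(** * Wronskians *)

Definition wronskian (f g : C -> C) (z : C) : C := (f z * C_derive g z - g z * C_derive f z)%C.

Lemma wronskian_eq (f g : C -> C) (z k l : C) :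
  is_Cderive f z k -> is_Cderive g z l -> wronskian f g z = (f z * l - g z * k)%C.
Proof.
  intros Hk Hl. unfold wronskian. rewrite (is_C_derive_unique f z k Hk), (is_C_derive_unique g z l Hl). reflexivity.
Qed.

Lemma wronskian_ext_above (h : R) (f g f' g' : C -> C) (z : C) : h < Im z ->
  (forall w, h < Im w -> f w = f' w) -> (forall w, h < Im w -> g w = g' w) ->
  ex_Cderive f z -> ex_Cderive g z -> wronskian f g z = wronskian f' g' z.
Proof.
  intros Hz Hff' Hgg' [k Hk] [l Hl]. rewrite (wronskian_eq f g z k l), (wronskian_eq f' g' z k l), Hff', Hgg';
    try assumption; [reflexivity| |]; eapply is_Cderive_ext_above; eassumption.
Qed.

Lemma wronskian_linear_combination (f g : C -> C) (a b c d z : C) : ex_Cderive f z -> ex_Cderive g z ->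
  wronskian (fun w => a * f w + b * g w)%C (fun w => c * f w + d * g w)%C z = ((a * d - b * c) * wronskian f g z)%C.
Proof.
  intros [k Hk] [l Hl]. rewrite (wronskian_eq f g z k l Hk Hl).
  erewrite wronskian_eq by (apply is_Cderive_plus; apply is_Cderive_scal; eassumption). ring.
Qed.

Lemma wronskian_comp (f g p : C -> C) (z m : C) : is_Cderive p z m -> ex_Cderive f (p z) -> ex_Cderive g (p z) ->
  wronskian (fun w => f (p w)) (fun w => g (p w)) z = (m * wronskian f g (p z))%C.
Proof.
  intros Hp [k Hk] [l Hl]. rewrite (wronskian_eq f g (p z) k l Hk Hl).
  rewrite (wronskian_eq (fun w => f (p w)) (fun w => g (p w)) z _ _ (is_Cderive_comp f p _ _ _ Hp Hk)
    (is_Cderive_comp g p _ _ _ Hp Hl)). ring.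
Qed.

Lemma wronskian_mult (f g r : C -> C) (z : C) : ex_Cderive r z -> ex_Cderive f z -> ex_Cderive g z ->
  wronskian (fun w => r w * f w)%C (fun w => r w * g w)%C z = (r z * r z * wronskian f g z)%C.
Proof.
  intros [m Hm] [k Hk] [l Hl]. rewrite (wronskian_eq f g z k l Hk Hl).
  erewrite wronskian_eq by (apply is_Cderive_mult; eassumption). ring.
Qed.

Lemma proportional_of_wronskian_eq_0 (h : R) (f g : C -> C) :
  holomorphic_above h f -> holomorphic_above h g -> (forall z, h < Im z -> f z <> RtoC 0) ->
  (forall z, h < Im z -> wronskian f g z = RtoC 0) -> exists c, forall z, h < Im z -> g z = (c * f z)%C.
Proof.
  intros Hf Hg Hf0 Hw.
  assert (Hquotient : forall z, h < Im z -> is_Cderive (fun w => g w * / f w)%C z (RtoC 0)).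
  { intros z Hz. destruct (Hf z Hz) as [k Hk]. destruct (Hg z Hz) as [l Hl].
    assert (Hwz := Hw z Hz). rewrite (wronskian_eq f g z k l Hk Hl) in Hwz.
    eapply is_Cderive_eq; [|apply is_Cderive_mult; [exact Hl|apply is_Cderive_inv; [apply Hf0, Hz|exact Hk]]].
    cbv beta. transitivity ((f z * l - g z * k) / (f z * f z))%C; [field; apply Hf0, Hz|].
    rewrite Hwz. field. apply Hf0, Hz. }
  assert (Hz0 : h < Im (0, h + 1)) by (simpl; lra).
  exists (g (0, (h + 1)%R) * / f (0, (h + 1)%R))%C. intros z Hz.
  rewrite <- (derivative_zero_constant h _ Hquotient z _ Hz Hz0). field. apply Hf0, Hz.
Qed.

Definition plus_wronskian (f : C -> C) (z : C) : C := wronskian (even_part f) (odd_part f) (z / 4).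

Section PlusWronskian.

Variables (t : Z) (f : C -> C).
Hypothesis Hf : plus_form t f.

Let Hper : periodic_above 0 f := transforms_periodic t f (proj1 (proj2 Hf)).
Let Heven : holomorphic_above 0 (even_part f) := holomorphic_above_even_part f (proj1 Hf).
Let Hodd : holomorphic_above 0 (odd_part f) := holomorphic_above_odd_part f (proj1 Hf).

Lemma plus_wronskian_plus_1 (z : C) : 0 < Im z -> plus_wronskian f (z + 1) = (plus_unit t * plus_wronskian f z)%C.
Proof.
  intros Hz. set (s := (z / 4)%C). assert (Hs : 0 < Im s) by (unfold s; rewrite Im_div_4; lra).
  assert (Hs' : 0 < Im (s + (/ 4)%R)) by (rewrite Im_plus_R; exact Hs).
  unfold plus_wronskian. fold s.
  replace ((z + 1) / 4)%C with (s + (/ 4)%R)%C by (unfold s; rewrite RtoC_inv by lra; field).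
  assert (Hshift : is_Cderive (fun w => w + (/ 4)%R)%C s (RtoC 1))
    by apply (is_Cderive_shift (fun w => w)), is_Cderive_id.
  assert (Hcomp := wronskian_comp (even_part f) (odd_part f) _ s _ Hshift (Heven _ Hs') (Hodd _ Hs')).
  rewrite Cmult_1_l in Hcomp. rewrite <- Hcomp.
  rewrite (wronskian_ext_above 0 _ _ (fun w => 1 * even_part f w + 0 * odd_part f w)%C
    (fun w => 0 * even_part f w + plus_unit t * odd_part f w)%C s Hs).
  - rewrite wronskian_linear_combination by auto. ring.
  - intros w Hw. rewrite (even_part_quarter t f Hf w Hw). ring.
  - intros w Hw. rewrite (odd_part_quarter t f Hf w Hw). ring.
  - apply ex_Cderive_shift, Heven, Hs'.
  - apply ex_Cderive_shift, Hodd, Hs'.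
Qed.

Lemma plus_form_quarter_succ (z : C) : 0 < Im z ->
  f ((z + 1) / 4)%C = (even_part f (z / 4) + plus_unit t * odd_part f (z / 4))%C.
Proof.
  intros Hz. rewrite (even_odd_parts f).
  replace ((z + 1) / 4)%C with (z / 4 + (/ 4)%R)%C by (rewrite RtoC_inv by lra; field).
  rewrite (even_part_quarter t f Hf), (odd_part_quarter t f Hf) by (rewrite Im_div_4; lra). reflexivity.
Qed.

Lemma plus_form_quarter_pred (z : C) : 0 < Im z ->
  f ((z - 1) / 4)%C = (even_part f (z / 4) - plus_unit t * odd_part f (z / 4))%C.
Proof.
  intros Hz. set (w := ((z - 1) / 4)%C).
  assert (Hw : 0 < Im w) by (unfold w; rewrite Im_div_4; destruct z; simpl in *; lra).
  replace (z / 4)%C with (w + (/ 4)%R)%C by (unfold w; rewrite RtoC_inv by lra; field).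
  rewrite (even_part_quarter t f Hf), (odd_part_quarter t f Hf), (even_odd_parts f w) by exact Hw.
  transitivity (even_part f w - (plus_unit t * plus_unit t) * odd_part f w)%C; [rewrite plus_unit_sqr; ring|ring].
Qed.

Let succ (w : C) : C := f ((w + 1) / 4)%C.
Let pred (w : C) : C := f ((w - 1) / 4)%C.

Lemma holomorphic_above_quarter_succ : holomorphic_above 0 succ.
Proof.
  intros z Hz. apply (ex_Cderive_shift (fun w => f (w / 4)%C)), ex_Cderive_div_4; [apply Hf|].
  rewrite Im_plus_R. exact Hz.
Qed.

Lemma holomorphic_above_quarter_pred : holomorphic_above 0 pred.
Proof.
  intros z Hz. apply (ex_Cderive_shift (fun w => f (w / 4)%C) z (- RtoC 1)%C), ex_Cderive_div_4; [apply Hf|].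
  destruct z. simpl in *. lra.
Qed.

Lemma wronskian_quarter_shifts (z : C) : 0 < Im z ->
  wronskian succ pred z = (- plus_unit t / 2 * plus_wronskian f z)%C.
Proof.
  intros Hz. assert (Hz4 : 0 < Im (z / 4)) by (rewrite Im_div_4; lra).
  rewrite (wronskian_ext_above 0 _ _
    (fun w => 1 * even_part f (w / 4) + plus_unit t * odd_part f (w / 4))%C
    (fun w => 1 * even_part f (w / 4) + (- plus_unit t) * odd_part f (w / 4))%C z Hz).
  - rewrite (wronskian_linear_combination (fun w => even_part f (w / 4)%C) (fun w => odd_part f (w / 4)%C))
      by (apply ex_Cderive_div_4; assumption).
    rewrite (wronskian_comp (even_part f) (odd_part f) (fun w => w / 4)%C z _ (is_Cderive_div_4 z)) by auto.
    fold (plus_wronskian f z). field.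
  - intros w Hw. unfold succ. rewrite plus_form_quarter_succ by exact Hw. ring.
  - intros w Hw. unfold pred. rewrite plus_form_quarter_pred by exact Hw. ring.
  - apply holomorphic_above_quarter_succ, Hz.
  - apply holomorphic_above_quarter_pred, Hz.
Qed.

Lemma wronskian_quarter_shifts_swap (z : C) : 0 < Im z ->
  wronskian (fun w => weight_cocycle t w * pred w)%C (fun w => weight_cocycle t w * (inversion_sign t * succ w))%C z =
  (weight_cocycle t z * weight_cocycle t z * (- inversion_sign t * (- plus_unit t / 2 * plus_wronskian f z)))%C.
Proof.
  intros Hz. assert (Hsucc := holomorphic_above_quarter_succ z Hz).
  assert (Hpred := holomorphic_above_quarter_pred z Hz).
  rewrite (wronskian_mult pred (fun w => inversion_sign t * succ w)%C (weight_cocycle t) z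
    (holomorphic_above_weight_cocycle t z Hz) Hpred (ex_Cderive_scal _ _ _ Hsucc)).
  f_equal. rewrite <- wronskian_quarter_shifts by exact Hz.
  rewrite (wronskian_ext_above 0 _ _ (fun w => 0 * succ w + 1 * pred w)%C
    (fun w => inversion_sign t * succ w + 0 * pred w)%C z Hz).
  - rewrite (wronskian_linear_combination succ pred _ _ _ _ z Hsucc Hpred). ring.
  - intros w _. ring.
  - intros w _. ring.
  - exact Hpred.
  - apply ex_Cderive_scal, Hsucc.
Qed.

Lemma plus_wronskian_neg_inv (z : C) : 0 < Im z ->
  plus_wronskian f (- / z) = (- inversion_sign t * (weight_cocycle t z * weight_cocycle t z) *
    (z * z) * plus_wronskian f z)%C.
Proof.
  intros Hz. assert (Hz0 := Im_neq_0 z Hz). assert (Hw := Im_neg_inv_pos z Hz).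
  assert (Hsucc := holomorphic_above_quarter_succ). assert (Hpred := holomorphic_above_quarter_pred).
  assert (Hcomp := wronskian_comp succ pred (fun w => - / w)%C z _ (is_Cderive_neg_inv z Hz0) (Hsucc _ Hw)
    (Hpred _ Hw)).
  rewrite wronskian_quarter_shifts in Hcomp by exact Hw.
  apply Cmult_eq_reg_l with (/ (z * z) * (- plus_unit t / 2))%C.
  - unfold Cdiv. repeat apply Cmult_neq_0.
    + apply Cinv_neq_0, Cmult_neq_0; exact Hz0.
    + apply Copp_neq_0, plus_unit_neq_0.
    + apply Cinv_neq_0, RtoC_neq_0. lra.
  - rewrite <- Cmult_assoc, <- Hcomp, (wronskian_ext_above 0 _ _ (fun w => weight_cocycle t w * pred w)%C
      (fun w => weight_cocycle t w * (inversion_sign t * succ w))%C z Hz).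
    + rewrite wronskian_quarter_shifts_swap by exact Hz. field. exact Hz0.
    + intros w Hw'. apply (transforms_neg_inv_succ t f w (proj1 (proj2 Hf)) Hw').
    + intros w Hw'. unfold succ, pred. rewrite (transforms_neg_inv_pred t f w (proj1 (proj2 Hf)) Hw'). ring.
    + apply ex_Cderive_neg_inv; assumption.
    + apply ex_Cderive_neg_inv; assumption.
Qed.

Lemma Cmod_plus_wronskian_neg_inv (z : C) : 0 < Im z ->
  Cmod (plus_wronskian f (- / z)) = powerRZ (Cmod z) (2 * t + 3) * Cmod (plus_wronskian f z).
Proof.
  intros Hz. assert (Hpos := proj1 (Cmod_gt_0 z) (Im_neq_0 z Hz)).
  rewrite plus_wronskian_neg_inv, !Cmod_mult, Cmod_opp, Cmod_inversion_sign by exact Hz.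
  replace (2 * t + 3)%Z with (2 * t + 1 + Z.of_nat 2)%Z by (simpl; ring).
  rewrite powerRZ_add, <- pow_powerRZ, <- Cmod_weight_cocycle_sqr by (exact Hz || lra). simpl. ring.
Qed.

Variables B0 B1 : Z.
Hypotheses (Heven_low : forall n, (n < B0)%Z -> fcoef (even_part f) n = RtoC 0)
  (Hodd_low : forall n, (n < B1)%Z -> fcoef (odd_part f) n = RtoC 0).

Let Heven_per : periodic_above 0 (even_part f) := periodic_above_even_part f Hper.
Let Hodd_per : periodic_above 0 (odd_part f) := periodic_above_odd_part f Hper.

Lemma holomorphic_above_plus_wronskian : holomorphic_above 0 (plus_wronskian f).
Proof.
  intros z Hz. apply (ex_Cderive_div_4 (wronskian (even_part f) (odd_part f))); [|exact Hz].
  intros w Hw. apply ex_Cderive_minus; apply ex_Cderive_mult.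
  - apply Heven, Hw.
  - apply (holomorphic_above_C_derive 0 (odd_part f) B1); (assumption || lra).
  - apply Hodd, Hw.
  - apply (holomorphic_above_C_derive 0 (even_part f) B0); (assumption || lra).
Qed.

Lemma plus_wronskian_growth : exists K, 0 <= K /\ forall z, 3 / 4 <= Im z ->
  Cmod (plus_wronskian f z) <= K * exp (- (PI / 2 * IZR (B0 + B1) * Im z)).
Proof.
  destruct (qexp_growth 0 (even_part f) B0 Rlt_0_1 Heven Heven_per Heven_low (3 / 16)) as [K0 [HK0 Hgrowth0]]; [lra|].
  destruct (qexp_growth 0 (odd_part f) B1 Rlt_0_1 Hodd Hodd_per Hodd_low (3 / 16)) as [K1 [HK1 Hgrowth1]]; [lra|].
  exists (2 * (K0 * K1)). split; [nra|]. intros z Hz.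
  destruct (Hgrowth0 (z / 4)%C) as [Hf0 Hd0]; [rewrite Im_div_4; lra|].
  destruct (Hgrowth1 (z / 4)%C) as [Hf1 Hd1]; [rewrite Im_div_4; lra|].
  rewrite Im_div_4 in Hf0, Hd0, Hf1, Hd1.
  replace (- (PI / 2 * IZR (B0 + B1) * Im z))
    with (- (2 * PI * IZR B0 * (Im z / 4)) + - (2 * PI * IZR B1 * (Im z / 4)))
    by (rewrite plus_IZR; field).
  rewrite exp_plus. unfold plus_wronskian, wronskian.
  eapply Rle_trans; [apply Cmod_triangle_minus|]. rewrite !Cmod_mult.
  assert (Hprod0 := Rmult_le_compat _ _ _ _ (Cmod_ge_0 _) (Cmod_ge_0 _) Hf0 Hd1).
  assert (Hprod1 := Rmult_le_compat _ _ _ _ (Cmod_ge_0 _) (Cmod_ge_0 _) Hf1 Hd0). lra.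
Qed.

End PlusWronskian.

(** * The zero estimate *)

Definition wronskian_quotient (t : Z) (f : C -> C) (z : C) : C :=
  (plus_wronskian f z ^ 12 * Czpow (theta_disc z ^ 4) (- (2 * t + 3)))%C.

Lemma holomorphic_above_theta_disc : holomorphic_above 0 theta_disc.
Proof.
  assert (Htheta := holomorphic_above_theta).
  assert (Hodd : holomorphic_above 0 theta_odd).
  { intros z Hz. apply ex_Cderive_minus; [apply ex_Cderive_div_4; assumption|apply Htheta, Hz]. }
  intros z Hz. specialize (Htheta z Hz). specialize (Hodd z Hz).
  apply ex_Cderive_mult; [apply ex_Cderive_mult|apply ex_Cderive_minus; apply ex_Cderive_Cpow]; assumption.
Qed.

Lemma Cmod_wronskian_quotient (t : Z) (f : C -> C) (z : C) : 0 < Im z ->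
  Cmod (wronskian_quotient t f z) = Cmod (plus_wronskian f z) ^ 12 * powerRZ (Cmod (theta_disc z)) (- (2 * t + 3)) ^ 4.
Proof.
  intros Hz. unfold wronskian_quotient.
  rewrite Cmod_mult, Cmod_Czpow, !Cmod_pow, powerRZ_pow by apply Cpow_nz, theta_disc_neq_0, Hz. reflexivity.
Qed.

Section WronskianQuotient.

Variables (t : Z) (f : C -> C) (B0 B1 : Z).
Hypothesis Hf : plus_form t f.
Hypotheses (Heven_low : forall n, (n < B0)%Z -> fcoef (even_part f) n = RtoC 0)
  (Hodd_low : forall n, (n < B1)%Z -> fcoef (odd_part f) n = RtoC 0).

Lemma holomorphic_above_wronskian_quotient : holomorphic_above 0 (wronskian_quotient t f).
Proof.
  intros z Hz. apply ex_Cderive_mult.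
  - apply ex_Cderive_Cpow, (holomorphic_above_plus_wronskian t f Hf B0 B1); assumption.
  - apply (ex_Cderive_Czpow (fun w => theta_disc w ^ 4)%C); [|apply Cpow_nz, theta_disc_neq_0, Hz].
    apply ex_Cderive_Cpow, holomorphic_above_theta_disc, Hz.
Qed.

Lemma periodic_above_wronskian_quotient : periodic_above 0 (wronskian_quotient t f).
Proof.
  intros z Hz. unfold wronskian_quotient.
  rewrite (plus_wronskian_plus_1 t f Hf), theta_disc_plus_1, !Cpow_mult_l by exact Hz.
  replace (Ci ^ 4)%C with ((Ci * Ci) * (Ci * Ci))%C by ring. rewrite Ci_sqr.
  set (u := plus_unit t).
  replace (u ^ 12)%C with ((u * u) * (u * u) * (u * u) * (u * u) * (u * u) * (u * u))%C by ring.
  unfold u. rewrite plus_unit_sqr. f_equal; [ring|]. f_equal. ring.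
Qed.

Lemma Cmod_wronskian_quotient_neg_inv (z : C) : 0 < Im z ->
  Cmod (wronskian_quotient t f (- / z)%C) = Cmod (wronskian_quotient t f z).
Proof.
  intros Hz. assert (Hpos := proj1 (Cmod_gt_0 z) (Im_neq_0 z Hz)).
  rewrite !Cmod_wronskian_quotient, (Cmod_plus_wronskian_neg_inv t f Hf), Cmod_theta_disc_neg_inv
    by (exact Hz || apply Im_neg_inv_pos, Hz).
  rewrite powerRZ_mult, powerRZ_pow, powerRZ_neg'. field. apply powerRZ_NOR. lra.
Qed.

Lemma wronskian_quotient_decay : (2 * t + 3 < 3 * (B0 + B1))%Z -> exists K, forall z, 3 / 4 <= Im z ->
  Cmod (wronskian_quotient t f z) <= K * exp (- (2 * PI * Im z)).
Proof.
  intros HB. assert (HPI := PI_RGT_0). set (e := (- (2 * t + 3))%Z).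
  destruct (plus_wronskian_growth t f Hf B0 B1 Heven_low Hodd_low) as [K [HK Hgrowth]].
  set (L := powerRZ (/ 2) e + powerRZ 5 e).
  assert (HL : 0 <= L) by (apply Rplus_le_le_0_compat; apply powerRZ_le; lra).
  exists (K ^ 12 * L ^ 4). intros z Hz. rewrite Cmod_wronskian_quotient by lra. fold e.
  assert (HW := Hgrowth z Hz). set (EW := exp (- (PI / 2 * IZR (B0 + B1) * Im z))) in *.
  set (r := exp (- (PI / 2 * Im z))). assert (Hr : 0 < r) by apply exp_pos.
  assert (HD : powerRZ (Cmod (theta_disc z)) e <= L * powerRZ r e)
    by (apply powerRZ_le_scaled; try lra; apply theta_disc_bounds, Hz).
  assert (HD0 : 0 <= powerRZ (Cmod (theta_disc z)) e)
    by (apply powerRZ_le, Cmod_gt_0, theta_disc_neq_0; lra).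
  eapply Rle_trans; [apply Rmult_le_compat; [apply pow_le, Cmod_ge_0|apply pow_le, HD0| |];
    apply pow_incr; split; [apply Cmod_ge_0|exact HW|exact HD0|exact HD]|].
  rewrite !Rpow_mult_distr.
  replace (K ^ 12 * EW ^ 12 * (L ^ 4 * powerRZ r e ^ 4)) with (K ^ 12 * L ^ 4 * (EW ^ 12 * powerRZ r e ^ 4)) by ring.
  apply Rmult_le_compat_l; [apply Rmult_le_pos; apply pow_le; assumption|].
  unfold EW, r. rewrite powerRZ_exp, <- !exp_INR_mult, <- exp_plus. apply exp_le.
  assert (Hgap : 1 <= IZR (3 * (B0 + B1) + e)) by (apply IZR_le; unfold e; lia).
  rewrite plus_IZR, mult_IZR in Hgap.
  assert (Hmult : 2 * PI * Im z * 1 <= 2 * PI * Im z * (3 * IZR (B0 + B1) + IZR e))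
    by (apply Rmult_le_compat_l; [nra|exact Hgap]).
  simpl INR. lra.
Qed.

Lemma plus_wronskian_eq_0 (z : C) : (2 * t + 3 < 3 * (B0 + B1))%Z -> 0 < Im z -> plus_wronskian f z = RtoC 0.
Proof.
  intros HB Hz. destruct (wronskian_quotient_decay HB) as [K HK].
  assert (Hquotient_zero := weight_zero_vanishing (wronskian_quotient t f) K holomorphic_above_wronskian_quotient
    periodic_above_wronskian_quotient Cmod_wronskian_quotient_neg_inv HK z Hz).
  apply NNPP. intros HW. revert Hquotient_zero. apply Cmult_neq_0; [apply Cpow_nz, HW|].
  apply Czpow_neq_0, Cpow_nz, theta_disc_neq_0, Hz.
Qed.

End WronskianQuotient.

Lemma least_nonzero_coefficient (c : Z -> C) (B : Z) : (forall n, (n < B)%Z -> c n = RtoC 0) ->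
  (exists n, c n <> RtoC 0) -> exists n, c n <> RtoC 0 /\ forall k, (k < n)%Z -> c k = RtoC 0.
Proof.
  intros Hlow [n Hn].
  assert (Hoffset : forall k, c k <> RtoC 0 -> k = (B + Z.of_nat (Z.to_nat (k - B)))%Z).
  { intros k Hk. destruct (Z_lt_le_dec k B) as [Hlt|Hle]; [contradiction (Hk (Hlow k Hlt))|lia]. }
  destruct (dec_inh_nat_subset_has_unique_least_element (fun k => c (B + Z.of_nat k)%Z <> RtoC 0))
    as [m [[Hm Hleast] _]].
  - intros k. apply classic.
  - exists (Z.to_nat (n - B)). rewrite <- Hoffset; exact Hn.
  - exists (B + Z.of_nat m)%Z. split; [exact Hm|]. intros k Hk. apply NNPP. intros Hck.
    assert (Hle := Hleast (Z.to_nat (k - B))). rewrite <- Hoffset in Hle by exact Hck. specialize (Hle Hck).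
    rewrite (Hoffset k Hck) in Hk. lia.
Qed.

Section ZeroEstimate.

Variables (t : Z) (f : C -> C) (B0 B1 : Z).
Hypothesis Hf : plus_form t f.
Hypotheses (Heven_low : forall n, Z.even n = true -> (n < B0)%Z -> fcoef f n = RtoC 0)
  (Hodd_low : forall n, Z.even n = false -> (n < B1)%Z -> fcoef f n = RtoC 0).

Let Hper : periodic_above 0 f := transforms_periodic t f (proj1 (proj2 Hf)).
Let Heven : holomorphic_above 0 (even_part f) := holomorphic_above_even_part f (proj1 Hf).
Let Hodd : holomorphic_above 0 (odd_part f) := holomorphic_above_odd_part f (proj1 Hf).

Lemma fcoef_even_part_low (n : Z) : (n < B0)%Z -> fcoef (even_part f) n = RtoC 0.
Proof.
  intros Hn. rewrite fcoef_even_part by (apply Hf || exact Hper). destruct (Z.even n) eqn:Hpar; auto.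
Qed.

Lemma fcoef_odd_part_low (n : Z) : (n < B1)%Z -> fcoef (odd_part f) n = RtoC 0.
Proof.
  intros Hn. rewrite fcoef_odd_part by (apply Hf || exact Hper). destruct (Z.even n) eqn:Hpar; auto.
Qed.

(* Where the even part does not vanish, the odd part is a constant multiple of it; the shift by 1/4, which fixes
   the even part and multiplies the odd part by [plus_unit t], forces the constant to be zero. *)
Lemma odd_part_eq_0 : (2 * t + 3 < 3 * (B0 + B1))%Z -> (exists n, fcoef (even_part f) n <> RtoC 0) ->
  forall z, 0 < Im z -> odd_part f z = RtoC 0.
Proof.
  intros HB Hex. destruct (least_nonzero_coefficient _ B0 fcoef_even_part_low Hex) as [n1 [Hn1 Hlow]].
  destruct (qexp_neq_0 0 (even_part f) n1 Rlt_0_1 Heven (periodic_above_even_part f Hper) Hlow Hn1) as [Y [HY Hneq]].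
  destruct (proportional_of_wronskian_eq_0 Y (even_part f) (odd_part f)) as [c Hc].
  - intros z Hz. apply Heven. lra.
  - intros z Hz. apply Hodd. lra.
  - exact Hneq.
  - intros z Hz. assert (H4z : 0 < Im (4 * z)) by (rewrite im_scal_l; lra).
    assert (HW := plus_wronskian_eq_0 t f B0 B1 Hf fcoef_even_part_low fcoef_odd_part_low _ HB H4z).
    unfold plus_wronskian in HW. replace (4 * z / 4)%C with z in HW by field. exact HW.
  - apply (eq_0_of_eq_0_above 0 Y); try assumption; [lra|apply periodic_above_odd_part, Hper|].
    intros z Hz. assert (Hz0 : 0 < Im z) by lra. rewrite Hc by exact Hz.
    assert (Hshift := Hc (z + (/ 4)%R)%C ltac:(rewrite Im_plus_R; exact Hz)).
    rewrite (odd_part_quarter t f Hf), (even_part_quarter t f Hf), Hc in Hshift by assumption.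
    apply Cmult_eq_reg_l with (plus_unit t - 1)%C.
    + apply Cminus_eq_contra. intros Hone. assert (Hsqr := plus_unit_sqr t). rewrite Hone, Cmult_1_l in Hsqr.
      apply RtoC_inj in Hsqr. lra.
    + transitivity (plus_unit t * (c * even_part f z) - c * even_part f z)%C; [ring|]. rewrite Hshift. ring.
Qed.

Theorem plus_form_eq_0 : (2 * t + 3 < 3 * (B0 + B1))%Z -> forall n, fcoef f n = RtoC 0.
Proof.
  intros HB. cut (forall z, 0 < Im z -> f z = RtoC 0).
  { intros Hzero n. apply fcoef_eq_0. intros z Hz. apply Hzero. lra. }
  destruct (classic (exists n, fcoef (even_part f) n <> RtoC 0)) as [Hex|Hnone].
  - apply (half_period_vanishing t f 1 (proj1 (proj2 Hf))); [ring|]. intros z Hz.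
    assert (Hzero := odd_part_eq_0 HB Hex z Hz). unfold odd_part in Hzero.
    transitivity (f z - 2 * ((f z - f (z + (/ 2)%R)) / 2))%C; [field|]. rewrite Hzero. ring.
  - apply (half_period_vanishing t f (-1) (proj1 (proj2 Hf))); [ring|].
    assert (Hzero : forall z, 0 < Im z -> even_part f z = RtoC 0).
    { apply eq_0_of_fcoef_eq_0; [lra|exact Heven|apply periodic_above_even_part, Hper|].
      intros n. apply NNPP. intros Hn. apply Hnone. exists n. exact Hn. }
    intros z Hz. specialize (Hzero z Hz). unfold even_part in Hzero.
    transitivity (2 * ((f z + f (z + (/ 2)%R)) / 2) - f z)%C; [field|]. rewrite Hzero. ring.
Qed.

End ZeroEstimate.

(** * Homogeneous linear systems and combinations of plus forms *)

Lemma Csum_linear (a b : nat -> C) (c : C) (n : nat) :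
  sum_n (fun j => a j + c * b j)%C n = (sum_n a n + c * sum_n b n)%C :> C.
Proof.
  induction n as [|n IH]; [rewrite !sum_O; reflexivity|]. rewrite !Csum_Sn, IH. ring.
Qed.

Lemma Csum_ext (a b : nat -> C) (n : nat) : (forall j, (j <= n)%nat -> a j = b j) -> sum_n a n = sum_n b n :> C.
Proof. apply sum_n_ext_loc. Qed.

Lemma Csum_eq_0 (a : nat -> C) (n : nat) : (forall j, (j <= n)%nat -> a j = RtoC 0) -> sum_n a n = RtoC 0 :> C.
Proof.
  intros Ha. induction n as [|n IH]; [rewrite sum_O; apply Ha; lia|].
  rewrite Csum_Sn, IH, Ha by auto. ring.
Qed.

Lemma Csum_single (a : nat -> C) (n k : nat) : (k <= n)%nat ->
  (forall j, (j <= n)%nat -> j <> k -> a j = RtoC 0) -> sum_n a n = a k :> C.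
Proof.
  intros Hk Ha. induction n as [|n IH]; [replace k with O by lia; apply sum_O|].
  rewrite Csum_Sn. destruct (Nat.eq_dec k (S n)) as [->|Hne].
  - rewrite Csum_eq_0 by (intros j Hj; apply Ha; lia). ring.
  - rewrite IH, (Ha (S n)) by (auto with arith || lia). ring.
Qed.

Definition extend_solution (n : nat) (d : nat -> C) (last : C) (j : nat) : C := if (j <=? n)%nat then d j else last.

Lemma Csum_extend_solution (n : nat) (row d : nat -> C) (last : C) :
  sum_n (fun j => row j * extend_solution n d last j)%C (S n) =
  (sum_n (fun j => row j * d j)%C n + row (S n) * last)%C :> C.
Proof.
  rewrite Csum_Sn. unfold extend_solution at 2. rewrite (proj2 (Nat.leb_gt (S n) n)) by lia. f_equal.
  apply Csum_ext. intros j Hj. unfold extend_solution. rewrite (proj2 (Nat.leb_le j n) Hj). reflexivity.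
Qed.

(* If some row involves the last unknown, that row eliminates it; otherwise the last unknown is free. *)
Lemma underdetermined_system (n : nat) (rows : list (nat -> C)) : length rows = n -> exists c : nat -> C,
  (exists j, (j <= n)%nat /\ c j <> RtoC 0) /\ forall row, In row rows ->
    sum_n (fun j => row j * c j)%C n = RtoC 0 :> C.
Proof.
  revert rows. induction n as [|n IH]; intros rows Hlen.
  - apply length_zero_iff_nil in Hlen. subst rows.
    exists (fun _ => RtoC 1). split; [exists O; split; [lia|apply C1_nz]|intros row []].
  - destruct (classic (exists p, In p rows /\ p (S n) <> RtoC 0)) as [[p [Hp Hpivot]]|Hfree].
    + destruct (in_split p rows Hp) as [l1 [l2 ->]].
      destruct (IH (map (fun row j => row j + - (row (S n) / p (S n)) * p j)%C (l1 ++ l2))) as [d [[j [Hj Hdj]] Hd]].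
      { rewrite length_map. rewrite length_app in *. simpl in Hlen. lia. }
      exists (extend_solution n d (- sum_n (fun j => p j * d j)%C n / p (S n))). split.
      * exists j. split; [lia|]. unfold extend_solution. rewrite (proj2 (Nat.leb_le j n) Hj). exact Hdj.
      * intros row Hrow. rewrite Csum_extend_solution.
        assert (Hcases : row = p \/ In row (l1 ++ l2)).
        { apply in_app_or in Hrow. destruct Hrow as [Hrow|[<-|Hrow]]; auto; right; apply in_or_app; auto. }
        destruct Hcases as [->|Hrest]; [field; exact Hpivot|].
        specialize (Hd _ (in_map _ _ _ Hrest)). cbv beta in Hd.
        rewrite (Csum_ext _ (fun j => row j * d j + - (row (S n) / p (S n)) * (p j * d j))%C), Csum_linear in Hd
          by (intros k _; ring).
        rewrite <- Hd. field. exact Hpivot.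
    + exists (extend_solution n (fun _ => RtoC 0) 1). split.
      * exists (S n). split; [lia|]. unfold extend_solution. rewrite (proj2 (Nat.leb_gt (S n) n)) by lia. apply C1_nz.
      * intros row Hrow. rewrite Csum_extend_solution, Csum_eq_0 by (intros k _; ring).
        replace (row (S n)) with (RtoC 0); [ring|]. symmetry. apply NNPP. intros Hne. apply Hfree. exists row. auto.
Qed.

Lemma plus_form_linear (t : Z) (f g : C -> C) (c : C) : plus_form t f -> plus_form t g ->
  plus_form t (fun z => f z + c * g z)%C /\
  forall n, fcoef (fun z => f z + c * g z)%C n = (fcoef f n + c * fcoef g n)%C.
Proof.
  intros [Hf [Hftrans Hfplus]] [Hg [Hgtrans Hgplus]]. assert (Hcg := holomorphic_above_Cmult 0 c g Hg).
  assert (Hcoef : forall n, fcoef (fun z => f z + c * g z)%C n = (fcoef f n + c * fcoef g n)%C).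
  { intros n. rewrite (fcoef_plus 0 f (fun z => c * g z)%C), (fcoef_Cmult 0) by (assumption || lra). reflexivity. }
  split; [split; [|split]|exact Hcoef].
  - apply holomorphic_above_plus; assumption.
  - intros a b c' d Hgamma z Hz. rewrite (Hftrans a b c' d Hgamma z Hz), (Hgtrans a b c' d Hgamma z Hz). ring.
  - intros n Hn. rewrite Hcoef, (Hfplus n Hn), (Hgplus n Hn). ring.
Qed.

Lemma plus_form_const_0 (t : Z) : plus_form t (fun _ => RtoC 0) /\ forall n, fcoef (fun _ => RtoC 0) n = RtoC 0.
Proof.
  assert (Hcoef : forall n, fcoef (fun _ => RtoC 0) n = RtoC 0) by (intros n; apply fcoef_eq_0; reflexivity).
  split; [split; [|split]|exact Hcoef].
  - intros z _. apply ex_Cderive_const.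
  - intros a b c d _ z _. ring.
  - intros n _. apply Hcoef.
Qed.

Lemma plus_form_sum (t : Z) (F : nat -> C -> C) (c : nat -> C) (M : nat) : (forall j, plus_form t (F j)) ->
  plus_form t (fun z => sum_n (fun j => c j * F j z)%C M) /\
  forall n, fcoef (fun z => sum_n (fun j => c j * F j z)%C M) n = sum_n (fun j => c j * fcoef (F j) n)%C M.
Proof.
  intros HF. induction M as [|M [Hform Hcoef]].
  - destruct (plus_form_const_0 t) as [Hzero Hcoef0].
    replace (fun z => sum_n (fun j => c j * F j z)%C 0) with (fun z => 0 + c O * F O z)%C
      by (apply functional_extensionality; intros z; rewrite sum_O; apply Cplus_0_l).
    destruct (plus_form_linear t _ (F O) (c O) Hzero (HF O)) as [Hform Hcoef]. split; [exact Hform|].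
    intros n. rewrite Hcoef, Hcoef0, sum_O. apply Cplus_0_l.
  - replace (fun z => sum_n (fun j => c j * F j z)%C (S M))
      with (fun z => sum_n (fun j => c j * F j z) M + c (S M) * F (S M) z)%C
      by (apply functional_extensionality; intros z; rewrite Csum_Sn; reflexivity).
    destruct (plus_form_linear t _ (F (S M)) (c (S M)) Hform (HF (S M))) as [Hform' Hcoef']. split; [exact Hform'|].
    intros n. rewrite Hcoef', Hcoef, Csum_Sn. reflexivity.
Qed.

Lemma exists_vanishing_combination (t : Z) (index : nat -> Z) (F : nat -> C -> C) (exponents : list Z) :
  (forall j, canonical t (index j) (F j)) -> (forall j, (- Nk t <= index j)%Z) ->
  (forall j k, index j = index k -> j = k) -> exists g, plus_form t g /\ (exists n, fcoef g n <> RtoC 0) /\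
  (forall n, In n exponents -> fcoef g n = RtoC 0) /\
  forall n, (forall j, (j <= length exponents)%nat -> fcoef (F j) n = RtoC 0) -> fcoef g n = RtoC 0.
Proof.
  intros HF Hindex Hinj. set (M := length exponents).
  destruct (underdetermined_system M (map (fun n j => fcoef (F j) n) exponents) (length_map _ _))
    as [c [[k [Hk Hck]] Hc]].
  destruct (plus_form_sum t F c M) as [Hform Hcoef]; [intros j; apply in_Mshriek_plus_form, HF|].
  exists (fun z => sum_n (fun j => c j * F j z)%C M). split; [exact Hform|]. repeat split.
  - exists (- index k)%Z. rewrite Hcoef, (Csum_single _ M k Hk).
    + destruct (HF k) as [_ [Hlead _]]. rewrite Hlead, Cmult_1_r. exact Hck.
    + intros j _ Hjk. destruct (HF j) as [_ [_ Hlow]]. rewrite Hlow; [ring|specialize (Hindex k); lia|].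
      intros Heq. apply Hjk. symmetry. apply Hinj. lia.
  - intros n Hn. rewrite Hcoef. transitivity (sum_n (fun j => fcoef (F j) n * c j)%C M).
    + apply Csum_ext. intros j _. apply Cmult_comm.
    + apply (Hc (fun j => fcoef (F j) n)). apply (in_map (fun n j => fcoef (F j) n)), Hn.
  - intros n Hn. rewrite Hcoef. apply Csum_eq_0. intros j Hj. rewrite Hn by exact Hj. ring.
Qed.

(** * Exponents and indices *)

Open Scope Z_scope.

Definition odd_class (t : Z) : Z := if Z.even t then 1 else 3.

Lemma plus_okb_iff (t n : Z) : plus_okb t n = true <-> n mod 4 = 0 \/ n mod 4 = odd_class t.
Proof.
  unfold plus_okb, odd_class. rewrite Bool.orb_true_iff, !Z.eqb_eq.
  destruct (Z.even t); Z.div_mod_to_equations; lia.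
Qed.

Lemma plus_okb_pred_opp (t n : Z) : plus_okb (t - 1) (- n) = plus_okb t n.
Proof.
  unfold plus_okb. rewrite Z.sub_1_r, Z.even_pred, <- Z.negb_even.
  destruct (Z.even t); simpl; rewrite ?Z.opp_involutive; reflexivity.
Qed.

Definition first_above (N r : Z) : Z := N + 1 + (r - (N + 1)) mod 4.

Lemma first_above_spec (N r : Z) : 0 <= r < 4 -> N < first_above N r <= N + 4 /\ first_above N r mod 4 = r.
Proof. intros Hr. unfold first_above. Z.div_mod_to_equations. lia. Qed.

Lemma first_above_shift (N r a : Z) : first_above (N - 4 * a) r = first_above N r - 4 * a.
Proof. unfold first_above. Z.div_mod_to_equations. lia. Qed.

Lemma even_sub_12 (t a : Z) : Z.even (t - 12 * a) = Z.even t.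
Proof. replace (t - 12 * a) with (t + 2 * (- 6 * a)) by ring. apply Z.even_add_mul_2. Qed.

Lemma Nk_shift (t a : Z) : Nk (t - 12 * a) = Nk t - 4 * a.
Proof.
  assert (Hmod : (t - 12 * a) mod 6 = t mod 6).
  { replace (t - 12 * a) with (t + (- 2 * a) * 6) by ring. apply Z_mod_plus_full. }
  assert (Hell : ell (t - 12 * a) = ell t + 2 * - a).
  { unfold ell, kp_half. rewrite Hmod. set (k := match t mod 6 with 1 => 7 | r => r end).
    replace (t - 12 * a - k) with (t - k + (- 2 * a) * 6) by ring. rewrite Z_div_plus_full by lia. ring. }
  unfold Nk. rewrite Hell, Z.even_add_mul_2, even_sub_12. destruct (Z.even (ell t)); ring.
Qed.

Lemma Nk_bounds (t : Z) : t - 10 <= 3 * Nk t <= t + 3.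
Proof.
  unfold Nk, ell, kp_half. set (k := match t mod 6 with 1 => 7 | r => r end).
  assert (Hk : (t - k) mod 6 = 0 /\ 0 <= k <= 7).
  { unfold k. assert (Hr : 0 <= t mod 6 < 6) by (apply Z.mod_pos_bound; lia).
    assert (Hcases : t mod 6 = 0 \/ t mod 6 = 1 \/ t mod 6 = 2 \/ t mod 6 = 3 \/ t mod 6 = 4 \/ t mod 6 = 5) by lia.
    destruct Hcases as [H|[H|[H|[H|[H|H]]]]]; rewrite H; Z.div_mod_to_equations; lia. }
  destruct (Z.even ((t - k) / 6)), (Z.even t); Z.div_mod_to_equations; lia.
Qed.

(* The left-hand side is governed by the weight of the Wronskian, the right-hand side by its order at infinity. *)
Lemma first_exponents_sum_gt (t : Z) : 2 * t + 3 < 3 * (first_above (Nk t) 0 + first_above (Nk t) (odd_class t)).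
Proof.
  set (a := - (t / 12)). set (u := t mod 12).
  assert (Ht : t = u - 12 * a) by (unfold a, u; rewrite (Z.div_mod t 12) at 1 by lia; ring).
  assert (Hu : 0 <= u < 12) by (apply Z.mod_pos_bound; lia).
  assert (Hclass : odd_class (u - 12 * a) = odd_class u) by (unfold odd_class; rewrite even_sub_12; reflexivity).
  rewrite Ht, Hclass, Nk_shift, !first_above_shift.
  cut (2 * u + 3 < 3 * (first_above (Nk u) 0 + first_above (Nk u) (odd_class u))); [lia|].
  assert (Hall : forallb (fun k => let u := Z.of_nat k in
    2 * u + 3 <? 3 * (first_above (Nk u) 0 + first_above (Nk u) (odd_class u))) (seq 0 12) = true) by reflexivity.
  rewrite forallb_forall in Hall. specialize (Hall (Z.to_nat u)). rewrite Z2Nat.id in Hall by lia.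
  apply Z.ltb_lt, Hall, in_seq. lia.
Qed.

Lemma even_mod_4 (n : Z) : Z.even (n mod 4) = Z.even n.
Proof.
  rewrite (Z.div_mod n 4) at 2 by lia. replace (4 * (n / 4) + n mod 4) with (n mod 4 + 2 * (2 * (n / 4))) by ring.
  rewrite Z.even_add_mul_2. reflexivity.
Qed.

Lemma plus_exponent_class (t n : Z) : plus_okb t n = true -> n mod 4 = if Z.even n then 0 else odd_class t.
Proof.
  intros Hn. apply plus_okb_iff in Hn. rewrite <- even_mod_4.
  destruct Hn as [-> | ->]; [reflexivity|]. unfold odd_class. destruct (Z.even t); reflexivity.
Qed.

Section NonvanishingCoefficient.

Variables (t m : Z) (f : Z -> C -> C).
Hypothesis Hf : forall i, admissibleb t i = true -> canonical t i (f i).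
Hypothesis Hm : plus_okb t m = true.

Let other_class : Z := if Z.even m then odd_class t else 0.
Let n1 : Z := first_above (Nk t) (m mod 4).
Let n2 : Z := first_above (Nk t) other_class.

Let index (j : nat) : Z := 4 - n2 + 4 * Z.of_nat j.

Lemma other_class_bounds : 0 <= other_class < 4 /\ Z.even other_class = negb (Z.even m).
Proof. unfold other_class, odd_class. destruct (Z.even m), (Z.even t); simpl; lia. Qed.

Lemma index_class (j : nat) : plus_okb t (- index j) = true /\ Z.even (- index j) = negb (Z.even m).
Proof.
  destruct other_class_bounds as [Hbounds Heven].
  destruct (first_above_spec (Nk t) other_class Hbounds) as [_ Hmod]. fold n2 in Hmod.
  assert (Hindex : (- index j) mod 4 = other_class).
  { unfold index. replace (- (4 - n2 + 4 * Z.of_nat j)) with (n2 + (-1 - Z.of_nat j) * 4) by ring.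
    rewrite Z_mod_plus_full. exact Hmod. }
  split; [apply plus_okb_iff; rewrite Hindex; unfold other_class; destruct (Z.even m); auto|].
  rewrite <- even_mod_4, Hindex. exact Heven.
Qed.

Lemma index_qualifies (j : nat) : qualb t m (index j) = true.
Proof.
  destruct (index_class j) as [Hok Heven]. destruct other_class_bounds as [Hbounds _].
  destruct (first_above_spec (Nk t) other_class Hbounds) as [Hn2 _]. fold n2 in Hn2.
  unfold qualb, admissibleb. rewrite <- (Z.opp_involutive (index j)), plus_okb_pred_opp, Hok, Z.opp_involutive.
  rewrite (proj2 (Z.leb_le _ _)), !Bool.andb_true_l by (unfold index; lia).
  apply Bool.negb_true_iff, Z.eqb_neq. intros Heq. rewrite Z.even_opp, <- even_mod_4, Heq, even_mod_4 in Heven.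
  destruct (Z.even m); discriminate.
Qed.

Lemma first_exponents_sum_class : n1 + n2 = first_above (Nk t) 0 + first_above (Nk t) (odd_class t).
Proof.
  unfold n1, n2, other_class. rewrite (plus_exponent_class t m Hm). destruct (Z.even m); ring.
Qed.

Lemma index_canonical (j : nat) : canonical t (index j) (f (index j)).
Proof. apply Hf. assert (Hq := index_qualifies j). unfold qualb in Hq. apply andb_prop in Hq. apply Hq. Qed.

Lemma index_ge (j : nat) : - Nk t <= index j.
Proof.
  destruct (first_above_spec (Nk t) other_class (proj1 other_class_bounds)) as [Hn2 _]. fold n2 in Hn2.
  unfold index. lia.
Qed.

Lemma same_parity_exponent (n : Z) : plus_okb t n = true -> Z.even n = Z.even m -> Nk t < n ->
  exists l : nat, n = n1 + 4 * Z.of_nat l.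
Proof.
  intros Hok Heven Hn. destruct (first_above_spec (Nk t) (m mod 4) (Z.mod_pos_bound m 4 ltac:(lia))) as [Hn1 Hn1_mod].
  fold n1 in Hn1, Hn1_mod. apply plus_exponent_class in Hok. rewrite Heven, <- (plus_exponent_class t m Hm) in Hok.
  exists (Z.to_nat ((n - n1) / 4)). Z.div_mod_to_equations. lia.
Qed.

Lemma fcoef_index_low (n : Z) (j : nat) : n <= Nk t -> n <> - index j -> fcoef (f (index j)) n = RtoC 0.
Proof. destruct (index_canonical j) as [_ [_ Hlow]]. apply Hlow. Qed.

Lemma exists_nonzero_coefficient : Nk t + 4 <= m ->
  exists i, qualb t m i = true /\ i <= m - 2 * Nk t + 2 /\ fcoef (f i) m <> RtoC 0.
Proof.
  intros Hbig. apply NNPP. intros Hnone.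
  destruct (first_above_spec (Nk t) (m mod 4) (Z.mod_pos_bound m 4 ltac:(lia))) as [Hn1 _]. fold n1 in Hn1.
  destruct (first_above_spec (Nk t) other_class (proj1 other_class_bounds)) as [Hn2 _]. fold n2 in Hn2.
  destruct (same_parity_exponent m Hm eq_refl ltac:(lia)) as [M HM].
  destruct (exists_vanishing_combination t index (fun j => f (index j)) (map (fun l => n1 + 4 * Z.of_nat l) (seq 0 M)))
    as [g [Hg [Hg_neq [Hg_exp Hg_common]]]]; [exact index_canonical|exact index_ge|unfold index; lia|].
  rewrite length_map, length_seq in Hg_common.
  assert (Hsame : forall n, Z.even n = Z.even m -> n < m + 4 -> fcoef g n = RtoC 0).
  { intros n Heven Hn. destruct (plus_okb t n) eqn:Hok; [|apply Hg, Hok].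
    destruct (Z_le_gt_dec n (Nk t)) as [Hle|Hgt].
    - apply Hg_common. intros j _. apply fcoef_index_low; [exact Hle|]. intros Heq.
      destruct (index_class j) as [_ Hpar]. rewrite <- Heq, Heven in Hpar. destruct (Z.even m); discriminate.
    - destruct (same_parity_exponent n Hok Heven ltac:(lia)) as [l Hl].
      destruct (Nat.eq_dec l M) as [->|Hne].
      + rewrite Hl, <- HM. apply Hg_common. intros j Hj. apply NNPP. intros Hneq. apply Hnone.
        exists (index j). split; [apply index_qualifies|split; [unfold index; lia|exact Hneq]].
      + apply Hg_exp. rewrite Hl. apply (in_map (fun l => n1 + 4 * Z.of_nat l)), in_seq. lia. }
  assert (Hother : forall n, n < - index M -> fcoef g n = RtoC 0).
  { intros n Hn. apply Hg_common. intros j Hj. unfold index in Hn. apply fcoef_index_low; unfold index; lia. }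
  assert (Hsum := first_exponents_sum_gt t). rewrite <- first_exponents_sum_class in Hsum.
  destruct Hg_neq as [n Hn]. apply Hn. destruct (Z.even m) eqn:Hparity.
  - apply (plus_form_eq_0 t g (m + 4) (- index M) Hg); [auto|auto|unfold index; lia].
  - apply (plus_form_eq_0 t g (- index M) (m + 4) Hg); [auto|auto|unfold index; lia].
Qed.

End NonvanishingCoefficient.

Lemma length_filter_seq_le (p : nat -> bool) (w c : nat) : (0 < w)%nat ->
  (forall s, (length (filter p (seq s w)) <= c)%nat) ->
  forall L s, (length (filter p (seq s L)) <= c * (L / w + 1))%nat.
Proof.
  intros Hw Hwindow L s.
  assert (Hblocks : forall q s, (length (filter p (seq s (w * q))) <= c * q)%nat).
  { induction q as [|q IH]; intros u; [rewrite Nat.mul_0_r; simpl; lia|].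
    replace (w * S q)%nat with (w + w * q)%nat by lia.
    rewrite seq_app, filter_app, length_app. specialize (Hwindow u). specialize (IH (u + w)%nat). lia. }
  assert (Hround : (w * (L / w + 1) = L + (w * (L / w + 1) - L))%nat).
  { assert (Hdiv := Nat.div_mod L w ltac:(lia)). assert (Hmod := Nat.mod_upper_bound L w ltac:(lia)). lia. }
  specialize (Hblocks (L / w + 1)%nat s). rewrite Hround, seq_app, filter_app, length_app in Hblocks. lia.
Qed.

Lemma plus_okb_plus_2 (t n : Z) : plus_okb t n = true -> plus_okb t (n + 2) = false.
Proof.
  intros Hn. apply Bool.not_true_iff_false. intros Hn2. apply plus_okb_iff in Hn, Hn2.
  unfold odd_class in *. destruct (Z.even t); Z.div_mod_to_equations; lia.
Qed.

Lemma rank_le (t m i : Z) : - Nk t <= i -> Z.of_nat (rank t m i) <= (i + Nk t) / 2 + 2.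
Proof.
  intros Hi. unfold rank. set (p := fun k : nat => qualb t m (- Nk t + Z.of_nat k)). set (L := Z.to_nat (i + Nk t)).
  assert (Hskip : forall k, p k = true -> p (S (S k)) = false).
  { intros k Hk. unfold p, qualb, admissibleb in *. apply andb_prop in Hk. destruct Hk as [Hk _].
    apply andb_prop, proj2, plus_okb_plus_2 in Hk.
    replace (- Nk t + Z.of_nat (S (S k))) with (- Nk t + Z.of_nat k + 2) by lia. rewrite Hk, Bool.andb_false_r.
    reflexivity. }
  assert (Hcount := length_filter_seq_le p 4 2 ltac:(lia)).
  assert (Hle : (length (filter p (seq 0 L)) <= 2 * (L / 4 + 1))%nat).
  { apply Hcount. intros s. assert (Hskip0 := Hskip s). assert (Hskip1 := Hskip (S s)). simpl.
    destruct (p s), (p (S s)), (p (S (S s))), (p (S (S (S s)))); simpl; intuition (discriminate || lia). }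
  replace (i + Nk t) with (Z.of_nat L) by (unfold L; lia).
  apply Nat2Z.inj_le in Hle. rewrite Nat2Z.inj_mul, Nat2Z.inj_add, Nat2Z.inj_div in Hle.
  Z.div_mod_to_equations. lia.
Qed.

Lemma b_range_bounds (b : Z) : In b b_range -> 6 <= b <= 19.
Proof. unfold b_range. simpl. lia. Qed.

Lemma Cconst_le (m b : Z) : (Cconst m b <= 7 / 4)%R.
Proof. unfold Cconst. destruct (Z.even m); [destruct (Z.even b)|destruct (existsb (Z.eqb b) _)]; lra. Qed.

Lemma plus_okb_weight_dual (s m : Z) : m mod 4 = 0 \/ m mod 4 = (if Z.even (s - 1) then 1 else 3) ->
  plus_okb (1 - s) m = true.
Proof.
  intros Hm. apply plus_okb_iff. unfold odd_class. replace (1 - s) with (- (s - 1)) by ring. rewrite Z.even_opp.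
  exact Hm.
Qed.

Close Scope Z_scope.

Theorem theorem1p4 :
  exists A B : R, 0 < A /\ A <= 9 /\ 0 < B /\ B <= 109 /\
  forall s a b : Z, s = (12 * a + b)%Z -> In b b_range ->
  forall m : Z, A * IZR (Z.abs a) + B <= IZR m ->
    ((m mod 4 = 0)%Z \/ (m mod 4 = if Z.even (s - 1) then 1 else 3)%Z) ->
  forall f : Z -> C -> C,
    (forall i : Z, admissibleb (1 - s) i = true -> canonical (1 - s) i (f i)) ->
  forall M : Z,
    3 * IZR a + 3 * IZR m / 4 + IZR b / 2 - Cconst m b < IZR M ->
    ~ (forall i : Z, qualb (1 - s) m i = true ->
         (Z.of_nat (rank (1 - s) m i) < M)%Z ->
         fcoef (f i) m = RtoC 0).
Proof.
  exists 9, 109. repeat (split; [lra|]). intros s a b Hs Hb m Hm Hclass f Hf M HM Hvanish.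
  assert (Hm_Z : (9 * Z.abs a + 109 <= m)%Z) by (apply le_IZR; rewrite plus_IZR, mult_IZR; exact Hm).
  assert (HM_Z : (12 * a + 3 * m + 2 * b - 7 < 4 * M)%Z).
  { apply lt_IZR. rewrite minus_IZR, !plus_IZR, !mult_IZR. assert (HC := Cconst_le m b). lra. }
  assert (Hb_bounds := b_range_bounds b Hb). assert (HNk := Nk_bounds (1 - s)).
  destruct (exists_nonzero_coefficient (1 - s) m f Hf (plus_okb_weight_dual s m Hclass)) as [i [Hi [Hi_le Hneq]]];
    [lia|].
  apply Hneq, Hvanish; [exact Hi|].
  assert (Hi_ge : (- Nk (1 - s) <= i)%Z).
  { unfold qualb, admissibleb in Hi. apply andb_prop, proj1, andb_prop, proj1, Z.leb_le in Hi. exact Hi. }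
  assert (Hrank := rank_le (1 - s) m i Hi_ge). Z.div_mod_to_equations. lia.
Qed.
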